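(* Let $X_1,X_2,\dots$ be i.i.d. uniformly random points in $[0,1]^2$. Then, with probability tending to $1$ as $n\to\infty$, \[ \rho_n(\text{Maker wins the connectivity game}) = \rho_n(\text{minimum degree} \geq 2). \]
   Context: For points $x_1,\dots,x_n\in\mathbb{R}^2$ and $r>0$, the geometric graph $G(x_1,\dots,x_n;r)$ has vertex set $\{x_1,\dots,x_n\}$ and an edge $x_ix_j$ iff $\|x_i-x_j\|\le r$ (Euclidean norm). For an increasing graph property $\mathcal{P}$ (closed under isomorphism and under adding edges), the hitting radius is $\rho_n(\mathcal{P}) := \inf\{ r\ge 0 : G(X_1,\dots,X_n;r) \text{ satisfies } \mathcal{P}\}$, where the points $X_1,\dots,X_n$ are kept fixed while taking the infimum. In the Maker-Breaker game on a graph $G$, Breaker and Maker alternately claim unclaimed edges of $G$, Breaker moving first, until all edges are claimed; in the connectivity game Maker wins iff the edges he claimed contain a spanning tree of $G$. ''Maker wins'' means Maker has a winning strategy. *)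

(* Defs.v *)
From HB Require Import structures.
From mathcomp Require Import all_boot all_order all_algebra finmap.
From mathcomp Require Import all_classical all_reals all_analysis.

Set Implicit Arguments.
Unset Strict Implicit.
Unset Printing Implicit Defensive.

Import Order.TTheory GRing.Theory Num.Theory.
Import numFieldNormedType.Exports.

Local Open Scope classical_set_scope.
Local Open Scope ring_scope.

(* A simple graph on the vertex set V is given by its edge set, a set of
   two-element subsets of V. *)
Definition graph (V : finType) := {set {set V}}.

Definition graph_property := forall V : finType, graph V -> Prop.

Section Graphs.
Variable V : finType.
Implicit Type G : graph V.

Definition adj G : rel V := [rel u v | (u != v) && ([set u; v]%SET \in G)].

Definition degree G (v : V) : nat := #|[set e in G | v \in e]%SET|.

Definition connected_graph G : Prop := forall u v : V, connect (adj G) u v.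

(* The cycles of a simple graph are the simple closed paths on at least three
   vertices; closed paths u, v, u running back along an edge do not count. *)
Definition acyclic_graph G : Prop :=
  forall c : seq V, (2 < size c)%N -> ~ ucycle (adj G) c.

Definition is_tree G : Prop := connected_graph G /\ acyclic_graph G.

Definition contains_spanning_tree G : Prop :=
  exists2 T : graph V, T \subset G & is_tree T.

End Graphs.

Definition min_degree_ge (k : nat) : graph_property :=
  fun V G => forall v : V, (k <= degree G v)%N.

(* The Maker-Breaker game played on the edges of G. The state of the game is the
   sequence of the edges claimed so far, in order; Breaker moves first, so he
   claims the edges at even positions (counted from 0) and Maker those at odd
   positions. *)
Section MakerBreaker.
Variables (V : finType) (G : graph V).

Definition history (h : seq {set V}) : Prop := uniq h /\ {subset h <= G}.

Definition complete_play (p : seq {set V}) : Prop := perm_eq p (enum G).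

Definition maker_edges (p : seq {set V}) : graph V :=
  [set e in p | odd (index e p)]%SET.

(* A strategy for Maker answers every history in which it is Maker's turn and
   some edge is still unclaimed with an unclaimed edge. *)
Definition maker_strategy (s : seq {set V} -> {set V}) : Prop :=
  forall h, history h -> odd (size h) -> (size h < #|G|)%N ->
    s h \in G /\ s h \notin h.

Definition follows (s : seq {set V} -> {set V}) (p : seq {set V}) : Prop :=
  forall i, (i < size p)%N -> odd i -> nth finset.set0 p i = s (take i p).

Definition maker_wins (win : graph V -> Prop) : Prop :=
  exists2 s, maker_strategy s &
    forall p, complete_play p -> follows s p -> win (maker_edges p).

End MakerBreaker.

Definition maker_wins_connectivity : graph_property :=
  fun V G => maker_wins G (@contains_spanning_tree V).

Section GeometricGraph.
Variable R : realType.

(* The norm of the product R * R in the library is the maximum norm. *)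
Definition euclidean_dist (a b : R * R) : R :=
  Num.sqrt ((a.1 - b.1) ^+ 2 + (a.2 - b.2) ^+ 2).

(* The i-th vertex stands for the point x i. *)
Definition geometric_graph (n : nat) (x : 'I_n -> R * R) (r : R) : graph 'I_n :=
  [set e : {set 'I_n} | [exists i, exists j,
     [&& i != j, euclidean_dist (x i) (x j) <= r & e == [set i; j]%SET]]]%SET.

(* Extended-real infimum: it is +oo when no radius yields the property. *)
Definition hitting_radius (Q : graph_property) (n : nat) (x : 'I_n -> R * R)
    : \bar R :=
  ereal_inf [set r%:E | r in [set r : R | 0 <= r /\ Q _ (geometric_graph x r)]].

End GeometricGraph.

Section Probability.
Context {d : measure_display} {T : measurableType d} {R : realType}.
Variable P : probability T R.

Definition mutually_independent (I : choiceType) d' (S : measurableType d')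
    (X : I -> {RV P >-> S}) : Prop :=
  forall (J : {fset I}) (A : I -> set S), (forall i, measurable (A i)) ->
    P (\bigcap_(i in [set` J]) (X i @^-1` A i)) =
    (\prod_(i <- J) P (X i @^-1` A i))%E.

Definition unit_square : set (R * R) := `[0, 1] `*` `[0, 1].

Definition uniform_on_unit_square (X : {RV P >-> (R * R)%type}) : Prop :=
  forall A : set (R * R), measurable A ->
    distribution P X A =
    (@lebesgue_measure R \x @lebesgue_measure R)%E (A `&` unit_square).

End Probability.

(* Main.v *)
(* Maker wins on a graph with two edge-disjoint spanning connected subgraphs: he
   answers each claimed edge of one of them by an edge of the other one. Call a
   vertex set doubly connected if two edge-disjoint subgraphs connect it. Cut the
   square into cells and take the radius r0 at which the expected number lam of
   points in a disc satisfies exp (- lam) n sqrt(ln n) = 1, up to a constant. The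
   expected number of points having exactly one other point within r0 is then of
   order sqrt(ln n), and by a second moment estimate some vertex has degree at
   most 1 at r0, so both hitting radii exceed r0. For r >= r0 the maximal doubly
   connected set C reaches every small window of the square. A vertex outside C
   has at most one neighbour in C; if the minimum degree is 2 and C is not
   everything, there is a component of at least two points outside C. It is
   confined to a window, and beyond its leftmost, rightmost, top and bottom
   points lie four quarter discs with at most one point each. These have total
   area that of a disc plus a term linear in the width w of the component; summed
   over w the expected number of such configurations is O(1 / sqrt(ln n)).
   Boundary components lose some quarter discs, but also degrees of freedom. All
   probabilities are computed by counting assignments of points to cells. *)
Require Import Defs.
From HB Require Import structures.
From mathcomp Require Import all_boot all_order all_algebra.
From mathcomp Require Import zify ring lra.
From mathcomp Require Import reals sequences exp.

Set Implicit Arguments.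
Unset Strict Implicit.
Unset Printing Implicit Defensive.

Import Order.TTheory GRing.Theory Num.Theory.

(** * Maker's strategy and doubly connected sets *)

(** The choice of [r0] balances two orders. With [lam] near [ln n], pairs of points with nobody else
    nearby number about [n ln n exp (- lam)], whereas obstructing components number about
    [n exp (- lam)]; the value [n sqrt (ln n) exp (- lam) = 1] makes the first large and the second
    small. The second order is delicate: one free point in each of the left and right half discs
    would cost a factor [(ln n)^2] and ruin the bound. It is saved because two such points must each
    avoid the disc of the opposite extreme point, which leaves two thin crescents of size
    proportional to the width [w]. The obstruction is stated with discs of radius [r0] only, so that
    one event settles all radii [r >= r0] at once. The radius [r0] measures [4 b] cells with [b]
    about [ln n]. A cell then holds about [1 / b] points in expectation, and the O(b) cells that
    meet the boundary of a disc change exponents by O(1): rounding to cells costs constant factors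
    only, although the estimates must be sharp to within a power of [ln n]. *)

Section Connectivity.
Variable V : finType.
Implicit Types (G E M B : graph V) (u v w : V) (A : {set V}) (e : {set V}).

Lemma adjC G u v : adj G u v = adj G v u.
Proof. by rewrite /adj /= eq_sym setUC. Qed.

Lemma adj_connect_sym G : connect_sym (adj G).
Proof. by apply/sym_connect_sym => u v; rewrite adjC. Qed.

Lemma adj_sub G G' u v : G \subset G' -> adj G u v -> adj G' u v.
Proof. by move=> /subsetP sGG' /andP[uv Guv]; rewrite /adj /= uv sGG'. Qed.

Lemma connect_adj_sub G G' u v :
  G \subset G' -> connect (adj G) u v -> connect (adj G') u v.
Proof.
by move=> sGG'; apply: connect_sub => x y /(adj_sub sGG'); apply: connect1.
Qed.

Lemma connected_graphS G G' :
  G \subset G' -> connected_graph G -> connected_graph G'.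
Proof. by move=> sGG' cG u v; apply: connect_adj_sub (cG u v). Qed.

Lemma connect_crossing (r : rel V) (A : {pred V}) u v :
  connect r u v -> u \in A -> v \notin A ->
  exists x y, [/\ x \in A, y \notin A & r x y].
Proof.
case/connectP=> p; elim: p u => [|w p IHp] u /=.
  by move=> _ -> uA /negP[].
case/andP=> ruw pP vE uA vA; have [wA|wA] := boolP (w \in A).
  exact: IHp pP vE wA vA.
by exists u, w.
Qed.

(** Deleting [e] leaves at most two pieces of [E1], and the connected [E2] has an edge across such a
    cut; that edge [g] restores connectivity. The whole strategy of Maker rests on this exchange. *)
Lemma crossing_exchange E1 E2 e :
  connected_graph E1 -> connected_graph E2 ->
  connected_graph (E1 :\ e) \/
  exists2 g, g \in E2 & connected_graph (g |: (E1 :\ e)).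
Proof.
move=> cE1 cE2; set E := E1 :\ e.
have [/forallP cE|] := boolP [forall x, forall y, connect (adj E) x y].
  by left=> x y; apply/(forallP (cE x)).
rewrite negb_forall => /existsP[x]; rewrite negb_forall => /existsP[y nxy].
right; pose A := [pred z | connect (adj E) x z].
have [|u [v [uA vA]]] := connect_crossing (cE2 x y) (_ : x \in A) nxy.
  by rewrite inE connect0.
rewrite /adj /= => /andP[uv E2uv]; exists [set u; v] => //.
set E' := _ |: _.
have sEE' : E \subset E' by rewrite subsetUr.
have E'uv : adj E' u v by rewrite /adj /= uv !inE eqxx.
have adjEe p q : adj E1 p q -> ~~ adj E p q -> [set p; q] = e.
  by rewrite /adj /= /E !inE => /andP[-> ->]; rewrite andbT /= negbK => /eqP.
(* [A] and [Z] are the components of [x] and [v] after the deletion. [E1] leaves each of them, and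
   only [e] can be the exit; hence the end [t] of [e] outside [A] lies in [Z], and the path from [s]
   to [t] through [g] replaces [e]. *)
pose Z := [pred z | connect (adj E) v z].
have xZ : x \notin Z.
  by rewrite inE /= adj_connect_sym; apply: contra vA; rewrite inE.
have [|p [q [pZ qZ E1pq]]] := connect_crossing (cE1 v x) (_ : v \in Z) xZ.
  by rewrite inE connect0.
have [|s [t [sA tA E1st]]] := connect_crossing (cE1 x v) (_ : x \in A) vA.
  by rewrite inE connect0.
have pqe : [set p; q] = e.
  apply: adjEe => //; apply: contra qZ => Epq.
  by rewrite !inE in pZ *; apply: connect_trans pZ (connect1 Epq).
have ste : [set s; t] = e.
  apply: adjEe => //; apply: contra tA => Est.
  by rewrite !inE in sA *; apply: connect_trans sA (connect1 Est).
have svt : connect (adj E) v t.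
  have : p \in [set s; t] by rewrite ste -pqe !inE eqxx.
  rewrite !inE => /orP[/eqP ps|/eqP <-]; last by rewrite inE in pZ.
  case/negP: vA; rewrite !inE in sA pZ *; apply: connect_trans sA _.
  by rewrite adj_connect_sym -ps.
have E'st : connect (adj E') s t.
  apply: (@connect_trans _ _ u).
    apply: (connect_adj_sub sEE'); apply: (@connect_trans _ _ x).
      by rewrite adj_connect_sym; rewrite inE in sA.
    by rewrite inE in uA.
  by apply: connect_trans (connect1 E'uv) _; apply: connect_adj_sub svt.
move=> a b; apply: (connect_sub _ (cE1 a b)) => {a b} a b E1ab.
have [/(adj_sub sEE')/connect1//|/(adjEe _ _ E1ab) abe] := boolP (adj E a b).
have ab : a != b by case/andP: E1ab.
have /setP abst : [set a; b] = [set s; t] by rewrite ste.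
move: (abst a) (abst b); rewrite !inE !eqxx orbT /= => /esym/orP[]/eqP-> /esym/orP[]/eqP->.
- exact: connect0.
- exact: E'st.
- by rewrite adj_connect_sym.
- exact: connect0.
Qed.

(** An inclusion-minimal connected edge set has no cycle, since the rest of a cycle bypasses any of
    its edges. *)
Lemma connected_contains_spanning_tree G :
  connected_graph G -> contains_spanning_tree G.
Proof.
move=> cG.
pose conn E := [forall x, forall y, connect (adj E) x y].
have connP E : reflect (connected_graph E) (conn E).
  apply: (iffP idP) => [/forallP cE x y|cE]; first exact/(forallP (cE x)).
  by apply/forallP => x; apply/forallP.
have [|T /minsetP[/connP cT minT] sTG] := @minset_exists _ conn G.
  exact/connP.
exists T => //; split=> //.
case=> [//|x [//|y p]] szp /= /andP[cyc uniqc].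
pose e := [set x; y].
have eT : e \in T by case/andP: cyc => /andP[].
suff cTe : connected_graph (T :\ e).
  have /setP/(_ e) := minT _ (introT (connP _) cTe) (subsetDl _ _).
  by rewrite !inE eqxx eT.
have xy : x != y by case/andP: cyc => /andP[].
suff cyx : connect (adj (T :\ e)) y x.
  move=> a b; apply: (connect_sub _ (cT a b)) => {a b} a b Tab.
  have [abe|abe] := eqVneq [set a; b] e; last first.
    by apply: connect1; case/andP: Tab => ab Tab; rewrite /adj /= ab !inE abe.
  move: Tab => /andP[ab _].
  move/setP: abe => abe; move: (abe a) (abe b); rewrite !inE !eqxx orbT /=.
  move=> /esym/orP[]/eqP-> /esym/orP[]/eqP->; rewrite ?connect0 //.
  by rewrite adj_connect_sym.
have : path (adj T) y (rcons p x) by case/andP: cyc.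
move: szp uniqc => /=; rewrite !inE negb_or => szp /and3P[/andP[_ xp] yp up].
case: p szp {cyc} xp yp up => [//|z p] _ xp yp up /= /andP[Tyz pP].
have yz : y != z by move: yp; rewrite inE; case: eqP.
apply: (@connect_trans _ _ z).
  apply: connect1; case/andP: Tyz => _ Tyz; rewrite /adj /= yz !inE Tyz andbT /=.
  apply/eqP => /setP/(_ z); rewrite !inE eqxx orbT => /esym/orP[]/eqP zz.
    by move: xp; rewrite zz inE eqxx.
  by rewrite zz eqxx in yz.
(* The remaining path never returns to [y], so none of its edges is [e]. *)
move: yp; have: y \notin z :: p -> path (adj (T :\ e)) z (rcons p x).
  elim: p z pP {Tyz yz xp up} => [|t p IHp] z /= /andP[/andP[zt Tzt] pP].
    rewrite inE => yz; rewrite andbT /adj /= zt !inE Tzt andbT.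
    apply/eqP => /setP/(_ y); rewrite !inE eqxx orbT (negPf yz) /=.
    by rewrite (negPf (_ : y != x)) // eq_sym.
  rewrite !inE !negb_or => /and3P[yz yt yp].
  rewrite IHp ?inE ?negb_or ?yt // andbT /adj /= zt !inE Tzt andbT.
  apply/eqP => /setP/(_ y); rewrite !inE eqxx orbT (negPf yz) /=.
  by rewrite (negPf yt).
by move=> h /h zP; apply/connectP; exists (rcons p x); rewrite ?last_rcons.
Qed.

Lemma contains_spanning_tree_connected G :
  contains_spanning_tree G -> connected_graph G.
Proof. by case=> T sTG [cT _]; apply: connected_graphS cT. Qed.

End Connectivity.

(** * Maker's strategy, and Breaker's win at a vertex of low degree *)

Section Game.
Variables (V : finType) (G : graph V).
Implicit Types (E M B : graph V) (e g : {set V}) (h p : seq {set V}).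

Definition breaker_edges p : graph V := [set e in p | ~~ odd (index e p)].

(* After contracting Maker's edges and deleting Breaker's, there are still two
   edge-disjoint spanning connected subgraphs: an edge of Maker may serve in
   both. *)
Definition maker_safe B M : Prop :=
  exists E1 E2, [/\ E1 \subset G :\: B, E2 \subset G :\: B,
    connected_graph E1, connected_graph E2 & E1 :&: E2 \subset M].

Lemma maker_safeS B M M' : M \subset M' -> maker_safe B M -> maker_safe B M'.
Proof.
move=> sMM' [E1 [E2 [s1 s2 c1 c2 sM]]]; exists E1, E2; split=> //.
exact: subset_trans sM sMM'.
Qed.

(** Breaker's new edge [e] is not Maker's, so it lies in at most one of the two subgraphs, say [E1];
    an exchange edge [g] of [E2] repairs [E1]. Once [g] is Maker's it may be shared, so [E2] need
    not give it up. *)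
Lemma maker_safe_step B M e : maker_safe B M -> e \notin M ->
  maker_safe (e |: B) M \/
  exists g, [/\ g \in G, g != e, g \notin B, g \notin M &
                maker_safe (e |: B) (g |: M)].
Proof.
case=> E1 [E2 [s1 s2 c1 c2 sM]] eM.
wlog eE2 : E1 E2 s1 s2 c1 c2 sM / e \notin E2 => [wlg|].
  have [eE2|eE2] := boolP (e \in E2); last exact: (wlg E1 E2).
  apply: (wlg E2 E1) => //; first by rewrite setIC.
  by apply: contra eM => eE1; apply: (subsetP sM); rewrite inE eE1.
have sub E : E \subset G :\: B -> e \notin E -> E \subset G :\: (e |: B).
  move=> sE eE; apply/subsetP => g gE; have := subsetP sE g gE.
  rewrite !inE negb_or => /andP[-> ->]; rewrite !andbT.
  by apply: contraNneq eE => <-.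
have s1' : E1 :\ e \subset G :\: (e |: B).
  apply: sub; last by rewrite !inE eqxx.
  exact: subset_trans (subsetDl _ _) s1.
have sM' : (E1 :\ e) :&: E2 \subset M.
  apply: subset_trans sM; exact/setSI/subsetDl.
have [c1'|[g gE2 c1']] := crossing_exchange e c1 c2.
  by left; exists (E1 :\ e), E2; split=> //; apply: sub.
have ge : g != e by apply: contraNneq eE2 => <-.
have gGB : g \in G :\: (e |: B) by apply: (subsetP (sub _ s2 eE2)).
have gsafe : maker_safe (e |: B) (g |: M).
  exists (g |: E1 :\ e), E2; split=> //; last 1 first.
  - by rewrite setIUl setUSS // subsetIl.
  - by rewrite subUset sub1set gGB.
  - exact: sub.
(* If [g] already belongs to Maker, the repair is free and his answer can be arbitrary. *)
have [gM|gM] := boolP (g \in M).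
  by left; move: gsafe; rewrite (setUidPr (_ : [set g] \subset M)) ?sub1set.
right; exists g; split=> //; move: gGB; rewrite !inE negb_or => /andP[/andP[]] //.
Qed.

Lemma index_rcons_notin (T : eqType) (s : seq T) x y : x \notin s ->
  index y (rcons s x) = if y \in s then index y s else size s + (x != y).
Proof.
move=> xs; rewrite -cats1 index_cat /=; case: ifP => // _.
by case: (x == y).
Qed.

Lemma breaker_edges_rcons h e : e \notin h -> breaker_edges (rcons h e) =
  if odd (size h) then breaker_edges h else e |: breaker_edges h.
Proof.
move=> eh; apply/setP => g.
rewrite [LHS]inE index_rcons_notin // mem_rcons inE.
have [gh|gh] := boolP (g \in h).
  rewrite orbT /=; case: ifP => _; rewrite !inE gh //.
  by case: eqP gh eh => [-> ->|].
case: (eqVneq g e) => [->|ge] /=.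
  by rewrite addn0; case: ifP => oh; rewrite !inE ?eqxx ?oh //= (negPf eh).
by case: ifP => _; rewrite !inE (negPf gh) ?(negPf ge).
Qed.

Lemma maker_edges_rcons h e : e \notin h -> maker_edges (rcons h e) =
  if odd (size h) then e |: maker_edges h else maker_edges h.
Proof.
move=> eh; apply/setP => g.
rewrite [LHS]inE index_rcons_notin // mem_rcons inE.
have [gh|gh] := boolP (g \in h).
  rewrite orbT /=; case: ifP => _; rewrite !inE gh //.
  by case: eqP gh eh => [-> ->|].
case: (eqVneq g e) => [->|ge] /=.
  by rewrite addn0; case: ifP => oh; rewrite !inE ?eqxx ?oh //= (negPf eh).
by case: ifP => _; rewrite !inE (negPf gh) ?(negPf ge).
Qed.

Definition connectedb E := [forall x, forall y, connect (adj E) x y].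

Lemma connectedP E : reflect (connected_graph E) (connectedb E).
Proof.
apply: (iffP idP) => [/forallP cE x y|cE]; first exact/(forallP (cE x)).
by apply/forallP => x; apply/forallP.
Qed.

Definition maker_safeb B M := [exists E1 : graph V, exists E2 : graph V,
  [&& E1 \subset G :\: B, E2 \subset G :\: B,
      connectedb E1, connectedb E2 & E1 :&: E2 \subset M]].

Lemma maker_safeP B M : reflect (maker_safe B M) (maker_safeb B M).
Proof.
apply: (iffP existsP) => [[E1 /existsP[E2 /and5P[]]]|[E1 [E2 [? ? c1 c2 ?]]]].
  by move=> s1 s2 /connectedP c1 /connectedP c2 sM; exists E1, E2.
exists E1; apply/existsP; exists E2.
by apply/and5P; split=> //; apply/connectedP.
Qed.

Definition safe_history h := maker_safeb (breaker_edges h) (maker_edges h).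

(** The fallback to an arbitrary unclaimed edge keeps the answer legal on histories from which no
    safe one is available. *)
Definition safe_strategy h : {set V} :=
  if [pick g in G | (g \notin h) && safe_history (rcons h g)] is Some g then g
  else if [pick g in G | g \notin h] is Some g then g else set0.

Lemma safe_strategyP : maker_strategy G safe_strategy.
Proof.
move=> h [uh sh] _ szh; rewrite /safe_strategy.
case: pickP => [g /and3P[]//|_]; case: pickP => [g /andP[]//|h_all].
suff : #|G| <= size h by rewrite leqNgt szh.
rewrite -(card_uniqP uh); apply: subset_leq_card; apply/subsetP => g gG.
by have := h_all g; rewrite /= gG /= => /negbFE.
Qed.

Lemma maker_breaker_edges p e : e \in p ->
  (e \in maker_edges p) = (e \notin breaker_edges p).
Proof. by move=> ep; rewrite !inE ep /= negbK. Qed.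

Lemma complete_play_mem p : complete_play G p -> uniq p /\ p =i G.
Proof.
move=> pG; split; first by rewrite (perm_uniq pG) enum_uniq.
by move=> e; rewrite (perm_mem pG) mem_enum.
Qed.

Lemma safe_strategy_even p i : complete_play G p -> follows safe_strategy p ->
  i.*2 <= size p -> safe_history [::] -> safe_history (take i.*2 p).
Proof.
move=> pG fp + safe0; have [up mp] := complete_play_mem pG.
elim: i => [|i IHi]; first by rewrite take0.
rewrite doubleS => szp; have szp1 : i.*2.+1 <= size p by exact: ltnW.
have {IHi} := IHi (ltnW szp1).
set h := take i.*2 p; set e := nth set0 p i.*2; set g := nth set0 p i.*2.+1.
have hE : take i.*2.+1 p = rcons h e by rewrite (take_nth set0).
have hgE : take i.*2.+2 p = rcons (rcons h e) g by rewrite (take_nth set0) ?hE.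
have szh : size h = i.*2 by rewrite size_takel // ltnW.
have uhe : uniq (rcons h e) by rewrite -hE take_uniq.
have uhg : uniq (rcons (rcons h e) g) by rewrite -hgE take_uniq.
have eh : e \notin h by move: uhe; rewrite rcons_uniq => /andP[].
have ghe : g \notin rcons h e by move: uhg; rewrite rcons_uniq => /andP[].
have gG : g \in G by rewrite -mp mem_nth.
have gE : g = safe_strategy (rcons h e).
  by rewrite -hE; apply: fp; rewrite //= odd_double.
have ohe : odd (size (rcons h e)) by rewrite size_rcons szh /= odd_double.
have hnext g' : g' \notin rcons h e -> safe_history (rcons (rcons h e) g') =
    maker_safeb (e |: breaker_edges h) (g' |: maker_edges h).
  move=> g'he; rewrite /safe_history breaker_edges_rcons // ohe.
  rewrite maker_edges_rcons // ohe breaker_edges_rcons // maker_edges_rcons //.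
  by rewrite szh odd_double.
move/maker_safeP => safe_h.
have eM : e \notin maker_edges h by rewrite inE (negPf eh).
suff [g' /and3P[g'G g'he safe_g']] :
    exists g', [&& g' \in G, g' \notin rcons h e &
                   safe_history (rcons (rcons h e) g')].
  rewrite hgE; move: gE; rewrite /safe_strategy; case: pickP => [g2|/(_ g')].
    by move=> /and3P[_ _ ?] ->.
  by rewrite /= g'G g'he safe_g'.
(* When no repair is called for, the move [g] actually played shows that a safe answer exists:
   additional edges of Maker never hurt. *)
have [safe_he|[g' [g'G g'e g'B g'M safe_g']]] := maker_safe_step safe_h eM.
  exists g; rewrite gG ghe hnext //=; apply/maker_safeP.
  by apply: maker_safeS safe_he; rewrite subsetUr.
have g'he : g' \notin rcons h e.
  rewrite mem_rcons inE (negPf g'e) /=; apply: contra g'M => g'h.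
  by rewrite maker_breaker_edges.
by exists g'; rewrite g'G g'he hnext //=; apply/maker_safeP.
Qed.

Lemma safe_subset_maker p E : p =i G ->
  E \subset G :\: breaker_edges p -> E \subset maker_edges p.
Proof.
move=> mp /subsetP sE; apply/subsetP => e /sE; rewrite inE => /andP[eB eG].
by rewrite maker_breaker_edges // mp.
Qed.

(** Two disjoint connected subgraphs make the empty history safe. Once all edges are claimed, [G]
    without Breaker's edges is Maker's graph, so a safe final position makes it connected. *)
Theorem maker_wins_connectivity_two_connected E1 E2 :
  E1 \subset G -> E2 \subset G -> [disjoint E1 & E2] ->
  connected_graph E1 -> connected_graph E2 ->
  maker_wins G (@contains_spanning_tree V).
Proof.
move=> s1 s2 dE c1 c2; exists safe_strategy; first exact: safe_strategyP.
move=> p pG fp; apply: connected_contains_spanning_tree.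
have [up mp] := complete_play_mem pG.
have safe0 : safe_history [::].
  apply/maker_safeP; exists E1, E2.
  have nB : G :\: breaker_edges [::] = G.
    by apply/setP => e; rewrite !inE.
  rewrite nB; split=> //; move: dE; rewrite -setI_eq0 => /eqP->.
  exact: sub0set.
have szp : size p = odd (size p) + (size p)./2.*2 by rewrite odd_double_half.
have := safe_strategy_even pG fp _ safe0; move=> /(_ (size p)./2).
rewrite {2}szp leq_addl => /(_ isT).
case: (boolP (odd (size p))) szp => [op|_]; rewrite /= ?add0n ?add1n => szp.
  have iltp : (size p)./2.*2 < size p by rewrite {2}szp.
  have pE : p = rcons (take (size p)./2.*2 p) (nth set0 p (size p)./2.*2).
    by rewrite -take_nth // -szp take_size.
  move: pE; set h := take _ p; set e := nth _ _ _ => pE.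
  have szh : size h = (size p)./2.*2 by rewrite size_takel // ltnW.
  have eh : e \notin h by move: up; rewrite pE rcons_uniq => /andP[].
  have eM : e \notin maker_edges h by rewrite inE (negPf eh).
  move/maker_safeP => safe_h.
  have BE : breaker_edges p = e |: breaker_edges h.
    by rewrite pE breaker_edges_rcons // szh odd_double.
  have ME : maker_edges p = maker_edges h.
    by rewrite pE maker_edges_rcons // szh odd_double.
  (* With an odd number of edges Breaker moves last; the alternative that asks Maker for an answer
     would need an unclaimed edge, and none is left. *)
  have [[F1 [F2 [s1' _ c1' _ _]]]|] := maker_safe_step safe_h eM.
    by apply: connected_graphS c1'; apply: safe_subset_maker; rewrite // BE.
  case=> g [gG ge gB gM _]; move: gG; rewrite -mp pE mem_rcons inE (negPf ge) /=.
  by move=> /maker_breaker_edges; rewrite (negPf gM) gB.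
rewrite -szp take_size => /maker_safeP[F1 [F2 [s1' _ c1' _ _]]].
by apply: connected_graphS c1'; apply: safe_subset_maker.
Qed.

(** Turns a short opening against [s] into a full play, so that the guarantee of [s] on complete
    plays applies to it; Breaker continues with arbitrary edges. *)
Lemma complete_play_extend s h : maker_strategy G s -> history G h ->
  follows s h ->
  exists p, [/\ complete_play G p, follows s p & take (size h) p = h].
Proof.
move=> sP; have [k] := ubnP (#|G| - size h).
elim: k h => [//|k IHk] h ltk [uh sh] fh.
have szh : size h <= #|G|.
  by rewrite -(card_uniqP uh); apply: subset_leq_card; apply/subsetP.
have [ltG|geG] := ltnP (size h) #|G|; last first.
  exists h; rewrite take_size; split=> //.
  have sGh : {subset h <= enum G} by move=> e /sh; rewrite mem_enum.
  apply: uniq_perm => //; first exact: enum_uniq.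
  by apply: (uniq_min_size uh sGh _).2; rewrite -cardE.
have [e [eG eh es]] : exists e, [/\ e \in G, e \notin h & odd (size h) -> e = s h].
  case: (boolP (odd (size h))) => oh.
    by exists (s h); have [] := sP h (conj uh sh) oh ltG.
  have /subsetPn[e eG eh] : ~~ (G \subset h).
    apply/negP => /subset_leq_card; rewrite (card_uniqP uh) leqNgt ltG //.
  by exists e.
have [|||p [pG fp ph]] := IHk (rcons h e).
- by rewrite size_rcons subnS -ltnS (leq_trans _ ltk) // ltnS prednK ?subn_gt0.
- split; first by rewrite rcons_uniq eh uh.
  by move=> g; rewrite mem_rcons inE => /orP[/eqP->|/sh].
- move=> i; rewrite size_rcons ltnS leq_eqVlt => /orP[/eqP->|ih] oi.
    by rewrite nth_rcons ltnn eqxx es // -cats1 take_size_cat.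
  by rewrite nth_rcons ih fh // -cats1 takel_cat // ltnW.
exists p; split=> //.
have := congr1 (take (size h)) ph; rewrite take_takel ?size_rcons //.
by rewrite -cats1 take_size_cat.
Qed.

(** If [v] has degree at most one, Breaker opens with its edge, if there is one, and [v] stays
    isolated in Maker's graph; a second vertex makes this fatal. *)
Theorem maker_wins_connectivity_min_degree : 1 < #|V| ->
  maker_wins G (@contains_spanning_tree V) -> forall v, 1 < degree G v.
Proof.
move=> V1 [s sP winS] v; rewrite ltnNge; apply/negP => degv.
have [u vu] : exists u, u != v.
  apply/existsP; rewrite -negb_forall; apply/negP => /forallP all_v.
  move: V1; rewrite ltnNge => /negP; apply; rewrite -(cards1 v).
  by apply/subset_leq_card/subsetP => w _; rewrite inE.
have [h [hG fh szh hv]] : exists h, [/\ history G h, follows s h, size h <= 1 &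
    forall e, e \in G -> v \in e -> e \in h].
  have [/eqP|[e0 e0v]] := set_0Vmem [set e in G | v \in e].
    rewrite -subset0 => /subsetP D0; exists [::]; split=> // e eG ve.
    by have := D0 e; rewrite !inE eG ve => /(_ isT).
  exists [:: e0]; split=> //.
  - by split=> // e; rewrite inE => /eqP->; move: e0v; rewrite inE => /andP[].
  - by move=> [|[|]].
  - move=> e eG ve; rewrite inE.
    have /card_le1_eqP D1 : #|[set e in G | v \in e]| <= 1 by [].
    by apply/eqP; apply: D1 => //; rewrite inE eG.
have [p [pG fp ph]] := complete_play_extend sP hG fh.
have [up mp] := complete_play_mem pG.
have /contains_spanning_tree_connected cM := winS p pG fp.
have [|x [y [+ _ /andP[_]]]] :=
  connect_crossing (cM v u) (_ : v \in pred1 v) vu; first exact/eqP.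
rewrite inE => /eqP->; rewrite inE => /andP[vyp].
have vyh : [set v; y] \in h by apply: hv; rewrite -?mp // !inE eqxx.
suff idx0 : index [set v; y] p = 0 by rewrite idx0.
rewrite -[p](cat_take_drop (size h)) ph index_cat vyh.
by apply/eqP; rewrite -leqn0 -ltnS (leq_trans _ szh) // index_mem.
Qed.

End Game.

(** * Doubly connected vertex sets and their maximal extensions *)

Section DoublyConnected.
Variables (V : finType) (G : graph V).
Implicit Types (E : graph V) (u v w x y : V) (C : {set V}).

Definition neighbours v : {set V} := [set u | adj G v u].

Definition spans E C := [forall u in C, forall v in C, connect (adj E) u v].

Definition inside E C := [forall e in E, e \subset C].

(** Keeping the edges inside [C] leaves those at every outside vertex free, which is what allows [C]
    to absorb further vertices. *)
Definition doubly_connected C := [exists E1 : graph V, exists E2 : graph V,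
  [&& E1 \subset G, E2 \subset G, [disjoint E1 & E2],
      inside (E1 :|: E2) C, spans E1 C & spans E2 C]].

Lemma doubly_connectedP C : reflect
  (exists E1 E2, [/\ E1 \subset G, E2 \subset G, [disjoint E1 & E2],
      forall e, e \in E1 :|: E2 -> e \subset C &
      {in C &, forall u v, connect (adj E1) u v /\ connect (adj E2) u v}])
  (doubly_connected C).
Proof.
apply: (iffP existsP) => [[E1 /existsP[E2]]|[E1 [E2 [s1 s2 d12 i12 c12]]]].
  case/and5P=> s1 s2 d12 /forall_inP i12 /andP[/forall_inP c1 /forall_inP c2].
  exists E1, E2; split=> // u v uC vC; split.
    exact: (forall_inP (c1 u uC)).
  exact: (forall_inP (c2 u uC)).
exists E1; apply/existsP; exists E2; rewrite s1 s2 d12 /=.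
apply/and3P; split; first exact/forall_inP.
  by apply/forall_inP => u uC; apply/forall_inP => v vC; case: (c12 u v uC vC).
by apply/forall_inP => u uC; apply/forall_inP => v vC; case: (c12 u v uC vC).
Qed.

Lemma spans_from E C x :
  {in C, forall u, connect (adj E) u x} -> {in C &, forall u v, connect (adj E) u v}.
Proof.
move=> cx u v uC vC; apply: connect_trans (cx u uC) _.
by rewrite adj_connect_sym cx.
Qed.

(** Of two edges from [v] into [C], one is given to each subgraph. *)
Lemma doubly_connected_add C v : doubly_connected C ->
  v \notin C -> 1 < #|C :&: neighbours v| -> doubly_connected (v |: C).
Proof.
case/doubly_connectedP => E1 [E2 [s1 s2 d12 i12 c12]] vC.
case/card_gt1P => x [y [+ + xy]]; rewrite !inE.
move=> /andP[xC /andP[vx Gvx]] /andP[yC /andP[vy Gvy]].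
apply/doubly_connectedP; exists ([set v; x] |: E1), ([set v; y] |: E2).
have notin E z : E \subset E1 :|: E2 -> [set v; z] \notin E.
  move=> sE; apply/negP => /(subsetP sE)/i12/subsetP/(_ v).
  by rewrite !inE eqxx (negPf vC) => /(_ isT).
have vx1 : adj ([set v; x] |: E1) v x by rewrite /adj /= vx !inE eqxx.
have vy2 : adj ([set v; y] |: E2) v y by rewrite /adj /= vy !inE eqxx.
split; rewrite ?subUset ?sub1set ?Gvx ?Gvy //.
- rewrite -setI_eq0; apply/eqP/setP => e; rewrite !inE.
  apply/negP => /andP[/orP[/eqP->|e1] /orP[/eqP|e2]].
  + move/setP/(_ x); rewrite !inE eqxx orbT (negPf xy) orbF.
    by rewrite eq_sym (negPf vx).
  + by move: e2; rewrite (negPf (notin _ _ (subsetUr _ _))).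
  + by move=> ee; move: e1; rewrite ee (negPf (notin _ _ (subsetUl _ _))).
  + by move: d12; rewrite -setI_eq0 => /eqP/setP/(_ e); rewrite !inE e1 e2.
- move=> e; rewrite !inE => /orP[/orP[/eqP->|e1]|/orP[/eqP->|e2]].
  + by rewrite subUset !sub1set !inE eqxx xC orbT.
  + by apply: (subset_trans (i12 e _)); rewrite ?inE ?e1 ?subsetUr.
  + by rewrite subUset !sub1set !inE eqxx yC orbT.
  + by apply: (subset_trans (i12 e _)); rewrite ?inE ?e2 ?orbT ?subsetUr.
- move=> a b aC bC; split.
    apply: (spans_from (x := x) _ aC bC) => u; rewrite !inE => /orP[/eqP->|uC].
      exact: connect1.
    by apply: connect_adj_sub (c12 u x uC xC).1; rewrite subsetUr.
  apply: (spans_from (x := y) _ aC bC) => u; rewrite !inE => /orP[/eqP->|uC].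
    exact: connect1.
  by apply: connect_adj_sub (c12 u y uC yC).2; rewrite subsetUr.
Qed.

(* K4 is the union of the two Hamiltonian paths a-b-c-d and b-d-a-c. *)
Lemma doubly_connected_K4 a b c d : uniq [:: a; b; c; d] ->
  {in [:: a; b; c; d] &, forall u v, u != v -> adj G u v} ->
  exists2 C, doubly_connected C & {subset [:: a; b; c; d] <= C}.
Proof.
rewrite /= !inE !negb_or !andbT => /and3P[/and3P[ab ac ad] /andP[bc bd] cd] cl.
have clG u v : u \in [:: a; b; c; d] -> v \in [:: a; b; c; d] -> u != v ->
    [set u; v] \in G by move=> ui vi uv; case/andP: (cl u v ui vi uv).
pose E1 : graph V := [set [set a; b]; [set b; c]; [set c; d]].
pose E2 : graph V := [set [set b; d]; [set d; a]; [set a; c]].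
exists [set:: [:: a; b; c; d]]; last by move=> u; rewrite inE.
have neqs x y (A : {set V}) z : (z \in [set x; y]) != (z \in A) -> [set x; y] != A.
  by apply: contraNneq => ->.
have [ba ca da] : [/\ b != a, c != a & d != a] by rewrite !(eq_sym _ a).
have [cb db dc] : [/\ c != b, d != b & d != c].
  by rewrite (eq_sym c) !(eq_sym d).
have nE := (negPf ab, negPf ac, negPf ad, negPf bc, negPf bd, negPf cd,
            negPf ba, negPf ca, negPf da, negPf cb, negPf db, negPf dc).
have e1 x y : [set x; y] \in E1 -> x != y -> adj E1 x y.
  by rewrite /adj /= => -> ->.
have e2 x y : [set x; y] \in E2 -> x != y -> adj E2 x y.
  by rewrite /adj /= => -> ->.
apply/doubly_connectedP; exists E1, E2; split.
- by rewrite !subUset !sub1set !clG ?inE ?eqxx ?orbT.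
- by rewrite !subUset !sub1set !clG ?inE ?eqxx ?orbT.
- rewrite -setI_eq0; apply/eqP/setP => e; rewrite !inE; apply/negP => /andP[].
  case/orP=> [/orP[]|] /eqP->; apply/negP; rewrite !negb_or -!andbA; apply/and3P.
  + by split; [apply: (neqs _ _ _ a)|apply: (neqs _ _ _ b)|apply: (neqs _ _ _ b)];
      rewrite !inE !eqxx ?orbT ?nE.
  + by split; [apply: (neqs _ _ _ c)|apply: (neqs _ _ _ b)|apply: (neqs _ _ _ b)];
      rewrite !inE !eqxx ?orbT ?nE.
  + by split; [apply: (neqs _ _ _ c)|apply: (neqs _ _ _ c)|apply: (neqs _ _ _ d)];
      rewrite !inE !eqxx ?orbT ?nE.
- move=> e; rewrite !inE => /orP[/orP[/orP[]|]|/orP[/orP[]|]] /eqP->;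
    by rewrite subUset !sub1set !inE !eqxx ?orbT.
- have c1 u : u \in [set:: [:: a; b; c; d]] -> connect (adj E1) u a.
    have h1 : connect (adj E1) b a.
      by rewrite adj_connect_sym; apply/connect1/e1; rewrite // !inE eqxx.
    have h2 : connect (adj E1) c a.
      apply: connect_trans h1; rewrite adj_connect_sym.
      by apply/connect1/e1; rewrite // !inE eqxx ?orbT.
    rewrite !inE => /or4P[] /eqP-> //; apply: connect_trans h2.
    by rewrite adj_connect_sym; apply/connect1/e1; rewrite // !inE eqxx ?orbT.
  have c2 u : u \in [set:: [:: a; b; c; d]] -> connect (adj E2) u a.
    have h1 : connect (adj E2) d a.
      by apply/connect1/e2; rewrite // !inE eqxx ?orbT.
    rewrite !inE => /or4P[] /eqP-> //; last first.
      by rewrite adj_connect_sym; apply/connect1/e2; rewrite // !inE eqxx ?orbT.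
    by apply: connect_trans h1; apply/connect1/e2; rewrite // !inE eqxx ?orbT.
  by move=> u v uC vC; split; [apply: (spans_from c1)|apply: (spans_from c2)].
Qed.

Lemma maximal_doubly_connected C0 : doubly_connected C0 ->
  exists2 C : {set V}, C0 \subset C /\ doubly_connected C &
    forall v, v \notin C -> #|C :&: neighbours v| <= 1.
Proof.
move=> dC0; have [C /maxsetP[dC maxC] sC0C] := maxset_exists dC0.
exists C => // v vC; rewrite leqNgt; apply: contra vC => v2.
have [//|vC] := boolP (v \in C).
have := maxC _ (doubly_connected_add dC vC v2) (subsetUr _ _).
by move/setP/(_ v); rewrite !inE eqxx (negPf vC).
Qed.

Lemma maker_wins_doubly_connected :
  doubly_connected [set: V] -> maker_wins G (@contains_spanning_tree V).
Proof.
case/doubly_connectedP => E1 [E2 [s1 s2 d12 _ c12]].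
apply: (maker_wins_connectivity_two_connected s1 s2 d12) => u v.
  by case: (c12 u v) => //; rewrite inE.
by case: (c12 u v) => //; rewrite inE.
Qed.

Lemma degree_neighbours v :
  (forall e, e \in G -> exists u w, u != w /\ e = [set u; w]) ->
  degree G v = #|neighbours v|.
Proof.
move=> pairs; rewrite /degree.
have -> : [set e in G | v \in e] = [set [set v; u] | u in neighbours v].
  apply/setP => e; rewrite inE; apply/andP/imsetP => [[eG]|[u]].
    have [x [y [xy eE]]] := pairs e eG.
    rewrite eE !inE => /orP[] /eqP vE; subst v.
      by exists y; rewrite // inE /adj /= xy -eE.
    by exists x; rewrite 1?setUC // inE /adj /= eq_sym xy setUC -eE.
  by rewrite inE /adj /= => /andP[_ Gvu] ->; rewrite Gvu !inE eqxx.
apply: card_in_imset => x y; rewrite !inE => /andP[vx _] /andP[vy _].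
move=> /setP/(_ x); rewrite !inE eqxx orbT => /esym/orP[/eqP xv|/eqP//].
by move: vx; rewrite xv /= eqxx.
Qed.

End DoublyConnected.

(** * From cells to the geometric graph *)

Definition dn (a b : nat) : nat := (a - b) + (b - a).

(* In units of the cell side, points of cells p and q are within distance k if
   [close k p q], and only if [near k p q]. *)
Definition close (k : nat) (p q : nat * nat) : bool :=
  (dn p.1 q.1).+1 ^ 2 + (dn p.2 q.2).+1 ^ 2 <= k ^ 2.

Definition near (k : nat) (p q : nat * nat) : bool :=
  (dn p.1 q.1).-1 ^ 2 + (dn p.2 q.2).-1 ^ 2 <= k ^ 2.

Definition coords (m : nat) (z : 'I_m * 'I_m) : nat * nat := (val z.1, val z.2).

Section Geometry.
Variable R : realType.
Local Open Scope ring_scope.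
Implicit Types (x y : R * R) (p q : nat * nat) (r : R).

Definition in_cell (m : nat) p x : Prop :=
  (p.1%:R <= m%:R * x.1 < p.1%:R + 1) /\ (p.2%:R <= m%:R * x.2 < p.2%:R + 1).

Lemma euclidean_dist_le x y r : 0 <= r ->
  (euclidean_dist x y <= r) = ((x.1 - y.1) ^+ 2 + (x.2 - y.2) ^+ 2 <= r ^+ 2).
Proof.
move=> r0; have {1}-> : r = Num.sqrt (r ^+ 2) by rewrite sqrtr_sqr ger0_norm.
by rewrite /euclidean_dist ler_sqrt ?sqr_ge0.
Qed.

Lemma euclidean_distC x y : euclidean_dist x y = euclidean_dist y x.
Proof. by rewrite /euclidean_dist; congr Num.sqrt; ring. Qed.

Lemma dn_natr (a c : nat) (s t : R) :
  a%:R <= s < a%:R + 1 -> c%:R <= t < c%:R + 1 ->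
  `|s - t| <= (dn a c).+1%:R /\ (dn a c).-1%:R <= `|s - t|.
Proof.
wlog ac : a c s t / (a <= c)%N => [wlg ha hc|].
  have [|/ltnW ca] := leqP a c; first by move/wlg; apply.
  by rewrite distrC (_ : dn a c = dn c a); [exact: wlg|rewrite /dn addnC].
have [e ->] : exists e, c = (a + e)%N by exists (c - a)%N; lia.
have -> : dn a (a + e) = e by rewrite /dn; lia.
rewrite natrD => /andP[s0 s1] /andP[t0 t1]; split.
  by rewrite ler_norml -natr1; have := ler0n R e; lra.
case: e t0 t1 => [|e]; first by rewrite /= normr_ge0.
by rewrite -natr1 /= distrC => t0 t1; apply: le_trans (ler_norm _); lra.
Qed.

Lemma close_dist m k p q x y : (0 < m)%N -> in_cell m p x -> in_cell m q y ->
  close k p q -> euclidean_dist x y <= k%:R / m%:R.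
Proof.
move=> m0 [x1 x2] [y1 y2]; rewrite /close => cl.
have mR : 0 < m%:R :> R by rewrite ltr0n.
rewrite euclidean_dist_le ?divr_ge0 ?ler0n //.
have [d1 _] := dn_natr x1 y1; have [d2 _] := dn_natr x2 y2.
rewrite -(ler_pM2l (_ : 0 < m%:R ^+ 2)) ?exprn_gt0 //.
rewrite -[X in _ <= X]exprMn mulrCA mulfV ?gt_eqF // mulr1.
have -> : m%:R ^+ 2 * ((x.1 - y.1) ^+ 2 + (x.2 - y.2) ^+ 2) =
  (m%:R * x.1 - m%:R * y.1) ^+ 2 + (m%:R * x.2 - m%:R * y.2) ^+ 2 by ring.
rewrite -(ler_nat R) natrD !natrX in cl; apply: le_trans cl.
by rewrite -[X in X + _ <= _]real_normK ?num_real // -[X in _ + X <= _]real_normK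
  ?num_real // lerD // lerXn2r ?nnegrE.
Qed.

Lemma dist_near m k p q x y : (0 < m)%N -> in_cell m p x -> in_cell m q y ->
  euclidean_dist x y <= k%:R / m%:R -> near k p q.
Proof.
move=> m0 [x1 x2] [y1 y2].
have mR : 0 < m%:R :> R by rewrite ltr0n.
rewrite euclidean_dist_le ?divr_ge0 ?ler0n //.
have [_ d1] := dn_natr x1 y1; have [_ d2] := dn_natr x2 y2.
rewrite -(ler_pM2l (_ : 0 < m%:R ^+ 2)) ?exprn_gt0 //.
rewrite -[X in _ <= X]exprMn mulrCA mulfV ?gt_eqF // mulr1.
have -> : m%:R ^+ 2 * ((x.1 - y.1) ^+ 2 + (x.2 - y.2) ^+ 2) =
  (m%:R * x.1 - m%:R * y.1) ^+ 2 + (m%:R * x.2 - m%:R * y.2) ^+ 2 by ring.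
move=> h; rewrite /near -(ler_nat R) natrD !natrX; apply: le_trans h.
by rewrite -[X in _ <= X + _]real_normK ?num_real // -[X in _ <= _ + X]real_normK
  ?num_real // lerD // lerXn2r ?nnegrE.
Qed.

(* (u + w)^2 <= 3/2 u^2 + 3 w^2, with |u| <= r/2 and |w|^2 <= 2 (r/4)^2. *)
Lemma half_segment_dist (p q z v : R * R) (r t : R) :
  0 <= r -> 0 <= t <= 2^-1 -> euclidean_dist p q <= r ->
  z.1 = (1 - t) * p.1 + t * q.1 -> z.2 = (1 - t) * p.2 + t * q.2 ->
  `|v.1 - z.1| <= r / 4 -> `|v.2 - z.2| <= r / 4 -> euclidean_dist p v <= r.
Proof.
move=> r0 /andP[t0 t1]; rewrite !euclidean_dist_le // => pq z1 z2 v1 v2.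
have sq (a : R) : `|a| <= r / 4 -> a ^+ 2 <= r ^+ 2 / 16.
  move=> h; rewrite -[a ^+ 2]real_normK ?num_real //.
  have -> : r ^+ 2 / 16 = (r / 4) ^+ 2 by field.
  by rewrite lerXn2r ?nnegrE // divr_ge0.
have {v1}w1 := sq _ v1; have {v2}w2 := sq _ v2.
have E a c d : 2 * (a - d) ^+ 2 <= 3 * (a - c) ^+ 2 + 6 * (d - c) ^+ 2 :> R.
  rewrite -subr_ge0; have -> : 3 * (a - c) ^+ 2 + 6 * (d - c) ^+ 2 -
    2 * (a - d) ^+ 2 = (a - c + 2 * (d - c)) ^+ 2 by ring.
  exact: sqr_ge0.
have e1 := E p.1 z.1 v.1; have e2 := E p.2 z.2 v.2.
have tt : t ^+ 2 <= 4^-1.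
  have -> : 4^-1 = (2^-1) ^+ 2 :> R by field.
  by rewrite lerXn2r ?nnegrE // invr_ge0.
have h1 : (p.1 - z.1) ^+ 2 + (p.2 - z.2) ^+ 2 =
    t ^+ 2 * ((p.1 - q.1) ^+ 2 + (p.2 - q.2) ^+ 2) by rewrite z1 z2; ring.
have h2 : t ^+ 2 * ((p.1 - q.1) ^+ 2 + (p.2 - q.2) ^+ 2) <= 4^-1 * r ^+ 2.
  by apply: ler_pM; rewrite ?addr_ge0 ?sqr_ge0.
have r2 := sqr_ge0 r; lra.
Qed.

(* The exit point of a segment from an intersection of half-planes. *)
Lemma segment_exit (I : finType) (gp gq : I -> R) :
  (forall i, gp i <= 0) -> (exists i, 0 < gq i) ->
  exists t i, [/\ 0 <= t <= 1, 0 < gq i, (1 - t) * gp i + t * gq i = 0 &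
    forall j, (1 - t) * gp j + t * gq j <= 0].
Proof.
move=> gp0 [i0 gq0]; pose F i := gp i / (gp i - gq i).
have [i gqi mini] := @Order.TotalTheory.arg_minP _ _ _ i0 (fun i => 0 < gq i) F gq0.
have d i' : 0 < gq i' -> gp i' - gq i' < 0 by have := gp0 i'; lra.
have tE i' : 0 < gq i' -> F i' * (gp i' - gq i') = gp i'.
  by move=> h; rewrite mulfVK // lt_eqF ?d.
have Fi := tE i gqi; have di := d i gqi; have pi := gp0 i.
have t0 : 0 <= F i by rewrite /F mulr_le0 // invr_le0 ltW.
have t1 : F i <= 1 by rewrite /F ler_ndivrMr // mul1r; lra.
exists (F i), i; split=> //; first by rewrite t0.
  lra.
move=> j; have [gqj|gqj] := ltP 0 (gq j).
  have := mini j gqj; have := tE j gqj; have := d j gqj; nra.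
have := gp0 j; nra.
Qed.

End Geometry.

(** * Obstructions and the components that produce them *)

Section Regions.
Variable k : nat.
Implicit Types a b c d z : nat * nat.

Definition left_region a z : bool := (z.1 < a.1) && close k a z.
Definition right_region b z : bool := (b.1 < z.1) && close k b z.
(** Only columns between the extreme points are used. This keeps the region apart from the left and
    right ones and limits it to order [(w + 1) b] cells for a configuration of width [w], so that a
    point in it is cheap. *)
Definition upper_region a b c z : bool :=
  [&& a.1 <= z.1, z.1 <= b.1, c.2 < z.2 & close k c z].
Definition lower_region a b d z : bool :=
  [&& a.1 <= z.1, z.1 <= b.1, z.2 < d.2 & close k d z].

(** The last conjunct orients the configuration: at least as wide as tall. The opposite case is
    treated by swapping coordinates. *)
Definition box Q a b c d : bool :=
  [&& a.1 <= c.1 <= b.1, a.1 <= d.1 <= b.1, d.2 <= a.2 <= c.2,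
      d.2 <= b.2 <= c.2 & c.2 - d.2 <= b.1 - a.1 <= Q].

End Regions.

Definition occupied_once (n : nat) (g : 'I_n -> nat * nat)
    (P : nat * nat -> bool) : Prop :=
  forall i j, P (g i) -> P (g j) -> i = j.

(* The vertices ia, ib, ic, id are extreme to the left, right, top and bottom in
   a component of the complement of the doubly connected core; each of them has
   at most one neighbour in the core. *)
Definition obstruction (k Q n : nat) (g : 'I_n -> nat * nat) : Prop :=
  exists ia ib ic id : 'I_n,
    [/\ ia != ib, box Q (g ia) (g ib) (g ic) (g id),
        occupied_once g (left_region k (g ia)) /\
        occupied_once g (right_region k (g ib)),
        occupied_once g (upper_region k (g ia) (g ib) (g ic)) /\
        occupied_once g (lower_region k (g ia) (g ib) (g id)) &
        forall i j, left_region k (g ia) (g i) -> right_region k (g ib) (g j) ->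
          ~~ close k (g ib) (g i) /\ ~~ close k (g ia) (g j)].

(** A point close to an extreme point of [S] and beyond it is a neighbour outside [S], hence in [C],
    where the extreme point has at most one neighbour. *)
Lemma obstruction_component (k Q n : nat) (g : 'I_n -> nat * nat)
    (e : rel 'I_n) (S C : {set 'I_n}) :
  1 < #|S| -> [disjoint S & C] ->
  (forall p q, p != q -> close k (g p) (g q) -> e p q) ->
  {in S, forall p q, e p q -> (q \in S) || (q \in C)} ->
  (forall p q q', p \in S -> q \in C -> q' \in C -> e p q -> e p q' -> q = q') ->
  {in S &, forall p q, (g p).1 - (g q).1 <= Q} ->
  (exists2 p0, p0 \in S & exists2 q0, q0 \in S &
     {in S &, forall p q, (g p).2 - (g q).2 <= (g p0).1 - (g q0).1}) ->
  obstruction k Q g.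
Proof.
move=> S1 dSC cl eS eC wQ [p0 p0S [q0 q0S hw]].
have SC v : v \in S -> v \in C -> False.
  by move=> vS vC; move: dSC => /pred0P/(_ v); rewrite /= vS vC.
have [ia /= iaS mina] := @arg_minnP _ p0 [pred i in S] (fun i => (g i).1) p0S.
(* The rightmost point is sought away from [ia], so that two different points are obtained even when
   all of [S] sits in one column of cells. *)
have [ib0 ib0S] : exists ib0, ib0 \in S :\ ia.
  apply/set0Pn; rewrite -card_gt0.
  by move: S1; rewrite (cardsD1 ia) iaS add1n ltnS.
have [ib /= ibSa maxb'] := @arg_maxnP _ ib0 [pred i in S :\ ia] (fun i => (g i).1) ib0S.
have [ibS iab] : ib \in S /\ ia != ib.
  by move: ibSa; rewrite /= !inE eq_sym => /andP[].
have {maxb'} maxb v : v \in S -> (g v).1 <= (g ib).1.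
  move=> vS; have [->|va] := eqVneq v ia; first exact: mina.
  by apply: maxb'; rewrite /= !inE va.
have [ic /= icS maxc] := @arg_maxnP _ p0 [pred i in S] (fun i => (g i).2) p0S.
have [id /= idS mind] := @arg_minnP _ p0 [pred i in S] (fun i => (g i).2) p0S.
have inCreg p z : p \in S -> z \notin S -> close k (g p) (g z) ->
    z \in C /\ e p z.
  move=> pS zS clz; have pz : p != z by apply: contraNneq zS => <-.
  by have epz := cl _ _ pz clz; have := eS p pS z epz; rewrite (negPf zS).
have Lr z : left_region k (g ia) (g z) -> z \in C /\ e ia z.
  case/andP=> lt clz; apply: inCreg => //.
  by apply/negP => zS; have := mina z zS; rewrite leqNgt lt.
have Rr z : right_region k (g ib) (g z) -> z \in C /\ e ib z.
  case/andP=> lt clz; apply: inCreg => //.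
  by apply/negP => zS; have := maxb z zS; rewrite leqNgt lt.
have Ur z : upper_region k (g ia) (g ib) (g ic) (g z) -> z \in C /\ e ic z.
  case/and4P=> _ _ lt clz; apply: inCreg => //.
  by apply/negP => zS; have := maxc z zS; rewrite /= leqNgt lt.
have Dr z : lower_region k (g ia) (g ib) (g id) (g z) -> z \in C /\ e id z.
  case/and4P=> _ _ lt clz; apply: inCreg => //.
  by apply/negP => zS; have := mind z zS; rewrite /= leqNgt lt.
have once p (P : nat * nat -> bool) : p \in S -> (forall z, P (g z) -> z \in C /\ e p z) ->
    occupied_once g P.
  by move=> pS hP i j /hP[iC epi] /hP[jC epj]; apply: eC epi epj.
exists ia, ib, ic, id; split; rewrite ?iab //.
- have h1 := mina _ icS; have h2 := maxb _ icS; have h3 := mina _ idS.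
  have h4 := maxb _ idS; have h5 := maxc _ iaS; have h6 := maxc _ ibS.
  have h7 := mind _ iaS; have h8 := mind _ ibS; have h9 := hw _ _ icS idS.
  have h10 := wQ _ _ ibS iaS; have h11 := maxb _ p0S; have h12 := mina _ q0S.
  rewrite /= in h1 h2 h3 h4 h5 h6 h7 h8 h9 h10 h11 h12.
  rewrite /box h1 h2 h3 h4 h5 h6 h7 h8 /= (leq_trans h9 (leq_sub h11 h12)) /=.
  exact: h10.
- by split; [apply: once iaS Lr|apply: once ibS Rr].
- by split; [apply: once icS Ur|apply: once idS Dr].
move=> i j Li Rj; have [iC eai] := Lr _ Li; have [jC ebj] := Rr _ Rj.
have ij : i != j.
  apply/negP => /eqP ij; move: Li Rj; rewrite ij => /andP[l1 _] /andP[l2 _].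
  by have := ltn_trans (leq_ltn_trans (maxb _ iaS) l2) l1; rewrite ltnn.
(* A left point [i] that is also close to [ib] would be, beside [j], a second core neighbour of
   [ib]; likewise for [j] and [ia]. *)
split; apply: contra ij => clo.
  have eb : e ib i.
    by apply: cl => //; apply/negP => /eqP ibi; apply: (SC ib); rewrite // ibi.
  by apply/eqP; apply: (eC ib).
have ea : e ia j.
  by apply: cl => //; apply/negP => /eqP iaj; apply: (SC ia); rewrite // iaj.
by apply/eqP; apply: (eC ia).
Qed.

(** Pigeonhole: one bad block from each of [K] lines would make [K] bad blocks. *)
Lemma full_line (W K : nat) (P : nat -> nat -> bool) (lo : nat) :
  #|[set IJ : 'I_W * 'I_W | ~~ P IJ.1 IJ.2]| < K -> lo + K <= W ->
  exists2 I, lo <= I < lo + K & forall J, J < W -> P I J.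
Proof.
move=> bad loK.
have [/existsP[t /forallP tP]|] :=
    boolP [exists t : 'I_K, forall J : 'I_W, P (lo + t) J].
  exists (lo + t); first by rewrite leq_addr ltn_add2l ltn_ord.
  by move=> J JW; have := tP (Ordinal JW).
rewrite negb_exists => /forallP none; exfalso; move: bad; apply/negP; rewrite -leqNgt.
have [W0|W0] := posnP W.
  by move: loK; rewrite W0 leqn0 addn_eq0 => /andP[_ /eqP->].
have tW (t : 'I_K) : lo + t < W by apply: leq_trans loK; rewrite ltn_add2l.
pose J (t : 'I_K) := odflt (Ordinal W0) [pick J : 'I_W | ~~ P (lo + t) J].
have JP (t : 'I_K) : ~~ P (lo + t) (J t).
  rewrite /J; case: pickP => //= noJ.
  have := none t; rewrite negb_forall => /existsP[j]; by rewrite noJ.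
pose F t := (Ordinal (tW t), J t).
have injF : injective F.
  by move=> s t [] /addnI/val_inj.
rewrite -[K]card_ord -(card_imset _ injF); apply/subset_leq_card/subsetP.
by move=> _ /imsetP[t _ ->]; rewrite inE; apply: JP.
Qed.

Lemma full_column (W K : nat) (P : nat -> nat -> bool) (lo : nat) :
  #|[set IJ : 'I_W * 'I_W | ~~ P IJ.1 IJ.2]| < K -> lo + K <= W ->
  exists2 J, lo <= J < lo + K & forall I, I < W -> P I J.
Proof.
move=> bad loK; apply: (@full_line W K (fun J I => P I J)) => //.
apply: leq_ltn_trans bad.
pose sw (z : 'I_W * 'I_W) := (z.2, z.1).
have swI : injective sw by move=> [? ?] [? ?] [-> ->].
rewrite -(card_imset _ swI); apply/subset_leq_card/subsetP.
by move=> _ /imsetP[z + ->]; rewrite !inE.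
Qed.

Lemma dn_divn (b c c' : nat) : 0 < b -> dn (c %/ b) (c' %/ b) <= 1 ->
  (dn c c').+1 <= 2 * b.
Proof.
move=> b0; rewrite {2}(divn_eq c b) {2}(divn_eq c' b).
have := ltn_pmod c b0; have := ltn_pmod c' b0.
move: (c %/ b) (c' %/ b) (c %% b) (c' %% b) => q q' s s'.
move=> s'b sb; rewrite /dn => qq.
have [|] : (q = q' \/ q = q'.+1) \/ q' = q.+1 by lia.
  case=> ->; rewrite ?mulSn; last by move: (q' * b) => t; lia.
  by move: (q' * b) => t; lia.
by move=> ->; rewrite mulSn; move: (q * b) => t; lia.
Qed.

(** * Spreading the core through windows of dense blocks *)

Section Blocks.
Variables (n b B K : nat) (g : 'I_n -> nat * nat).
Hypothesis b_gt0 : 0 < b.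
Local Notation W := K.*2.+1.

Definition block (i : 'I_n) : nat * nat := ((g i).1 %/ b, (g i).2 %/ b).

(* Four points of a block span a K4, which is doubly connected. *)
Definition dense I J : bool := 3 < #|[set i | block i == (I, J)]|.

(** With fewer than [K] sparse blocks, any [K] consecutive lines contain a fully dense one. The side
    [2 K + 1] leaves [K] lines on either side of a central one and lets consecutive windows share a
    dense line. *)
Definition window_dense i j : bool :=
  #|[set IJ : 'I_W * 'I_W | ~~ dense (i + IJ.1) (j + IJ.2)]| < K.

Hypothesis g_lt : forall i, (g i).1 < b * B /\ (g i).2 < b * B.
Hypothesis B_ge : W <= B.
Hypothesis windows : forall i j, i + W <= B -> j + W <= B -> window_dense i j.

Definition dense_column i j I : Prop :=
  i <= I < i + W /\ forall J, j <= J < j + W -> dense I J.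
Definition dense_row i j J : Prop :=
  j <= J < j + W /\ forall I, i <= I < i + W -> dense I J.

Lemma exists_dense_column i j lo : i + W <= B -> j + W <= B ->
  i <= lo -> lo + K <= i + W ->
  exists2 I, lo <= I < lo + K & dense_column i j I.
Proof.
move=> iW jW ilo loW.
have [|I IK dI] := @full_line W K (fun I J => dense (i + I) (j + J)) (lo - i)
  (windows iW jW); first lia.
exists (i + I); first lia; split=> [|J Jr]; first lia.
by have := dI (J - j); rewrite subnKC; [apply; lia|lia].
Qed.

Lemma exists_dense_row i j lo : i + W <= B -> j + W <= B ->
  j <= lo -> lo + K <= j + W ->
  exists2 J, lo <= J < lo + K & dense_row i j J.
Proof.
move=> iW jW ilo loW.
have [|J JK dJ] := @full_column W K (fun I J => dense (i + I) (j + J)) (lo - j)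
  (windows iW jW); first lia.
exists (j + J); first lia; split=> [|I Ir]; first lia.
by have := dJ (I - i); rewrite subnKC; [apply; lia|lia].
Qed.

Section Core.
Variables (G : graph 'I_n) (C : {set 'I_n}).
Hypothesis close_adj : forall i j, i != j -> close (4 * b) (g i) (g j) -> adj G i j.
Hypothesis C_closed : forall v, v \notin C -> #|C :&: neighbours G v| <= 1.

Definition block_in_core I J : Prop := forall v, block v = (I, J) -> v \in C.

(** Points of equal or adjacent blocks are less than [2 b] cells apart in each coordinate, and
    [8 b^2 <= 16 b^2]. *)
Lemma block_close u v I J I' J' : block u = (I, J) -> block v = (I', J') ->
  dn I I' <= 1 -> dn J J' <= 1 -> close (4 * b) (g u) (g v).
Proof.
rewrite /block => -[u1 u2] [v1 v2] dI dJ; rewrite /close.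
have h c c' := @dn_divn b c c' b_gt0.
have h1 := h (g u).1 (g v).1; have h2 := h (g u).2 (g v).2.
rewrite u1 v1 in h1; rewrite u2 v2 in h2.
have {}h1 := h1 dI; have {}h2 := h2 dJ.
have e1 : (dn (g u).1 (g v).1).+1 ^ 2 <= (2 * b) ^ 2 by rewrite leq_sqr.
have e2 : (dn (g u).2 (g v).2).+1 ^ 2 <= (2 * b) ^ 2 by rewrite leq_sqr.
apply: leq_trans (leq_add e1 e2) _; rewrite !expnMn -mulnDl leq_mul2r.
by rewrite orbT.
Qed.

Lemma many_core_neighbours v (D : {set 'I_n}) : 1 < #|D| -> D \subset C ->
  (forall u, u \in D -> v != u -> adj G v u) -> v \in C.
Proof.
move=> D1 sDC aD; apply/negPn/negP => vC; have := C_closed vC.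
rewrite leqNgt => /negP; apply; apply: leq_trans D1 _.
apply/subset_leq_card/subsetP => u uD; rewrite !inE (subsetP sDC) //=.
by apply: aD => //; apply: contraNneq vC => ->; apply: (subsetP sDC).
Qed.

(** A dense block of the core offers at least two core neighbours to every point of an adjacent
    block outside the core, which [C_closed] forbids. *)
Lemma block_in_core_spread I J I' J' : dense I J -> block_in_core I J ->
  dn I I' <= 1 -> dn J J' <= 1 -> block_in_core I' J'.
Proof.
move=> dIJ cIJ dI dJ v vb; apply: (many_core_neighbours (ltn_trans (isT : 1 < 3) dIJ)).
  by apply/subsetP => u; rewrite inE => /eqP/cIJ.
move=> u; rewrite inE => /eqP ub vu; apply: close_adj => //.
by apply: block_close vb ub _ _; rewrite /dn addnC.
Qed.

Lemma column_spread i j I J0 : dense_column i j I -> j <= J0 < j + W ->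
  block_in_core I J0 -> forall J, j <= J < j + W -> block_in_core I J.
Proof.
move=> [_ dI] J0r c0.
have up e : J0 + e < j + W -> block_in_core I (J0 + e).
  elim: e => [|e IHe] h; first by rewrite addn0.
  apply: (@block_in_core_spread I (J0 + e)).
  - by apply: dI; lia.
  - by apply: IHe; lia.
  - by rewrite /dn; lia.
  - by rewrite /dn; lia.
have down e : j <= J0 - e -> e <= J0 -> block_in_core I (J0 - e).
  elim: e => [|e IHe] h h'; first by rewrite subn0.
  apply: (@block_in_core_spread I (J0 - e)).
  - by apply: dI; lia.
  - by apply: IHe; lia.
  - by rewrite /dn; lia.
  - by rewrite /dn; lia.
move=> J Jr; have [le|lt] := leqP J0 J.
  by rewrite -(subnKC le); apply: up; lia.
have -> : J = J0 - (J0 - J) by lia.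
by apply: down; lia.
Qed.

Lemma row_spread i j J I0 : dense_row i j J -> i <= I0 < i + W ->
  block_in_core I0 J -> forall I, i <= I < i + W -> block_in_core I J.
Proof.
move=> [_ dJ] I0r c0.
have up e : I0 + e < i + W -> block_in_core (I0 + e) J.
  elim: e => [|e IHe] h; first by rewrite addn0.
  apply: (@block_in_core_spread (I0 + e) J).
  - by apply: dJ; lia.
  - by apply: IHe; lia.
  - by rewrite /dn; lia.
  - by rewrite /dn; lia.
have down e : i <= I0 - e -> e <= I0 -> block_in_core (I0 - e) J.
  elim: e => [|e IHe] h h'; first by rewrite subn0.
  apply: (@block_in_core_spread (I0 - e) J).
  - by apply: dJ; lia.
  - by apply: IHe; lia.
  - by rewrite /dn; lia.
  - by rewrite /dn; lia.
move=> I Ir; have [le|lt] := leqP I0 I.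
  by rewrite -(subnKC le); apply: up; lia.
have -> : I = I0 - (I0 - I) by lia.
by apply: down; lia.
Qed.

Definition window_in_core i j : Prop :=
  (forall I, dense_column i j I -> forall J, j <= J < j + W -> block_in_core I J) /\
  (forall J, dense_row i j J -> forall I, i <= I < i + W -> block_in_core I J).

(** Every full row crosses the given column, so the core spreads from the column to all full rows,
    and from one of them to all full columns. *)
Lemma window_in_core_column i j I J0 : i + W <= B -> j + W <= B ->
  dense_column i j I -> j <= J0 < j + W -> block_in_core I J0 ->
  window_in_core i j.
Proof.
move=> iW jW cI J0r cIJ0; have cIJ := column_spread cI J0r cIJ0.
have rows J : dense_row i j J -> forall I, i <= I < i + W -> block_in_core I J.
  by move=> rJ; apply: (row_spread rJ (proj1 cI)); apply: cIJ; case: rJ.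
split=> // I' cI'.
have [||J _ rJ] := @exists_dense_row i j j iW jW; try lia.
by apply: (column_spread cI' (proj1 rJ)); apply: rows; case: cI'.
Qed.

Lemma window_in_core_row i j J I0 : i + W <= B -> j + W <= B ->
  dense_row i j J -> i <= I0 < i + W -> block_in_core I0 J ->
  window_in_core i j.
Proof.
move=> iW jW rJ I0r rIJ0; have rIJ := row_spread rJ I0r rIJ0.
have [||I _ cI] := @exists_dense_column i j i iW jW; try lia.
apply: (window_in_core_column iW jW cI (proj1 rJ)).
by apply: rIJ; case: cI.
Qed.

(* Consecutive windows share a dense column, or a dense row. *)
Lemma all_windows_in_core : 0 < K -> window_in_core 0 0 ->
  forall i j, i + W <= B -> j + W <= B -> window_in_core i j.
Proof.
move=> K0 w00 i j.
have wi0 : forall i, i + W <= B -> window_in_core i 0.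
  elim=> [//|{}i IHi] iW.
  have [||I Ir cI] := @exists_dense_column i.+1 0 i.+1 iW B_ge; try lia.
  apply: (@window_in_core_column i.+1 0 I 0 iW B_ge cI); first lia.
  apply: (proj1 (IHi _)); [lia| |lia].
  by split; [lia|case: cI].
move=> iW; elim: j => [|j IHj] jW; first exact: wi0.
have [||J Jr rJ] := @exists_dense_row i j.+1 j.+1 iW jW; try lia.
apply: (@window_in_core_row i j.+1 J i iW jW rJ); first lia.
apply: (proj2 (IHj _)); [lia| |lia].
by split; [lia|case: rJ].
Qed.

End Core.
End Blocks.

(** * Components outside the core stay in one window *)

Section Confinement.
Variables (R : realType) (n b B K : nat) (g : 'I_n -> nat * nat).
Variables (x : 'I_n -> R * R) (r : R).
Hypothesis b_gt0 : 0 < b.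
Hypothesis K_gt0 : 0 < K.
Local Notation W := K.*2.+1.
Local Notation m := (b * B).
Hypothesis g_lt : forall i, (g i).1 < m /\ (g i).2 < m.
Hypothesis B_ge : W <= B.
Hypothesis windows :
  forall i j, i + W <= B -> j + W <= B -> window_dense b K g i j.
Hypothesis xg : forall i, in_cell m (g i) (x i).
Hypothesis r_ge : ((4 * b)%:R / m%:R <= r)%R.
Local Notation G := (geometric_graph x r).

Lemma m_gt0 : 0 < m.
Proof. by rewrite muln_gt0 b_gt0 (leq_trans _ B_ge). Qed.

Lemma mR_gt0 : (0 < m%:R :> R)%R.
Proof. by rewrite ltr0n m_gt0. Qed.

Lemma r_ge0 : (0 <= r)%R.
Proof. by apply: le_trans r_ge; rewrite divr_ge0. Qed.

Lemma geometric_graph_pair e : e \in G -> exists u v, u != v /\ e = [set u; v].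
Proof.
by rewrite inE => /existsP[u /existsP[v /and3P[uv _ /eqP->]]]; exists u, v.
Qed.

Lemma adj_geometric i j : adj G i j = (i != j) && (euclidean_dist (x i) (x j) <= r)%R.
Proof.
rewrite /adj /= inE; case: eqVneq => //= ij; apply/existsP/idP; last first.
  by move=> d; exists i; apply/existsP; exists j; rewrite ij d eqxx.
case=> u /existsP[v /and3P[uv d /eqP/setP E]].
have /orP iuv : (i == u) || (i == v) by have := E i; rewrite !inE eqxx => <-.
have /orP juv : (j == u) || (j == v) by have := E j; rewrite !inE eqxx orbT => <-.
move: ij; case: iuv => /eqP->; case: juv => /eqP->; rewrite ?eqxx // => _ //.
by rewrite euclidean_distC.
Qed.

Lemma close_adj_geometric i j :
  i != j -> close (4 * b) (g i) (g j) -> adj G i j.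
Proof.
move=> ij cl; rewrite adj_geometric ij /=; apply: le_trans r_ge.
exact: close_dist m_gt0 (xg i) (xg j) cl.
Qed.

Variable C : {set 'I_n}.
Hypothesis C_closed : forall v, v \notin C -> #|C :&: neighbours G v| <= 1.

Local Open Scope ring_scope.

(* An edge meeting a dense block of the core at [z] has an endpoint within
   [r/2] of [z], hence adjacent to all the points of the block. *)
Lemma edge_avoids_core (I J : nat) p q (t z1 z2 : R) :
  dense b g I J -> block_in_core b g C I J -> p \notin C -> q \notin C ->
  adj G p q -> 0 <= t <= 1 ->
  z1 = (1 - t) * (x p).1 + t * (x q).1 -> z2 = (1 - t) * (x p).2 + t * (x q).2 ->
  (I * b)%:R <= m%:R * z1 <= (I.+1 * b)%:R ->
  (J * b)%:R <= m%:R * z2 <= (J.+1 * b)%:R -> False.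
Proof.
move=> dIJ cIJ; wlog t2 : p q t / t <= 2^-1 => [wlg|] pC qC pq t01 z1E z2E z1I z2J.
  have [t2|t2] := lerP t 2^-1; first exact: (wlg p q t).
  apply: (wlg q p (1 - t)) => //; first lra.
  - by rewrite adjC.
  - by move: t01; lra.
  - by rewrite z1E; ring.
  - by rewrite z2E; ring.
have d : euclidean_dist (x p) (x q) <= r by move: pq; rewrite adj_geometric => /andP[].
case/negP: pC; apply: (many_core_neighbours C_closed (ltn_trans (isT : (1 < 3)%N) dIJ)).
  by apply/subsetP => u; rewrite inE => /eqP/cIJ.
move=> v; rewrite inE => /eqP [v1 v2] pv; rewrite adj_geometric pv /=.
have near_z (c : nat) (s z : R) (L : nat) : (c %/ b)%N = L ->
    c%:R <= m%:R * s < c%:R + 1 -> (L * b)%:R <= m%:R * z <= (L.+1 * b)%:R ->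
    `|s - z| <= r / 4.
  move=> cL /andP[s0 s1] /andP[zl zh].
  have [c0 c1] : (L * b <= c)%N /\ (c.+1 <= L.+1 * b)%N.
    by rewrite -cL leq_trunc_div ltn_ceil.
  rewrite -(ler_nat R) in c0; rewrite -(ler_nat R) -natr1 in c1.
  have bE : (L.+1 * b)%:R = (L * b)%:R + b%:R :> R by rewrite mulSn addnC natrD.
  have : `|m%:R * (s - z)| <= b%:R by rewrite ler_norml; lra.
  rewrite normrM ger0_norm ?ler0n // => h.
  have {}h : `|s - z| <= b%:R / m%:R by rewrite ler_pdivlMr ?mR_gt0 // mulrC.
  apply: le_trans h _; have := r_ge; rewrite [(4 * b)%N]mulnC natrM -mulrA mulrC -mulrA.
  by rewrite (mulrC b%:R); lra.
case: (xg v) => xv1 xv2.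
apply: (@half_segment_dist R (x p) (x q) (z1, z2) (x v) r t r_ge0 _ d z1E z2E).
- by case/andP: t01 => -> _.
- exact: near_z v1 xv1 z1I.
- exact: near_z v2 xv2 z2J.
Qed.

Lemma block_interval (l h : nat) (s : R) : (l < h)%N ->
  (l * b)%:R <= s <= (h * b)%:R ->
  exists2 J : nat, (l <= J < h)%N & (J * b)%:R <= s <= (J.+1 * b)%:R.
Proof.
elim: h => [//|h IHh] lh /andP[s0 s1].
have [sh|/ltW sh] := leP (h * b)%:R s.
  by exists h; [rewrite leqnn andbT|rewrite sh].
have [lh'|hl] := ltnP l h.
  by have [|J Jr JS] := IHh lh'; [rewrite s0|exists J => //; lia].
have lE : l = h by lia.
by exists h; [lia|rewrite -{1}lE s0 s1].
Qed.

Hypothesis core_windows : forall i j, (i + W <= B)%N -> (j + W <= B)%N ->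
  window_in_core b K g C i j.

Definition outside_adj : rel 'I_n :=
  [rel u v | [&& adj G u v, u \notin C & v \notin C]].

Lemma x_bounds i : [/\ 0 <= m%:R * (x i).1, m%:R * (x i).1 <= m%:R,
  0 <= m%:R * (x i).2 & m%:R * (x i).2 <= m%:R].
Proof.
have [/andP[a1 a2] /andP[b1 b2]] := xg i; have [g1 g2] := g_lt i.
rewrite -(ler_nat R) -natr1 in g1; rewrite -(ler_nat R) -natr1 in g2.
have := ler0n R (g i).1; have := ler0n R (g i).2; split; lra.
Qed.

(* [lo] and [hi] are sides of a box around [u]: each is either a side of the
   square or borders a dense row or column of the window. *)
Lemma box_sides i0 Iu (col : nat -> Prop) :
  (i0 <= Iu < i0 + W)%N -> (Iu < B)%N ->
  (i0 = 0%N \/ (i0 + K <= Iu)%N) ->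
  ((i0 + W = B)%N \/ (Iu + K < i0 + W)%N) ->
  (forall lo, (i0 <= lo)%N -> (lo + K <= i0 + W)%N ->
     exists2 I, (lo <= I < lo + K)%N & col I) ->
  exists lo hi, [/\ (i0 <= lo <= Iu)%N, (Iu < hi <= i0 + W)%N,
    lo = 0%N \/ exists2 I, lo = I.+1 & col I & hi = B \/ col hi].
Proof.
move=> Ir IB l h cols.
have [lo [lor loP]] : exists lo, (i0 <= lo <= Iu)%N /\
    (lo = 0%N \/ exists2 I, lo = I.+1 & col I).
  case: l => [i00|iK]; first by exists 0%N; split; [lia|left].
  have [||I Ir2 cI] := cols i0; try lia.
  by exists I.+1; split; [lia|right; exists I].
have [hi [hir hiP]] : exists hi, (Iu < hi <= i0 + W)%N /\ (hi = B \/ col hi).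
  case: h => [iB|iK]; first by exists B; split; [lia|left].
  have [||I Ir2 cI] := cols Iu.+1; try lia.
  by exists I; split; [lia|right].
by exists lo, hi; split.
Qed.

(** A box around [u], bounded by dense core lines or by sides of the square, cannot be left: an edge
    leaving it would cross its border at a point that touches a dense block of the core. *)
Lemma confined u : u \notin C -> exists Q : nat * nat, forall v, connect outside_adj u v ->
    (Q.1 <= (g v).1 <= Q.1 + W * b)%N /\ (Q.2 <= (g v).2 <= Q.2 + W * b)%N.
Proof.
move=> uC.
pose Iu := ((g u).1 %/ b)%N; pose Ju := ((g u).2 %/ b)%N.
have [IuB JuB] : (Iu < B)%N /\ (Ju < B)%N.
  by have [g1 g2] := g_lt u; rewrite /Iu /Ju !ltn_divLR // ![(B * b)%N]mulnC.
(* The window is centred at the block of [u] and pushed back into the grid where it would stick out;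
   there the box may end at the side of the square itself. *)
pose w c := minn (c - K) (B - W).
have wP c : (c < B)%N -> [/\ (w c + W <= B)%N, (w c <= c < w c + W)%N,
    w c = 0%N \/ (w c + K <= c)%N & (w c + W = B)%N \/ (c + K < w c + W)%N].
  have BW : (K + K < B)%N by rewrite addnn.
  by move=> cB; clear -cB BW K_gt0; rewrite /w -addnn; split; lia.
have [i1 i2 i3 i4] := wP Iu IuB; have [j1 j2 j3 j4] := wP Ju JuB.
move: (w Iu) (w Ju) i1 i2 i3 i4 j1 j2 j3 j4 => i j i1 i2 i3 i4 j1 j2 j3 j4.
have [l1 [h1 [l1r h1r l1P h1P]]] := box_sides i2 IuB i3 i4
  (fun lo => @exists_dense_column n b B K g b_gt0 B_ge windows i j lo i1 j1).
have [l2 [h2 [l2r h2r l2P h2P]]] := box_sides j2 JuB j3 j4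
  (fun lo => @exists_dense_row n b B K g b_gt0 B_ge windows i j lo i1 j1).
have [cw rw] := core_windows i1 j1.
have lh1 : (l1 < h1)%N by clear -l1r h1r; lia.
have lh2 : (l2 < h2)%N by clear -l2r h2r; lia.
(* Signed excess over the four sides of the box, in the form required by [segment_exit]. *)
pose gap (s : bool * bool) (y : R * R) : R := match s with
  | (false, false) => (l1 * b)%:R - m%:R * y.1
  | (false, true) => m%:R * y.1 - (h1 * b)%:R
  | (true, false) => (l2 * b)%:R - m%:R * y.2
  | (true, true) => m%:R * y.2 - (h2 * b)%:R end.
pose inbox v := [forall s, gap s (x v) <= 0].
have ubox : inbox u.
  have [/andP[a1 a2] /andP[b1 b2]] := xg u.
  have lo (c l : nat) : (l <= c %/ b)%N -> (l * b)%:R <= c%:R :> R.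
    by move=> lc; rewrite ler_nat (leq_trans _ (leq_trunc_div c b)) // leq_mul2r lc orbT.
  have hi (c h : nat) : (c %/ b < h)%N -> c%:R + 1 <= (h * b)%:R :> R.
    move=> ch; rewrite natr1 ler_nat (leq_trans (ltn_ceil c b_gt0)) //.
    by rewrite leq_mul2r ch orbT.
  have {}l1r := lo _ _ (proj2 (andP l1r)); have {}l2r := lo _ _ (proj2 (andP l2r)).
  have {}h1r := hi _ _ (proj1 (andP h1r)); have {}h2r := hi _ _ (proj1 (andP h2r)).
  by apply/forallP => -[[] []] /=; lra.
have boxP v : connect outside_adj u v -> inbox v.
  move=> uv; apply/negPn/negP => vbox.
  have [p [q [pbox qbox /and3P[pq pC qC]]]] :=
    @connect_crossing _ outside_adj inbox u v uv ubox vbox.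
  have gp s : gap s (x p) <= 0 by apply/(forallP pbox).
  have gq : exists s, 0 < gap s (x q).
    move: qbox; rewrite negb_forall => /existsP[s]; rewrite -ltNge => ?; by exists s.
  have [t [s [t01 gqs gz gzs]]] := segment_exit gp gq.
  pose z1 := (1 - t) * (x p).1 + t * (x q).1.
  pose z2 := (1 - t) * (x p).2 + t * (x q).2.
  have gapz s' : (1 - t) * gap s' (x p) + t * gap s' (x q) = gap s' (z1, z2).
    by case: s' => -[] [] /=; rewrite /z1 /z2; ring.
  have {}gzs s' : gap s' (z1, z2) <= 0 by rewrite -gapz.
  rewrite gapz in gz.
  have z1r : (l1 * b)%:R <= m%:R * z1 <= (h1 * b)%:R.
    by have := gzs (false, false); have := gzs (false, true); rewrite /=; lra.
  have z2r : (l2 * b)%:R <= m%:R * z2 <= (h2 * b)%:R.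
    by have := gzs (true, false); have := gzs (true, true); rewrite /=; lra.
  have [J Jr zJ] := block_interval lh2 z2r; have [I Ir zI] := block_interval lh1 z1r.
  have Jw : (j <= J < j + W)%N by clear -Jr l2r h2r; lia.
  have Iw : (i <= I < i + W)%N by clear -Ir l1r h1r; lia.
  have [x0 xm y0 ym] := x_bounds q.
  have hit I' J' : dense b g I' J' -> block_in_core b g C I' J' ->
      (I' * b)%:R <= m%:R * z1 <= (I'.+1 * b)%:R ->
      (J' * b)%:R <= m%:R * z2 <= (J'.+1 * b)%:R -> False.
    by move=> d c; apply: (edge_avoids_core d c pC qC pq t01).
  (* Exit through a side of the square contradicts the position of [q]; any other exit point lies on
     the closed border of a block in a core line, and [edge_avoids_core] excludes it. *)
  case: s gqs gz => -[] [] /= gqs gz.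
  - case: h2P => [h2B|rh2]; first by move: gqs; rewrite h2B (mulnC B); lra.
    apply: (hit I h2) => //; first by case: rh2 => _; apply.
      exact: rw.
    by rewrite mulSn natrD; have := ler0n R b; lra.
  - case: l2P => [l20|[J' JE rJ]]; first by move: gqs; rewrite l20 mul0n; lra.
    apply: (hit I J') => //; first by case: rJ => _; apply.
      exact: rw.
    by move: gz; rewrite JE mulSn natrD; have := ler0n R b; lra.
  - case: h1P => [h1B|ch1]; first by move: gqs; rewrite h1B (mulnC B); lra.
    apply: (hit h1 J) => //; first by case: ch1 => _; apply.
      exact: cw.
    by rewrite mulSn natrD; have := ler0n R b; lra.
  - case: l1P => [l10|[I' IE cI]]; first by move: gqs; rewrite l10 mul0n; lra.
    apply: (hit I' J) => //; first by case: cI => _; apply.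
      exact: cw.
    by move: gz; rewrite IE mulSn natrD; have := ler0n R b; lra.
exists (l1 * b, l2 * b)%N => v /boxP/forallP vbox.
have [/andP[a1 a2] /andP[b1 b2]] := xg v.
have between (l h c i0 : nat) (s : R) : (i0 <= l)%N -> (h <= i0 + W)%N ->
    c%:R <= s < c%:R + 1 -> (l * b)%:R <= s -> s <= (h * b)%:R ->
    (l * b <= c <= l * b + W * b)%N.
  move=> il hi /andP[s0 s1] ls sh.
  have lc : (l * b < c.+1)%N by rewrite -(ltr_nat R) -natr1; lra.
  have ch : (c <= h * b)%N by rewrite -(ler_nat R); lra.
  rewrite -ltnS lc (leq_trans ch) // -mulnDl leq_mul2r; apply/orP; right.
  by rewrite (leq_trans hi) // leq_add2r.
have v00 := vbox (false, false); have v01 := vbox (false, true).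
have v10 := vbox (true, false); have v11 := vbox (true, true).
rewrite /= in v00 v01 v10 v11.
split.
  apply: (between l1 h1 _ i _ (proj1 (andP l1r)) (proj2 (andP h1r)) (proj1 (xg v))); lra.
apply: (between l2 h2 _ j _ (proj1 (andP l2r)) (proj2 (andP h2r)) (proj2 (xg v))); lra.
Qed.

End Confinement.

Definition swap_coords (p : nat * nat) : nat * nat := (p.2, p.1).

Lemma close_swap k p q : close k (swap_coords p) (swap_coords q) = close k p q.
Proof. by rewrite /close /= addnC. Qed.

(** * The deterministic criterion for double connectivity *)

Section Deterministic.
Variables (R : realType) (n b B K : nat) (g : 'I_n -> nat * nat).
Variables (x : 'I_n -> R * R) (r : R).
Hypothesis b_gt0 : 0 < b.
Hypothesis K_gt0 : 0 < K.
Local Notation W := K.*2.+1.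
Local Notation m := (b * B).
Hypothesis g_lt : forall i, (g i).1 < m /\ (g i).2 < m.
Hypothesis B_ge : W <= B.
Hypothesis windows :
  forall i j, i + W <= B -> j + W <= B -> window_dense b K g i j.
Hypothesis xg : forall i, in_cell m (g i) (x i).
Hypothesis r_ge : ((4 * b)%:R / m%:R <= r)%R.
Local Notation G := (geometric_graph x r).

(** Four points of one dense block in the first window seed the core; the remaining points of that
    block see all four, so the block is in the core and all windows follow. *)
Lemma exists_core : exists2 C : {set 'I_n}, doubly_connected G C /\
  (forall v, v \notin C -> #|C :&: neighbours G v| <= 1) &
  forall i j, i + W <= B -> j + W <= B -> window_in_core b K g C i j.
Proof.
have clA := close_adj_geometric b_gt0 B_ge xg r_ge.
have [||I _ cI] := @exists_dense_column n b B K g b_gt0 B_ge windows 0 0 0 B_ge B_ge.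
- by [].
- by rewrite add0n -addnn -addnS leq_addr.
have dI : dense b g I 0 by case: cI => _; apply.
pose D := [set i | block b g i == (I, 0)].
have : 4 <= size (enum D) by rewrite -cardE.
have := enum_uniq D; have mD i : i \in enum D -> block b g i = (I, 0).
  by rewrite mem_enum inE => /eqP.
move: mD; case: (enum D) => [|a1 [|a2 [|a3 [|a4 s]]]] // mD us _.
have u4 : uniq [:: a1; a2; a3; a4].
  by move: us; rewrite -[_ :: _]/([:: a1; a2; a3; a4] ++ s) cat_uniq => /andP[].
have m4 i : i \in [:: a1; a2; a3; a4] -> block b g i = (I, 0).
  move=> i4; apply: mD; rewrite -[_ :: _]/([:: a1; a2; a3; a4] ++ s).
  by rewrite mem_cat i4.
have [|C0 dC0 sC0] := @doubly_connected_K4 _ G a1 a2 a3 a4 u4.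
  move=> u v /m4 ub /m4 vb uv; apply: clA => //.
  by apply: (block_close b_gt0 ub vb); rewrite /dn subnn.
have [C [sC0C dC] cC] := maximal_doubly_connected dC0.
exists C => // i j; apply: (all_windows_in_core b_gt0 B_ge windows clA cC K_gt0).
apply: (@window_in_core_column n b B K g b_gt0 B_ge windows G C clA cC 0 0 I 0) => //.
move=> v vb; pose D4 := [set:: [:: a1; a2; a3; a4]].
apply: (many_core_neighbours cC (_ : 1 < #|D4|)).
- by rewrite cardsE (card_uniqP u4).
- by apply/subsetP => u; rewrite inE => /sC0; apply: (subsetP sC0C).
move=> u; rewrite inE => /m4 ub vu; apply: clA => //.
by apply: (block_close b_gt0 vb ub); rewrite /dn subnn.
Qed.

(** A vertex [u] outside the core has two neighbours, at most one of them in the core, so its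
    component outside the core has a second point. Being confined, the component yields an
    obstruction, upright or transposed according to the larger of its two extents. *)
Theorem geometric_graph_doubly_connected :
  ~ obstruction (4 * b) (W * b) g ->
  ~ obstruction (4 * b) (W * b) (fun i => swap_coords (g i)) ->
  (forall v, 1 < #|neighbours G v|) ->
  doubly_connected G [set: 'I_n].
Proof.
move=> no_h no_v deg2; have [C [dC cC] wC] := exists_core.
suff <- : C = [set: 'I_n] by [].
apply/setP => u; rewrite [in RHS]inE; apply/negPn/negP => uC.
have [Q conf] := confined b_gt0 K_gt0 g_lt B_ge windows xg r_ge cC wC uC.
pose S := [set v | connect (outside_adj x r C) u v].
have uS : u \in S by rewrite inE connect0.
have SC v : v \in S -> v \notin C.
  move=> vS; apply/negP => vC; have : u \in ~: C by rewrite inE.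
  move/(connect_crossing (r := outside_adj x r C) (A := ~: C) (v := v)).
  rewrite inE in vS; rewrite inE negbK => /(_ vS vC)[p [q [_]]].
  by rewrite inE negbK => qC /and3P[_ _]; rewrite qC.
have dSC : [disjoint S & C].
  apply/pred0P => v /=; apply/negP => /andP[/SC]; exact/negP.
have eS : {in S, forall p q, adj G p q -> (q \in S) || (q \in C)}.
  move=> p pS q pq; have [//|qC] := boolP (q \in C); first by rewrite orbT.
  rewrite orbF; have := SC p pS; rewrite !inE in pS * => pC.
  by apply: connect_trans pS (connect1 _); rewrite /outside_adj /= pq pC qC.
have eC p q q' : p \in S -> q \in C -> q' \in C -> adj G p q -> adj G p q' -> q = q'.
  move=> /SC/cC/card_le1_eqP uniq_nbr qC q'C pq pq'; apply: uniq_nbr.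
    by rewrite !inE q'C.
  by rewrite !inE qC.
have S1 : 1 < #|S|.
  have /subsetPn[v] : ~~ (neighbours G u \subset C).
    apply/negP => /setIidPr NC; have := cC u uC; rewrite NC.
    by rewrite leqNgt deg2.
  rewrite inE => uv vC; apply/card_gt1P; exists u, v; split=> //.
    by have := eS u uS v uv; rewrite (negPf vC) orbF.
  by case/andP: uv.
have clA := close_adj_geometric b_gt0 B_ge xg r_ge.
have conf1 : {in S &, forall p q, (g p).1 - (g q).1 <= W * b}.
  move=> p q; rewrite !inE => /conf[/andP[_ p1] _] /conf[/andP[q1 _] _].
  by rewrite leq_subLR (leq_trans p1) // leq_add2r.
have conf2 : {in S &, forall p q, (g p).2 - (g q).2 <= W * b}.
  move=> p q; rewrite !inE => /conf[_ /andP[_ p1]] /conf[_ /andP[q1 _]].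
  by rewrite leq_subLR (leq_trans p1) // leq_add2r.
pose P2 := [pred z : 'I_n * 'I_n | (z.1 \in S) && (z.2 \in S)].
have P2u : P2 (u, u) by rewrite /= uS.
have [[p0 q0] /= /andP[p0S q0S] max1] :=
  @arg_maxnP _ (u, u) P2 (fun z => (g z.1).1 - (g z.2).1) P2u.
have [[p1 q1] /= /andP[p1S q1S] max2] :=
  @arg_maxnP _ (u, u) P2 (fun z => (g z.1).2 - (g z.2).2) P2u.
have [le|/ltnW le] := leqP ((g p1).2 - (g q1).2) ((g p0).1 - (g q0).1).
  apply: no_h; apply: (@obstruction_component _ _ _ g (adj G) S C) => //.
  exists p0 => //; exists q0 => // p q pS qS.
  by apply: leq_trans le; apply: (max2 (p, q)); rewrite /= pS.
apply: no_v; apply: (@obstruction_component _ _ _ _ (adj G) S C) => //.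
  by move=> p q pq; rewrite close_swap; apply: clA.
exists p1 => //; exists q1 => // p q pS qS /=.
by apply: leq_trans le; apply: (max1 (p, q)); rewrite /= pS.
Qed.

End Deterministic.

(* At radius k, in units of the cell side, i has at most the neighbour j. *)
Definition low_degree (k n : nat) (g : 'I_n -> nat * nat) : Prop :=
  exists i j : 'I_n, forall l, l != i -> l != j -> ~~ near k (g i) (g l).

(** The conditions involve only the cells of the points and the single scale [4 * b], yet they make
    the two graph properties agree at every radius. *)
Definition good_cells (b B K n : nat) (g : 'I_n -> nat * nat) : Prop :=
  [/\ low_degree (4 * b) g,
      forall i j, i + K.*2.+1 <= B -> j + K.*2.+1 <= B -> window_dense b K g i j,
      ~ obstruction (4 * b) (K.*2.+1 * b) g &
      ~ obstruction (4 * b) (K.*2.+1 * b) (fun i => swap_coords (g i))].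

Section HittingRadius.
Variables (R : realType) (n b B K : nat) (g : 'I_n -> nat * nat).
Variables (x : 'I_n -> R * R).
Hypothesis b_gt0 : 0 < b.
Hypothesis K_gt0 : 0 < K.
Local Notation m := (b * B).
Hypothesis g_lt : forall i, (g i).1 < m /\ (g i).2 < m.
Hypothesis B_ge : K.*2.+1 <= B.
Hypothesis xg : forall i, in_cell m (g i) (x i).

Lemma degree_geometric r v :
  degree (geometric_graph x r) v = #|neighbours (geometric_graph x r) v|.
Proof. by apply: degree_neighbours => e; apply: geometric_graph_pair. Qed.

Lemma low_degree_geometric r : low_degree (4 * b) g ->
  (r <= (4 * b)%:R / m%:R)%R -> exists v, degree (geometric_graph x r) v <= 1.
Proof.
case=> i [j far] rle; exists i; rewrite degree_geometric.
rewrite -(cards1 j); apply/subset_leq_card/subsetP => l.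
rewrite !inE adj_geometric => /andP[il d]; apply/negPn/negP => lj.
have m0 : 0 < m by rewrite muln_gt0 b_gt0 (leq_trans _ B_ge).
have := far l; rewrite eq_sym il => /(_ isT lj) /negP; apply.
exact: dist_near m0 (xg i) (xg l) (le_trans d rle).
Qed.

(** Up to radius [4 b / m] a vertex of degree at most one refutes the degree condition; beyond it
    the core argument gives Maker the win. *)
Lemma maker_wins_min_degree r : 1 < n -> good_cells b B K g ->
  maker_wins_connectivity (geometric_graph x r) <->
  min_degree_ge 2 (geometric_graph x r).
Proof.
move=> n1 [low win no_h no_v]; split.
  by apply: maker_wins_connectivity_min_degree; rewrite card_ord.
move=> deg2; have [rle|/ltW rge] := lerP r ((4 * b)%:R / m%:R)%R.
  have [v] := low_degree_geometric low rle; by rewrite leqNgt deg2.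
apply: maker_wins_doubly_connected.
apply: (geometric_graph_doubly_connected b_gt0 K_gt0 g_lt B_ge win xg rge no_h no_v).
by move=> v; rewrite -degree_geometric deg2.
Qed.

Lemma hitting_radius_eq : 1 < n -> good_cells b B K g ->
  hitting_radius maker_wins_connectivity x = hitting_radius (min_degree_ge 2) x.
Proof.
move=> n1 gg; rewrite /hitting_radius; congr (ereal.ereal_inf _).
apply/classical_sets.seteqP; split=> _ [r [r0 h] <-]; exists r => //; split=> //.
  exact/maker_wins_min_degree.
exact/maker_wins_min_degree.
Qed.

End HittingRadius.

(** * Counting assignments of points to cells *)

Section UniformAssignments.
Local Open Scope ring_scope.
Variables (R : realType) (n : nat) (T : finType).
Hypothesis T_gt0 : (0 < #|T|)%N.
Local Notation Omega := {ffun 'I_n -> T}.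
Implicit Types (A B : {set Omega}) (D : {set T}) (f : Omega).

(** The law of the cells of [n] independent uniform points as a normalised count, so that all
    estimates below concern finite sets. *)
Definition pr A : R := #|A|%:R / #|T|%:R ^+ n.
Definition dens D : R := #|D|%:R / #|T|%:R.

Lemma card_T_gt0 : 0 < #|T|%:R :> R.
Proof. by rewrite ltr0n. Qed.

Lemma cardX_T_gt0 : 0 < #|T|%:R ^+ n :> R.
Proof. by rewrite exprn_gt0 ?card_T_gt0. Qed.

Lemma pr_ge0 A : 0 <= pr A.
Proof. by rewrite divr_ge0 ?ler0n ?ltW ?cardX_T_gt0. Qed.

Lemma dens_ge0 D : 0 <= dens D.
Proof. by rewrite divr_ge0 ?ler0n. Qed.

Lemma dens_le1 D : dens D <= 1.
Proof. by rewrite ler_pdivrMr ?card_T_gt0 // mul1r ler_nat max_card. Qed.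

Lemma dens_setC D : dens (~: D) = 1 - dens D.
Proof.
have DC : dens D + dens (~: D) = 1.
  by rewrite /dens -mulrDl -natrD cardsC divff ?gt_eqF ?card_T_gt0.
by rewrite -DC addrAC subrr add0r.
Qed.

Lemma pr_setC A : pr (~: A) = 1 - pr A.
Proof.
have AC : pr A + pr (~: A) = 1.
  by rewrite /pr -mulrDl -natrD cardsC card_ffun card_ord natrX divff ?gt_eqF ?cardX_T_gt0.
by rewrite -AC addrAC subrr add0r.
Qed.

Lemma prS A B : A \subset B -> pr A <= pr B.
Proof.
by move=> s; rewrite ler_pM2r ?invr_gt0 ?cardX_T_gt0 // ler_nat subset_leq_card.
Qed.

Lemma pr_setU A B : pr (A :|: B) <= pr A + pr B.
Proof.
rewrite -mulrDl -natrD ler_pM2r ?invr_gt0 ?cardX_T_gt0 // ler_nat.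
exact: leq_card_setU.
Qed.

Lemma pr_bigcup (I : finType) (P : pred I) (F : I -> {set Omega}) :
  pr (\bigcup_(i | P i) F i) <= \sum_(i | P i) pr (F i).
Proof.
elim/big_rec2: _ => [|i x y _ le]; first by rewrite /pr cards0 mul0r.
by apply: le_trans (pr_setU _ _) _; rewrite lerD2l.
Qed.

Lemma pr_indicator A : pr A = (\sum_f (f \in A)%:R) / #|T|%:R ^+ n.
Proof.
rewrite /pr -sum1_card natr_sum big_mkcond; congr (_ / _).
by apply: eq_bigr => f _; case: (f \in A).
Qed.

Lemma pr_family (F : 'I_n -> {set T}) :
  pr [set f : Omega | [forall i, f i \in F i]] = \prod_i dens (F i).
Proof.
rewrite /pr /dens prodf_div prodr_const card_ord; congr (_ / _).
have -> : #|[set f : Omega | [forall i, f i \in F i]]| = #|family F|.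
  by apply: eq_card => f; rewrite inE; apply/forallP/familyP.
by rewrite card_family -natr_prod foldrE big_map big_enum.
Qed.

(* Distinct points lie in the sets of [As], in order; all the others avoid [D]. *)
Definition occupied (As : seq {set T}) (D : {set T}) : {set Omega} :=
  [set f : Omega | [exists s : (size As).-tuple 'I_n,
     [&& uniq s, all2 (fun i (Q : {set T}) => f i \in Q) s As &
         [forall i, (i \notin s) ==> (f i \notin D)]]]].

Lemma all2_index (U : Type) (u0 : U) (I : eqType) (r : I -> U -> bool) s t i :
  all2 r s t -> i \in s -> r i (nth u0 t (index i s)).
Proof.
elim: s t => [|j s IHs] [|u t] //= /andP[rj rs]; rewrite inE eq_sym.
by case: eqVneq => [<-|] //= _; apply: IHs.
Qed.

Lemma pr_occupied_tuple (As : seq {set T}) (D : {set T})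
    (s : (size As).-tuple 'I_n) : uniq s ->
  pr [set f : Omega | all2 (fun i (Q : {set T}) => f i \in Q) s As &&
        [forall i, (i \notin s) ==> (f i \notin D)]] <=
  \prod_(Q <- As) dens Q * (1 - dens D) ^+ (n - size As).
Proof.
move=> us.
pose F i := if i \in s then nth set0 As (index i s) else ~: D.
apply: (@le_trans _ _ (\prod_i dens (F i))).
  rewrite -pr_family; apply/prS/subsetP => f; rewrite !inE => /andP[fs fD].
  apply/forallP => i; rewrite /F; case: ifPn => is_.
    exact: (all2_index set0 fs is_).
  by rewrite inE; apply: (implyP (forallP fD i)).
rewrite (bigID (mem s)) /= -big_uniq //=; apply: ler_pM.
- by apply: prodr_ge0 => i _; apply: dens_ge0.
- by apply: prodr_ge0 => i _; apply: dens_ge0.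
- rewrite (big_nth set0); case: (posnP n) => [n0|n0].
    have s0 : tval s = [::].
      by case: (tval s) => // i; have := ltn_ord i; rewrite {2}n0.
    by rewrite s0 big_nil -(size_tuple s) s0 big_geq.
  rewrite (big_nth (Ordinal n0)) size_tuple !big_nat.
  apply: ler_prod => l /andP[_ ls].
  by rewrite dens_ge0 /F mem_nth ?size_tuple // index_uniq ?size_tuple ?lexx.
have nE : (n - size As)%N = #|[predC s]|.
  have := cardC (mem s); rewrite card_ord (card_uniqP us) size_tuple => h.
  by rewrite -[in LHS]h addKn.
rewrite nE -prodr_const.
by apply: ler_prod => i /negPf is_; rewrite /F is_ dens_ge0 dens_setC /=.
Qed.

(** A union bound over the at most [n ^ size As] choices of points; each factor [n] turns a density
    into an expected number. *)
Lemma pr_occupied (As : seq {set T}) (D : {set T}) :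
  pr (occupied As D) <=
  \prod_(Q <- As) (n%:R * dens Q) * (1 - dens D) ^+ (n - size As).
Proof.
pose E (s : (size As).-tuple 'I_n) := [set f : Omega |
  all2 (fun i (Q : {set T}) => f i \in Q) s As && [forall i, (i \notin s) ==> (f i \notin D)]].
apply: (@le_trans _ _ (pr (\bigcup_(s : (size As).-tuple 'I_n | uniq s) E s))).
  apply/prS/subsetP => f; rewrite inE => /existsP[s /and3P[us fs fD]].
  by apply/bigcupP; exists s; rewrite ?inE ?fs.
apply: le_trans (pr_bigcup _ _) _.
set rhs := \prod_(Q <- As) dens Q * (1 - dens D) ^+ (n - size As).
have rhs0 : 0 <= rhs.
  rewrite mulr_ge0 ?prodr_ge0 // => [Q _|]; first exact: dens_ge0.
  by rewrite exprn_ge0 // subr_ge0 dens_le1.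
apply: (@le_trans _ _ (\sum_(s : (size As).-tuple 'I_n) rhs)).
  rewrite big_mkcond /=; apply: ler_sum => s _; case: ifP => // us.
  exact: pr_occupied_tuple.
rewrite sumr_const card_tuple card_ord big_split /= -mulrA.
by rewrite big_const_seq count_predT iter_mulr_1 -[X in X <= _]mulr_natl natrX.
Qed.

(** Chebyshev's inequality for the number [N] of events that occur: on assignments without any of
    them, [(N - mu)^2 = mu^2]. *)
Lemma second_moment (I : finType) (E : I -> {set Omega}) (V : R) :
  let mu := \sum_t pr (E t) in
  \sum_t \sum_u pr (E t :&: E u) <= V ->
  pr [set f : Omega | [forall t, f \notin E t]] * mu ^+ 2 <= V - mu ^+ 2.
Proof.
move=> mu hV; pose N f : R := \sum_t (f \in E t)%:R.
have Z0 := cardX_T_gt0; have Zn0 : #|T|%:R ^+ n != 0 :> R by rewrite gt_eqF.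
have EN : \sum_f N f = mu * #|T|%:R ^+ n.
  rewrite exchange_big /= /mu mulr_suml; apply: eq_bigr => t _.
  by rewrite pr_indicator mulfVK.
have EN2 : \sum_f N f ^+ 2 <= V * #|T|%:R ^+ n.
  apply: le_trans (ler_wpM2r (ltW Z0) hV); rewrite le_eqVlt; apply/orP; left.
  rewrite mulr_suml; under [X in _ == X]eq_bigr do rewrite mulr_suml.
  have -> : \sum_f N f ^+ 2 =
      \sum_f \sum_t \sum_u ((f \in E t) && (f \in E u))%:R.
    apply: eq_bigr => f _; rewrite expr2 mulr_suml; apply: eq_bigr => t _.
    by rewrite mulr_sumr; apply: eq_bigr => u _; rewrite -natrM mulnb.
  rewrite exchange_big /=; apply/eqP/eq_bigr => t _.
  rewrite exchange_big /=; apply: eq_bigr => u _.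
  by rewrite pr_indicator mulfVK //; apply: eq_bigr => f _; rewrite inE.
have var : \sum_f (N f - mu) ^+ 2 <= (V - mu ^+ 2) * #|T|%:R ^+ n.
  have -> : \sum_f (N f - mu) ^+ 2 =
      \sum_f N f ^+ 2 + - (2 * mu) * (\sum_f N f) + mu ^+ 2 * #|T|%:R ^+ n.
    have tE f : (N f - mu) ^+ 2 = N f ^+ 2 + - (2 * mu) * N f + mu ^+ 2 by ring.
    under eq_bigr do rewrite tE.
    rewrite !big_split /= -mulr_sumr sumr_const card_ffun card_ord.
    by rewrite -[X in _ + X = _]mulr_natr natrX.
  have -> : - (2 * mu) * \sum_f N f = - 2 * mu ^+ 2 * #|T|%:R ^+ n.
    by rewrite EN; ring.
  by move: EN2; lra.
rewrite -(ler_pM2r Z0); apply: le_trans var.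
rewrite mulrAC /pr mulfVK // mulr_natl -sumr_const big_mkcond /=.
apply: ler_sum => f _; case: ifP => [|_]; last exact: sqr_ge0.
rewrite inE => /forallP nE; rewrite (_ : N f = 0) ?sub0r ?sqrrN //.
by rewrite /N big1 // => t _; rewrite (negPf (nE t)).
Qed.

End UniformAssignments.

(** * Counting cells in quarter discs, half discs and strips *)

Section CellCounts.
Variable m : nat.
Local Notation cell := ('I_m * 'I_m)%type.
Implicit Types (D : {set cell}) (p q : nat * nat).

Lemma coords_inj : injective (@coords m).
Proof. by move=> [x y] [x' y'] [] /val_inj-> /val_inj->. Qed.

Lemma card_cells_ge (I : finType) (A : {set I}) (F : I -> nat * nat) D :
  {in A &, injective F} ->
  (forall i, i \in A -> (F i).1 < m /\ (F i).2 < m) ->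
  (forall i z, i \in A -> coords z = F i -> z \in D) ->
  #|A| <= #|D|.
Proof.
move=> injF Fm FD.
have [->|[i0 i0A]] := set_0Vmem A; first by rewrite cards0.
have m0 : 0 < m by case: (Fm _ i0A) => h _; apply: leq_ltn_trans h.
pose G i : cell := (insubd (Ordinal m0) (F i).1, insubd (Ordinal m0) (F i).2).
have GE i : i \in A -> coords (G i) = F i.
  move=> iA; have [h1 h2] := Fm i iA.
  by rewrite /coords /G /= !val_insubd h1 h2 -surjective_pairing.
rewrite -(card_in_imset (f := G)); last first.
  by move=> i j iA jA /(congr1 (@coords m)); rewrite !GE //; apply: injF.
by apply/subset_leq_card/subsetP => _ /imsetP[i iA ->]; apply: (FD i) => //; apply: GE.
Qed.

Lemma card_cells_le (I : finType) (A : {set I}) (F : nat * nat -> I) D :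
  (forall z z', z \in D -> z' \in D -> F (coords z) = F (coords z') -> z = z') ->
  (forall z, z \in D -> F (coords z) \in A) ->
  #|D| <= #|A|.
Proof.
move=> injF FA; rewrite -(card_in_imset (f := F \o @coords m)) //.
by apply/subset_leq_card/subsetP => _ /imsetP[z zD ->]; apply: FA.
Qed.

Lemma card_rectangle_le x0 y0 s t D :
  (forall z, z \in D -> x0 <= (coords z).1 < x0 + s /\ y0 <= (coords z).2 < y0 + t) ->
  #|D| <= s * t.
Proof.
move=> DP; have [->|[z0 z0D]] := set_0Vmem D; first by rewrite cards0.
have [/andP[h1 h2] /andP[h3 h4]] := DP z0 z0D.
have s0 : 0 < s by move: (leq_ltn_trans h1 h2); rewrite -{1}(addn0 x0) ltn_add2l.
have t0 : 0 < t by move: (leq_ltn_trans h3 h4); rewrite -{1}(addn0 y0) ltn_add2l.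
pose F (p : nat * nat) : 'I_s * 'I_t :=
  (insubd (Ordinal s0) (p.1 - x0), insubd (Ordinal t0) (p.2 - y0)).
rewrite -[s]card_ord -[t in _ * t]card_ord -card_prod -cardsT.
apply: (card_cells_le (F := F)) => [z z' /DP[/andP[a1 a2] /andP[a3 a4]]|z _]; last by rewrite inE.
move=> /DP[/andP[b1 b2] /andP[b3 b4]] /eqP; rewrite /F xpair_eqE => /andP[].
move=> /eqP/(congr1 val) e1 /eqP/(congr1 val) e2; move: e1 e2.
rewrite /= !val_insubd !ltn_subLR // a2 b2 a4 b4 => e1 e2.
apply: coords_inj; rewrite [LHS]surjective_pairing [RHS]surjective_pairing.
by rewrite -(subnK a1) -(subnK b1) -(subnK a3) -(subnK b3) e1 e2.
Qed.

Lemma card_rectangle_ge x0 y0 s t D : x0 + s <= m -> y0 + t <= m ->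
  (forall z, x0 <= (coords z).1 < x0 + s -> y0 <= (coords z).2 < y0 + t -> z \in D) ->
  s * t <= #|D|.
Proof.
move=> sm tm DP; pose F (i : 'I_s * 'I_t) := (x0 + i.1, y0 + i.2).
rewrite -[s]card_ord -[t in _ * t]card_ord -card_prod -cardsT.
apply: (card_cells_ge (F := F)) => [[i j] [i' j'] _ _ [] /addnI/val_inj-> /addnI/val_inj->//|[i j] _|[i j] z _ zE].
  by split; [apply: leq_trans sm|apply: leq_trans tm]; rewrite ltn_add2l.
by apply: DP; rewrite zE leq_addr ltn_add2l ltn_ord.
Qed.

End CellCounts.

(** Index 0 stands for the first cell beside the centre, whose [dn] is 1, and [close] adds one more:
    hence [.+2]. The row and the column of the centre are left out, so that quarters in different
    directions are disjoint. [rx] and [ry] are the numbers of cells available before the sides of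
    the square. *)
Definition quarter (k rx ry : nat) : {set 'I_k * 'I_k} :=
  [set z : 'I_k * 'I_k | [&& z.1.+2 ^ 2 + z.2.+2 ^ 2 <= k ^ 2, z.1 < rx & z.2 < ry]].

Lemma quarter_full k rx ry : k <= rx -> k <= ry -> #|quarter k rx ry| = #|quarter k k k|.
Proof.
move=> hx hy; apply: eq_card => z; rewrite !inE !ltn_ord.
by rewrite (leq_trans (ltn_ord _) hx) (leq_trans (ltn_ord _) hy).
Qed.

Lemma quarter_leq k : #|quarter k k k| <= k ^ 2.
Proof.
by apply: leq_trans (max_card _) _; rewrite card_prod card_ord mulnn.
Qed.

(** A [b] by [2 b] rectangle beside the centre fits in the disc, as [4 b^2 + 9 b^2 <= 16 b^2]. *)
Lemma sum_sqr_leq b s t : 0 < b -> s <= b -> t <= b.*2 ->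
  s.+1 ^ 2 + t.+1 ^ 2 <= (4 * b) ^ 2.
Proof.
move=> b0 sb tb.
have h1 : s.+1 ^ 2 <= (b + b) ^ 2 by rewrite leq_sqr; lia.
have h2 : t.+1 ^ 2 <= (3 * b) ^ 2 by rewrite leq_sqr; lia.
apply: leq_trans (leq_add h1 h2) _; rewrite addnn -mul2n !expnMn -mulnDl leq_mul2r.
by rewrite orbT.
Qed.

Lemma card_quarter_ge b rx ry s t : 0 < b ->
  (s <= b.*2 /\ t <= b) \/ (s <= b /\ t <= b.*2) -> s <= rx -> t <= ry ->
  s * t <= #|quarter (4 * b) rx ry|.
Proof.
move=> b0 st srx try.
have [s4 t4] : s <= 4 * b /\ t <= 4 * b by rewrite -addnn in st; lia.
pose F (i : 'I_s * 'I_t) := (widen_ord s4 i.1, widen_ord t4 i.2).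
have injF : injective F by move=> [i j] [i' j'] [] /val_inj-> /val_inj->.
rewrite -[s]card_ord -[t in _ * t]card_ord -card_prod -(card_imset _ injF).
apply/subset_leq_card/subsetP => _ /imsetP[[i j] _ ->]; rewrite inE /=.
rewrite (leq_trans (ltn_ord i) srx) (leq_trans (ltn_ord j) try) !andbT.
have i_s := ltn_ord i; have j_t := ltn_ord j.
case: st => -[sb tb]; last first.
  by apply: sum_sqr_leq => //; [apply: leq_trans sb|apply: leq_trans tb].
by rewrite addnC; apply: sum_sqr_leq => //; [apply: leq_trans tb|apply: leq_trans sb].
Qed.

Definition step (s : bool) (c i : nat) : nat := if s then c + i.+1 else c - i.+1.
Definition room (m : nat) (s : bool) (c : nat) : nat := if s then m.-1 - c else c.

Lemma dn_step m s c i : i < room m s c -> dn c (step s c i) = i.+1.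
Proof. by rewrite /dn /step /room; case: s; lia. Qed.

Lemma step_lt m s c i : c < m -> i < room m s c -> step s c i < m.
Proof. by rewrite /step /room; case: s; lia. Qed.

Lemma card_quarter_cells m k (sx sy : bool) (p : nat * nat) (D : {set 'I_m * 'I_m}) :
  p.1 < m -> p.2 < m ->
  (forall z i j, i < room m sx p.1 -> j < room m sy p.2 ->
     close k p (coords z) -> coords z = (step sx p.1 i, step sy p.2 j) -> z \in D) ->
  #|quarter k (room m sx p.1) (room m sy p.2)| <= #|D|.
Proof.
move=> p1 p2 DP; pose F (i : 'I_k * 'I_k) := (step sx p.1 i.1, step sy p.2 i.2).
apply: (card_cells_ge (F := F)).
- move=> [i j] [i' j']; rewrite !inE /= => /and3P[_ ir jr] /and3P[_ i'r j'r] [e1 e2].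
  have := dn_step ir; have := dn_step jr; rewrite e1 e2 (dn_step i'r) (dn_step j'r).
  by move=> [/val_inj ->] [/val_inj ->].
- by move=> [i j]; rewrite !inE /= => /and3P[_ ir jr]; split; apply: step_lt.
move=> [i j] z; rewrite !inE /= => /and3P[ij ir jr] zE.
by apply: (DP z i j) => //; rewrite /close zE /= (dn_step ir) (dn_step jr).
Qed.

Lemma card_disjointU (T : finType) (A B : {set T}) :
  (forall z, z \in A -> z \in B -> False) -> #|A :|: B| = #|A| + #|B|.
Proof.
move=> dAB; rewrite cardsU (_ : A :&: B = set0) ?cards0 ?subn0 //.
by apply/setP => z; rewrite !inE; apply/negP => /andP[/dAB zA /zA].
Qed.

Section CellRegions.
Variables (m b : nat).
Hypothesis b_gt0 : 0 < b.
Local Notation k := (4 * b).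
Local Notation cell := ('I_m * 'I_m)%type.
Implicit Types (D : {set cell}) (p q : nat * nat) (z : cell).

Definition close_cells p : {set cell} := [set z | close k p (coords z)].
Definition near_cells p : {set cell} := [set z | near k p (coords z)].
Definition left_cells p : {set cell} := [set z | left_region k p (coords z)].
Definition right_cells p : {set cell} := [set z | right_region k p (coords z)].
Definition upper_cells p q p' : {set cell} :=
  [set z | upper_region k p q p' (coords z)].
Definition lower_cells p q p' : {set cell} :=
  [set z | lower_region k p q p' (coords z)].

Definition forbidden_cells (p q p' q' : nat * nat) : {set cell} :=
  (left_cells p :|: right_cells q) :|: (upper_cells p q p' :|: lower_cells p q q').

Lemma card_forbidden p q p' q' : p.1 <= q.1 -> q'.2 <= p'.2 ->
  #|forbidden_cells p q p' q'| = #|left_cells p| + #|right_cells q| +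
    (#|upper_cells p q p'| + #|lower_cells p q q'|).
Proof.
move=> pq qp; rewrite /forbidden_cells !card_disjointU //.
- move=> z; rewrite !inE => /and4P[_ _ h _] /and4P[_ _ h' _].
  by have := leq_trans h' (leq_trans qp (ltnW h)); rewrite ltnn.
- move=> z; rewrite !inE => /andP[h _] /andP[h' _].
  by have := leq_ltn_trans pq (ltn_trans h' h); rewrite ltnn.
move=> z; rewrite !inE => /orP[]/andP[h _] /orP[]/and4P[h1 h2 _ _].
- by rewrite leqNgt h in h1.
- by rewrite leqNgt h in h1.
- by rewrite leqNgt h in h2.
- by rewrite leqNgt h in h2.
Qed.

Lemma card_left_cells p : p.1 < m -> p.2 < m ->
  #|quarter k (room m false p.1) (room m false p.2)| +
  #|quarter k (room m false p.1) (room m true p.2)| <= #|left_cells p|.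
Proof.
move=> p1 p2; pose D1 := [set z in left_cells p | (coords z).2 < p.2].
pose D2 := [set z in left_cells p | p.2 < (coords z).2].
have sD : D1 :|: D2 \subset left_cells p.
  by apply/subsetP => z; rewrite inE => /orP[]; rewrite inE => /andP[].
apply: leq_trans (subset_leq_card sD); rewrite card_disjointU; last first.
  move=> z; rewrite !inE => /andP[_ h] /andP[_ h'].
  by have := ltn_trans h h'; rewrite ltnn.
apply: leq_add; apply: card_quarter_cells => // z i j ir jr cl zE.
  by rewrite !inE /left_region cl zE /=; move: ir jr; rewrite /room; lia.
by rewrite !inE /left_region cl zE /=; move: ir jr; rewrite /room; lia.
Qed.

Lemma card_right_cells p : p.1 < m -> p.2 < m ->
  #|quarter k (room m true p.1) (room m false p.2)| +
  #|quarter k (room m true p.1) (room m true p.2)| <= #|right_cells p|.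
Proof.
move=> p1 p2; pose D1 := [set z in right_cells p | (coords z).2 < p.2].
pose D2 := [set z in right_cells p | p.2 < (coords z).2].
have sD : D1 :|: D2 \subset right_cells p.
  by apply/subsetP => z; rewrite inE => /orP[]; rewrite inE => /andP[].
apply: leq_trans (subset_leq_card sD); rewrite card_disjointU; last first.
  move=> z; rewrite !inE => /andP[_ h] /andP[_ h'].
  by have := ltn_trans h h'; rewrite ltnn.
apply: leq_add; apply: card_quarter_cells => // z i j ir jr cl zE.
  by rewrite !inE /right_region cl zE /=; move: ir jr; rewrite /room; lia.
by rewrite !inE /right_region cl zE /=; move: ir jr; rewrite /room; lia.
Qed.

Lemma strip_columns p q p' mu : p.1 <= p'.1 <= q.1 -> mu <= b -> mu <= q.1 - p.1 ->
  exists s, forall x, s <= x < s + mu ->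
    [/\ p.1 <= x, x <= q.1 & dn p'.1 x <= b].
Proof.
move=> pq mub muw; exists (maxn p.1 (p'.1 - mu)) => x; rewrite /dn.
by case: (leqP p.1 (p'.1 - mu)); split; lia.
Qed.

Lemma card_upper_cells p q p' mu : q.1 < m -> p.1 <= p'.1 <= q.1 ->
  mu <= b -> mu <= q.1 - p.1 -> p'.2 + b.*2 < m ->
  mu * b.*2 <= #|upper_cells p q p'|.
Proof.
move=> qm pq mub muw roomy; have [s sP] := strip_columns pq mub muw.
have [->//|mu0] := posnP mu.
apply: (@card_rectangle_ge _ s p'.2.+1).
- have [|h1 h2 _] := sP (s + mu).-1; first lia.
  by apply: leq_trans qm; move: h2; lia.
- by rewrite addSn.
move=> z /sP[h1 h2 h3] h4; rewrite inE /upper_region h1 h2 (proj1 (andP h4)) /=.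
by apply: sum_sqr_leq => //; rewrite /dn; lia.
Qed.

Lemma card_lower_cells p q p' mu : q.1 < m -> p'.2 <= m -> p.1 <= p'.1 <= q.1 ->
  mu <= b -> mu <= q.1 - p.1 -> b.*2 <= p'.2 ->
  mu * b.*2 <= #|lower_cells p q p'|.
Proof.
move=> qm p'm pq mub muw roomy; have [s sP] := strip_columns pq mub muw.
have [->//|mu0] := posnP mu.
apply: (@card_rectangle_ge _ s (p'.2 - b.*2)).
- have [|h1 h2 _] := sP (s + mu).-1; first lia.
  by apply: leq_trans qm; move: h2; lia.
- by rewrite subnK.
move=> z /sP[h1 h2 h3]; rewrite subnK // => h4.
rewrite inE /lower_region h1 h2 (proj2 (andP h4)) /=.
by apply: sum_sqr_leq => //; rewrite /dn; lia.
Qed.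

Lemma card_close_cells p : #|close_cells p| <= (2 * k) ^ 2.
Proof.
rewrite -mulnn; apply: (@card_rectangle_le _ (p.1 - k) (p.2 - k)) => z.
rewrite inE => cl.
have h c c' t : (dn c c').+1 ^ 2 + t <= k ^ 2 -> c - k <= c' < c - k + 2 * k.
  move=> le; have {}le : (dn c c').+1 ^ 2 <= k ^ 2 by apply: leq_trans le; rewrite leq_addr.
  by move: le; rewrite leq_sqr /dn; lia.
by split; [apply: h cl|apply: (h _ _ ((dn p.1 (coords z).1).+1 ^ 2)); rewrite addnC].
Qed.

Lemma card_upper_cells_le p q p' : p.1 <= q.1 ->
  #|upper_cells p q p'| <= (q.1 - p.1).+1 * k.
Proof.
move=> pq; apply: (@card_rectangle_le _ p.1 p'.2) => z; rewrite inE.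
case/and4P=> h1 h2 h3 cl.
have : (dn p'.2 (coords z).2).+1 ^ 2 <= k ^ 2 by apply: leq_trans cl; rewrite leq_addl.
by rewrite leq_sqr /dn; lia.
Qed.

Lemma card_lower_cells_le p q p' : p.1 <= q.1 ->
  #|lower_cells p q p'| <= (q.1 - p.1).+1 * k.
Proof.
move=> pq; apply: (@card_rectangle_le _ p.1 (p'.2 - k)) => z; rewrite inE.
case/and4P=> h1 h2 h3 cl.
have : (dn p'.2 (coords z).2).+1 ^ 2 <= k ^ 2 by apply: leq_trans cl; rewrite leq_addl.
by rewrite leq_sqr /dn; lia.
Qed.

End CellRegions.

(* Translating along the diagonal by w maps the part of the quarter disc outside
   two strips of width w onto the points of depth at least w. *)
Lemma card_crescent (k w : nat) :
  #|[set z : 'I_k * 'I_k | (z.1.+1 ^ 2 + z.2.+1 ^ 2 <= k ^ 2) &&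
      ~~ ((z.1.+1 + w) ^ 2 + (z.2.+1 + w) ^ 2 <= k ^ 2)]| <= 2 * w * k.
Proof.
pose Q := [set z : 'I_k * 'I_k | z.1.+1 ^ 2 + z.2.+1 ^ 2 <= k ^ 2].
pose G := [set z : 'I_k * 'I_k | (z.1.+1 + w) ^ 2 + (z.2.+1 + w) ^ 2 <= k ^ 2].
pose Qw := [set z in Q | (w <= z.1) && (w <= z.2)].
have GQ : G \subset Q.
  apply/subsetP => z; rewrite !inE; apply: leq_trans.
  by apply: leq_add; rewrite leq_sqr leq_addr.
have QwQ : Qw \subset Q by apply/subsetP => z; rewrite inE => /andP[].
have QwG : #|Qw| <= #|G|.
  pose sh (i : 'I_k) : 'I_k := Ordinal (leq_ltn_trans (leq_subr w i) (ltn_ord i)).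
  pose F (z : 'I_k * 'I_k) := (sh z.1, sh z.2).
  rewrite -(card_in_imset (f := F)) => [|[i j] [i' j']]; last first.
    rewrite !inE /= => /and3P[_ h1 h2] /and3P[_ h3 h4] [e1 e2].
    congr pair; apply: val_inj => /=.
      by rewrite -(subnK h1) -(subnK h3) e1.
    by rewrite -(subnK h2) -(subnK h4) e2.
  apply/subset_leq_card/subsetP => _ /imsetP[[i j] + ->].
  rewrite !inE /= => /and3P[h h1 h2].
  by rewrite !addSn !subnK.
have -> : [set z : 'I_k * 'I_k | (z.1.+1 ^ 2 + z.2.+1 ^ 2 <= k ^ 2) &&
      ~~ ((z.1.+1 + w) ^ 2 + (z.2.+1 + w) ^ 2 <= k ^ 2)] = Q :\: G.
  by apply/setP => z; rewrite !inE andbC.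
rewrite cardsD (setIidPr GQ); apply: leq_trans (leq_sub2l _ QwG) _.
have -> : #|Q| - #|Qw| = #|Q :\: Qw| by rewrite cardsD (setIidPr QwQ).
pose S1 := [set z : 'I_k * 'I_k | z.1 < w]; pose S2 := [set z : 'I_k * 'I_k | z.2 < w].
have sQ : Q :\: Qw \subset S1 :|: S2.
  apply/subsetP => z /setDP[zQ]; apply: contraNT; rewrite !inE negb_or -!leqNgt.
  by rewrite inE in zQ; rewrite zQ.
apply: leq_trans (subset_leq_card sQ) _; apply: leq_trans (leq_card_setU _ _) _.
have cw : #|[set i : 'I_k | i < w]| <= w.
  have [kw|wk] := leqP k w; first by apply: leq_trans (max_card _) _; rewrite card_ord.
  have -> : [set i : 'I_k | i < w] = [set widen_ord (ltnW wk) i | i in 'I_w].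
    apply/setP => i; rewrite inE; apply/idP/imsetP => [iw|[j _ ->]]; last exact: (ltn_ord j).
    by exists (Ordinal iw) => //; apply: val_inj.
  by apply: leq_trans (leq_imset_card _ _) _; rewrite card_ord.
have -> : S1 = setX [set i : 'I_k | i < w] [set: 'I_k].
  by apply/setP => z; rewrite !inE andbT.
have -> : S2 = setX [set: 'I_k] [set i : 'I_k | i < w].
  by apply/setP => z; rewrite !inE.
rewrite !cardsX !cardsT !card_ord; move: cw; set c := #|_| => cw.
rewrite (mulnC k) -mulnA mul2n -addnn.
by apply: leq_add; rewrite leq_mul2r cw orbT.
Qed.

Lemma dn_inj (c x y : nat) : dn c x = dn c y -> (c < x) = (c < y) -> x = y.
Proof. by rewrite /dn; lia. Qed.

Lemma coords_eq m (z z' : 'I_m * 'I_m) : (coords z).1 = (coords z').1 ->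
  (coords z).2 = (coords z').2 -> z = z'.
Proof.
by move=> e1 e2; apply: coords_inj; rewrite [LHS]surjective_pairing e1 e2.
Qed.

Section CellRegionCounts.
Variables (m b : nat).
Hypothesis b_gt0 : 0 < b.
Local Notation k := (4 * b).
Local Notation N := #|quarter k k k|.

Lemma k_gt0 : 0 < k.
Proof. by rewrite muln_gt0. Qed.

(** Moving the centre by at most [w] in each coordinate removes from each of the four quadrants no
    more than a crescent of [2 w k] cells. This makes two extra points, each avoiding the other
    disc, affordable. *)
Lemma card_close_diff p q w : dn p.1 q.1 <= w -> dn p.2 q.2 <= w ->
  #|@close_cells m b p :\: close_cells m b q| <= 8 * w * k.
Proof.
move=> pq1 pq2.
pose Z := [set z : 'I_k * 'I_k | (z.1.+1 ^ 2 + z.2.+1 ^ 2 <= k ^ 2) &&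
      ~~ ((z.1.+1 + w) ^ 2 + (z.2.+1 + w) ^ 2 <= k ^ 2)].
pose od c : 'I_k := insubd (Ordinal k_gt0) c.
pose F (z : nat * nat) := ((od (dn p.1 z.1), od (dn p.2 z.2)), (p.1 < z.1, p.2 < z.2)).
apply: (@leq_trans #|setX Z [set: bool * bool]|); last first.
  rewrite cardsX cardsT card_prod !card_bool; have := card_crescent k w.
  by rewrite -/Z; lia.
have dk z : z \in close_cells m b p -> dn p.1 (coords z).1 < k /\ dn p.2 (coords z).2 < k.
  by rewrite inE => cl; split; rewrite -leq_sqr; apply: leq_trans cl;
    [apply: leq_addr|apply: leq_addl].
apply: (card_cells_le (F := F)) => [z z'|z]; rewrite inE => /andP[nq zp];
  have [h1 h2] := dk z zp.
  rewrite inE => /andP[_ /dk[h3 h4]] [].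
  move=> /(congr1 val); rewrite !val_insubd h1 h3 => e1.
  move=> /(congr1 val); rewrite !val_insubd h2 h4 => e2 e3 e4.
  by apply: coords_eq; [apply: dn_inj e1 e3|apply: dn_inj e2 e4].
rewrite inE in zp.
rewrite !inE andbT /= !val_insubd h1 h2; apply/andP; split; first exact: zp.
apply: contra nq; rewrite inE => h; apply: leq_trans h.
by apply: leq_add; rewrite leq_sqr; move: pq1 pq2; rewrite /dn /coords /=; lia.
Qed.

(** A shift by three towards the centre in both coordinates carries the cells of [near] into the
    inner quarters counted by [N]. Those within two of an axis fill two bands of [5 (2 k + 3)]
    cells, and [20 k + 30 <= 50 k]. *)
Lemma card_near_cells p : #|@near_cells m b p| <= 4 * N + 50 * k.
Proof.
pose B1 := [set z in @near_cells m b p | dn p.1 (coords z).1 <= 2].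
pose B2 := [set z in @near_cells m b p | dn p.2 (coords z).2 <= 2].
pose D := [set z in @near_cells m b p |
  (2 < dn p.1 (coords z).1) && (2 < dn p.2 (coords z).2)].
have sD : @near_cells m b p \subset D :|: (B1 :|: B2).
  by apply/subsetP => z zn; rewrite !inE in zn *; rewrite zn /= !ltnNge -negb_or orNb.
have nk z : z \in @near_cells m b p ->
    dn p.1 (coords z).1 <= k.+1 /\ dn p.2 (coords z).2 <= k.+1.
  rewrite inE => nr; have h s t u : s.-1 ^ 2 + t <= u ^ 2 -> s <= u.+1.
    move=> le; have : s.-1 ^ 2 <= u ^ 2 by apply: leq_trans le; rewrite leq_addr.
    by rewrite leq_sqr; lia.
  by split; [apply: h nr|apply: (h _ ((dn p.1 (coords z).1).-1 ^ 2)); rewrite addnC].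
have B1le : #|B1| <= 5 * (2 * k + 3).
  apply: (@card_rectangle_le _ (p.1 - 2) (p.2 - k.+1)) => z.
  by rewrite inE => /andP[/nk[_ h] h']; move: h h'; rewrite /dn; lia.
have B2le : #|B2| <= (2 * k + 3) * 5.
  apply: (@card_rectangle_le _ (p.1 - k.+1) (p.2 - 2)) => z.
  by rewrite inE => /andP[/nk[h _] h']; move: h h'; rewrite /dn; lia.
have Dle : #|D| <= 4 * N.
  pose od c : 'I_k := insubd (Ordinal k_gt0) c.
  pose F (z : nat * nat) := ((od (dn p.1 z.1 - 3), od (dn p.2 z.2 - 3)), (p.1 < z.1, p.2 < z.2)).
  apply: (@leq_trans #|setX (quarter k k k) [set: bool * bool]|); last first.
    by rewrite cardsX cardsT card_prod !card_bool mulnC.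
  have dk z : z \in D -> [/\ dn p.1 (coords z).1 - 3 < k, dn p.2 (coords z).2 - 3 < k,
      2 < dn p.1 (coords z).1 & 2 < dn p.2 (coords z).2].
    by rewrite inE => /andP[/nk[h1 h2] /andP[h3 h4]]; split=> //; clear -h1 h2 h3 h4; lia.
  apply: (card_cells_le (F := F)) => [z z' /dk[h1 h2 h3 h4] /dk[h5 h6 h7 h8] []|z zD].
    move=> /(congr1 val); rewrite !val_insubd h1 h5 => e1.
    move=> /(congr1 val); rewrite !val_insubd h2 h6 => e2 e3 e4.
    apply: coords_eq; [apply: (dn_inj _ e3)|apply: (dn_inj _ e4)].
      by move: e1 h3 h7; rewrite /coords /=; clear; lia.
    by move: e2 h4 h8; rewrite /coords /=; clear; lia.
  have [h1 h2 h3 h4] := dk z zD; rewrite in_setX in_setT andbT inE /= !val_insubd h1 h2 ?h1 ?h2 ?andbT.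
  have : near k p (coords z) by move: zD; rewrite !inE => /andP[].
  have e c : 2 < c -> (c - 3).+2 = c.-1 by lia.
  by rewrite /near !e.
have k0 := k_gt0.
apply: leq_trans (subset_leq_card sD) _; apply: leq_trans (leq_card_setU _ _) _.
apply: leq_add => //; apply: leq_trans (leq_card_setU _ _) _.
by move: B1le B2le k0; clear; move: #|B1| #|B2| => x y; lia.
Qed.

Lemma near_close p q : close k p q -> near k p q.
Proof.
move=> cl; apply: leq_trans cl; apply: leq_add; rewrite leq_sqr.
  by apply: leq_trans (leq_pred _) (leqnSn _).
by apply: leq_trans (leq_pred _) (leqnSn _).
Qed.

Lemma card_near_cells_ge (z0 : 'I_m * 'I_m) :
  z0.1 + k < m -> z0.2 + k < m -> N <= #|@near_cells m b (coords z0) :\ z0|.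
Proof.
move=> h1 h2.
rewrite -(@quarter_full k (room m true z0.1) (room m true z0.2)); last 2 first.
- by rewrite /room; lia.
- by rewrite /room; lia.
apply: (@card_quarter_cells m k true true (coords z0)); rewrite ?ltn_ord //=.
move=> z i j _ _ cl zE; rewrite !inE near_close // andbT.
apply/eqP => zz; move: zE; rewrite zz /coords /step /= => -[].
by lia.
Qed.

Variables (W : nat) (p q p' q' : nat * nat).
Hypotheses (pm : p.1 < m /\ p.2 < m) (qm : q.1 < m /\ q.2 < m).
Hypotheses (p'm : p'.2 < m) (q'm : q'.2 < m).
Hypothesis pqbox : box (W * b) p q p' q'.
Hypothesis m_large : 2 * (W * b + k) < m.
Local Notation w := (q.1 - p.1).
Local Notation Lam := (W * b + k).
Local Notation T := (@forbidden_cells m b p q p' q').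

Lemma card_forbidden_ge :
  #|quarter k p.1 p.2| + #|quarter k p.1 (m.-1 - p.2)| +
  (#|quarter k (m.-1 - q.1) q.2| + #|quarter k (m.-1 - q.1) (m.-1 - q.2)|) +
  minn w b * b.*2 <= #|T|.
Proof.
case/and5P: pqbox => b1 b2 b3 b4 /andP[b5 b6].
have [p1 p2] := pm; have [q1 q2] := qm.
rewrite card_forbidden; [|lia|lia].
apply: leq_add; first apply: leq_add.
- exact: card_left_cells p1 p2.
- exact: card_right_cells q1 q2.
have mu1 : minn w b <= b := geq_minr _ _; have mu2 : minn w b <= w := geq_minl _ _.
(* One strip suffices: a configuration of height at most [W b] cannot be close to the top and to the
   bottom of the square at once. *)
have [room_up|no_room] := ltnP (p'.2 + b.*2) m.
  by apply: leq_trans (leq_addr _ _); apply: card_upper_cells.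
apply: leq_trans (leq_addl _ _); apply: card_lower_cells; rewrite // 1?ltnW //.
by clear -no_room b5 b6 m_large; lia.
Qed.

(** Interior, side and corner positions. Along a side only two full quarters are certain, but a
    truncated one still gains an amount growing with the distance to the side. This bounds the later
    sum over that distance, so that the boundary counts as a line and not as a strip of width of
    order [b]. *)
Lemma card_forbidden_classes :
  [\/ 4 * N + minn w b * b.*2 <= #|T|,
      [\/ 2 * N + (minn w b + minn p.1 b) * b <= #|T| /\ p.1 < Lam,
          2 * N + (minn w b + minn (m.-1 - p.1) b) * b <= #|T| /\ m.-1 - p.1 < Lam,
          2 * N + (minn w b + minn p.2 b) * b <= #|T| /\ p.2 < Lam |
          2 * N + (minn w b + minn (m.-1 - p.2) b) * b <= #|T| /\ m.-1 - p.2 < Lam] |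
      [/\ N <= #|T|, (p.1 < Lam) || (m.-1 - p.1 < Lam) &
          (p.2 < Lam) || (m.-1 - p.2 < Lam)]].
Proof.
have := card_forbidden_ge; have := pqbox.
case/and5P=> b1 b2 b3 b4 /andP[b5 b6] hT.
have [p1 p2] := pm; have [q1 q2] := qm.
have qf rx ry : k <= rx -> k <= ry -> #|quarter k rx ry| = N := @quarter_full k rx ry.
have wq : q.1 = p.1 + w by clear -b1; lia.
have wW : w <= W * b by [].
have yd1 : q.2 <= p.2 + w by clear -b3 b4 b5; lia.
have yd2 : p.2 <= q.2 + w by clear -b3 b4 b5; lia.
have bb : b.*2 <= k by rewrite -mul2n leq_mul2r orbT.
have gain rx ry : k <= rx -> minn ry b * b <= #|quarter k rx ry|.
  move=> kr; rewrite mulnC; apply: card_quarter_ge => //; last exact: geq_minl.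
    by left; split; [rewrite -addnn leq_addr|apply: geq_minr].
  by apply: leq_trans kr; apply: leq_trans bb; rewrite -addnn leq_addr.
have gain' rx ry : k <= ry -> minn rx b * b <= #|quarter k rx ry|.
  move=> kr; apply: card_quarter_ge => //; last first.
  - by apply: leq_trans kr; apply: leq_trans bb; rewrite -addnn leq_addr.
  - exact: geq_minl.
  by right; split; [apply: geq_minr|rewrite -addnn leq_addr].
have split_gain : minn w b * b.*2 = minn w b * b + minn w b * b.
  by rewrite -addnn mulnDr.
rewrite split_gain in hT *.
(* At the right-hand side the truncated quarters belong to [q], while distances are measured from
   [p]; half of the width gain pays for the difference. *)
have wb_w : minn w b * b + minn (m.-1 - q.1) b * b >= minn (m.-1 - p.1) b * b.
  by rewrite -mulnDl leq_mul2r; apply/orP; right; clear -wq q1; lia.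
move: hT; rewrite !mulnDl.
move: wb_w; set gw := minn w b * b; move=> wb_w hT.
have [pl|pl] := ltnP p.1 Lam; have [pr|pr] := ltnP (m.-1 - p.1) Lam;
have [pd|pd] := ltnP p.2 Lam; have [pu|pu] := ltnP (m.-1 - p.2) Lam;
  try (by exfalso; clear -m_large pl pr; lia);
  try (by exfalso; clear -m_large pd pu; lia).
- apply: Or33; split=> //; rewrite -(qf (m.-1 - q.1) (m.-1 - q.2)).
  + by clear -hT; lia.
  + by clear -m_large wq wW pl; lia.
  + by clear -m_large yd1 wW pd; lia.
- apply: Or33; split=> //; rewrite -(qf (m.-1 - q.1) q.2).
  + by clear -hT; lia.
  + by clear -m_large wq wW pl; lia.
  + by clear -m_large yd2 wW pu; lia.
- apply: Or32; apply: Or41; split=> //.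
  have e1 := qf (m.-1 - q.1) q.2; have e2 := qf (m.-1 - q.1) (m.-1 - q.2).
  rewrite e1 ?e2 in hT; try by clear -m_large wq wW pl pd pu yd1 yd2; lia.
  have := gain' p.1 p.2; move/(_ (leq_trans (leq_addl _ _) pd)).
  by move: hT; clear; lia.
- apply: Or33; split=> //; rewrite ?pr ?orbT // -(qf p.1 (m.-1 - p.2)).
  + by clear -hT; lia.
  + by clear -m_large pl; lia.
  + by clear -m_large pd; lia.
- apply: Or33; split=> //; rewrite ?pr ?orbT // -(qf p.1 p.2).
  + by clear -hT; lia.
  + by clear -m_large pl; lia.
  + by clear -m_large pu; lia.
- apply: Or32; apply: Or42; split=> //.
  have e1 := qf p.1 p.2; have e2 := qf p.1 (m.-1 - p.2).
  rewrite e1 ?e2 in hT; try by clear -pl pd pu; lia.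
  have := gain' (m.-1 - q.1) q.2; have kq : k <= q.2 by clear -pd yd2 wW; lia.
  by move/(_ kq); move: hT wb_w; clear; lia.
- apply: Or32; apply: Or43; split=> //.
  have e1 := qf p.1 (m.-1 - p.2); have e2 := qf (m.-1 - q.1) (m.-1 - q.2).
  rewrite e1 ?e2 in hT; try by clear -m_large wq wW pl pr pd pu yd1 yd2; lia.
  have := gain p.1 p.2; move/(_ (leq_trans (leq_addl _ _) pl)).
  by move: hT; clear; lia.
- apply: Or32; apply: Or44; split=> //.
  have e1 := qf p.1 p.2; have e2 := qf (m.-1 - q.1) q.2.
  rewrite e1 ?e2 in hT; try by clear -m_large wq wW pl pr pd pu yd1 yd2; lia.
  have := gain p.1 (m.-1 - p.2); move/(_ (leq_trans (leq_addl _ _) pl)).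
  by move: hT; clear; lia.
by apply: Or31; move: hT; rewrite !qf; clear -m_large wq wW pl pr pd pu yd1 yd2; lia.
Qed.

End CellRegionCounts.

Lemma occupiedI (n : nat) (T : finType) (f : {ffun 'I_n -> T}) (s : seq 'I_n)
    (As : seq {set T}) (D : {set T}) :
  uniq s -> all2 (fun i (Q : {set T}) => f i \in Q) s As ->
  (forall i, i \notin s -> f i \notin D) -> f \in occupied n As D.
Proof.
move=> us sAs sD; have szs : size s == size As.
  by move: sAs; rewrite all2E => /andP[].
rewrite inE; apply/existsP; exists (Tuple szs); rewrite us sAs /=.
by apply/forallP => i; apply/implyP; apply: sD.
Qed.

Lemma all2_cat_both (U V : Type) (r : U -> V -> bool) s t s' t' :
  all2 r s t -> all2 r s' t' -> all2 r (s ++ s') (t ++ t').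
Proof. by elim: s t => [|u s IHs] [|v t] //= /andP[-> /IHs]. Qed.

(** * Obstructions as occupancy events *)

Section ObstructionEvents.
Variables (m b n : nat).
Hypothesis b_gt0 : 0 < b.
Local Notation k := (4 * b).
Local Notation cell := ('I_m * 'I_m)%type.
Implicit Types (f : {ffun 'I_n -> cell}) (p q : nat * nat).

Definition cell_at p : {set cell} := [set z | coords z == p].

(** The half discs contain no further point, one, or two. A lone point may be anywhere in their
    union, at a cost of order [b]; for two, mutual avoidance leaves only the crescents, at a cost of
    order [w^2]. *)
Definition left_right_options p q (o : 'I_3) : seq {set cell} :=
  nth [::] [:: [::];
    [:: @left_cells m b p :|: @right_cells m b q];
    [:: @close_cells m b p :\: close_cells m b q;
        @close_cells m b q :\: close_cells m b p]] o.

Definition option_list (D : {set cell}) (o : bool) : seq {set cell} :=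
  if o then [:: D] else [::].

(** Only the leftmost and rightmost points are listed as occupants, since the top and bottom points
    may coincide with them; the cells [p'] and [q'] are mere parameters and cost a power of the
    width later. *)
Definition event_sets p q p' q' (o : 'I_3 * (bool * bool)) : seq {set cell} :=
  [:: cell_at p; cell_at q] ++ (left_right_options p q o.1 ++
    (option_list (@upper_cells m b p q p') o.2.1 ++
     option_list (@lower_cells m b p q q') o.2.2)).

Definition obstruction_event p q p' q' : {set {ffun 'I_n -> cell}} :=
  \bigcup_o occupied n (event_sets p q p' q' o) (@forbidden_cells m b p q p' q').

Lemma option_listP f (D : {set cell}) :
  (forall i j, f i \in D -> f j \in D -> i = j) ->
  exists o s, [/\ uniq s, all2 (fun i (Q : {set cell}) => f i \in Q) s (option_list D o),
    {in s, forall i, f i \in D} & forall i, f i \in D -> i \in s].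
Proof.
move=> once; have [/existsP[i iD]|] := boolP [exists i, f i \in D].
  exists true, [:: i]; split; rewrite /= ?iD //.
    by move=> j; rewrite inE => /eqP->.
  by move=> j jD; rewrite inE (once j i).
rewrite negb_exists => /forallP none; exists false, [::]; split=> // i iD.
by move: (none i); rewrite iD.
Qed.

Lemma left_right_optionsP f p q : p.1 <= q.1 ->
  occupied_once (fun i => coords (f i)) (left_region k p) ->
  occupied_once (fun i => coords (f i)) (right_region k q) ->
  (forall i j, left_region k p (coords (f i)) -> right_region k q (coords (f j)) ->
     ~~ close k q (coords (f i)) /\ ~~ close k p (coords (f j))) ->
  exists o s, [/\ uniq s,
    all2 (fun i (Q : {set cell}) => f i \in Q) s (left_right_options p q o),
    {in s, forall i, f i \in left_cells m b p :|: right_cells m b q} &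
    forall i, f i \in left_cells m b p :|: right_cells m b q -> i \in s].
Proof.
move=> pq onceL onceR LR.
have mL i : (f i \in left_cells m b p) = left_region k p (coords (f i)) by rewrite inE.
have mR i : (f i \in right_cells m b q) = right_region k q (coords (f i)) by rewrite inE.
have [/existsP[i iL]|] := boolP [exists i, f i \in left_cells m b p];
    have [/existsP[j jR]|] := boolP [exists i, f i \in right_cells m b q].
- exists (inord 2), [:: i; j].
  rewrite mL in iL; rewrite mR in jR; have [h1 h2] := LR i j iL jR.
  have ij : i != j.
    by apply/eqP => ij; move: h2; rewrite -ij; case/andP: iL => _ ->.
  split; rewrite ?/left_right_options ?inordK //=.
  + by rewrite inE ij.
  + by rewrite !inE h1 h2 (proj2 (andP iL)) (proj2 (andP jR)).
  + move=> l; rewrite mem_seq2 in_setU mL mR.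
    by case/orP=> /eqP->; rewrite ?iL ?jR ?orbT.
  + move=> l; rewrite mem_seq2 in_setU mL mR => /orP[h|h].
      by rewrite (onceL l i) // eqxx.
    by rewrite (onceR l j) // eqxx orbT.
- rewrite negb_exists => /forallP noR; exists (inord 1), [:: i].
  split; rewrite ?/left_right_options ?inordK //=.
  + by rewrite in_setU iL.
  + by move=> l; rewrite inE => /eqP->; rewrite in_setU iL.
  + move=> l; rewrite in_setU (negPf (noR l)) orbF mL inE => h.
    by rewrite (onceL l i) // -mL.
- rewrite negb_exists => /forallP noL; exists (inord 1), [:: j].
  split; rewrite ?/left_right_options ?inordK //=.
  + by rewrite in_setU jR orbT.
  + by move=> l; rewrite inE => /eqP->; rewrite in_setU jR orbT.
  + move=> l; rewrite in_setU (negPf (noL l)) mR inE => h.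
    by rewrite (onceR l j) // -mR.
rewrite !negb_exists => /forallP noR /forallP noL; exists (inord 0), [::].
split; rewrite ?/left_right_options ?inordK // => l.
by rewrite in_setU (negPf (noL l)) (negPf (noR l)).
Qed.

Lemma in_forbidden_cells p q p' q' (z : cell) :
  (z \in forbidden_cells m b p q p' q') =
  [|| z \in left_cells m b p :|: right_cells m b q, z \in upper_cells m b p q p' |
      z \in lower_cells m b p q q'].
Proof. by rewrite /forbidden_cells [LHS]in_setU [X in _ || X]in_setU. Qed.

(** The listed points are distinct because the regions are disjoint and contain neither of the cells
    [p] and [q]. *)
Lemma obstruction_eventP Q f : obstruction k Q (fun i => coords (f i)) ->
  exists ia ib ic id, box Q (coords (f ia)) (coords (f ib)) (coords (f ic)) (coords (f id)) /\
    f \in obstruction_event (coords (f ia)) (coords (f ib)) (coords (f ic)) (coords (f id)).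
Proof.
case=> ia [ib [ic [id [iab bx [onceL onceR] [onceU onceD] LR]]]].
exists ia, ib, ic, id; split=> //.
set p := coords (f ia) in bx onceL onceR onceU onceD LR *.
set q := coords (f ib) in bx onceR onceU onceD LR *.
set p' := coords (f ic) in bx onceU *; set q' := coords (f id) in bx onceD *.
have [b1 b2 b3 b4 b5] : [/\ p.1 <= q.1, q'.2 <= p'.2, q'.2 <= p.2 <= p'.2,
    q'.2 <= q.2 <= p'.2 & true].
  case/and5P: bx => /andP[h1 h2] _ /andP[h3 h4] -> _; rewrite h3 h4.
  by split=> //; [apply: leq_trans h1 h2|apply: leq_trans h3 h4].
have [o1 [s1 [u1 a1 in1 all1]]] := left_right_optionsP b1 onceL onceR LR.
have [|o2 [s2 [u2 a2 in2 all2]]] := @option_listP f (upper_cells m b p q p').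
- by move=> i j; rewrite !inE; apply: onceU.
have [|o3 [s3 [u3 a3 in3 all3]]] := @option_listP f (lower_cells m b p q q').
- by move=> i j; rewrite !inE; apply: onceD.
have dLRU z : z \in left_cells m b p :|: right_cells m b q ->
    (p.1 <= (coords z).1) && ((coords z).1 <= q.1) = false.
  rewrite !inE => /orP[]/andP[h _]; apply/negP => /andP[].
    by rewrite leqNgt h.
  by rewrite [_ <= q.1]leqNgt h.
have inU z : z \in upper_cells m b p q p' ->
    [&& p.1 <= (coords z).1, (coords z).1 <= q.1 & p'.2 < (coords z).2].
  by rewrite inE => /and4P[-> -> ->].
have inD z : z \in lower_cells m b p q q' ->
    [&& p.1 <= (coords z).1, (coords z).1 <= q.1 & (coords z).2 < q'.2].
  by rewrite inE => /and4P[-> -> ->].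
have [ina inb] : (forall z, z \in forbidden_cells m b p q p' q' -> coords z != p) /\
    (forall z, z \in forbidden_cells m b p q p' q' -> coords z != q).
  split=> z; rewrite in_forbidden_cells => /orP[|/orP[/inU/and3P[_ _ h]|/inD/and3P[_ _ h]]].
  - by move=> /dLRU; apply: contraFneq => ->; rewrite leqnn b1.
  - by apply: contraL h => /eqP->; rewrite -leqNgt; case/andP: b3.
  - by apply: contraL h => /eqP->; rewrite -leqNgt; case/andP: b3.
  - by move=> /dLRU; apply: contraFneq => ->; rewrite leqnn b1.
  - by apply: contraL h => /eqP->; rewrite -leqNgt; case/andP: b4.
  - by apply: contraL h => /eqP->; rewrite -leqNgt; case/andP: b4.
apply/bigcupP; exists (o1, (o2, o3)) => //.
apply: (@occupiedI _ _ _ ([:: ia; ib] ++ (s1 ++ (s2 ++ s3)))).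
- have inF i : i \in s1 ++ (s2 ++ s3) -> f i \in forbidden_cells m b p q p' q'.
    by rewrite !mem_cat in_forbidden_cells => /or3P[/in1->|/in2->|/in3->]; rewrite ?orbT.
  rewrite !cat_uniq u1 u2 u3 /= inE iab !andbT /=; apply/and3P; split.
  + apply/hasPn => i /inF iF; rewrite !inE negb_or.
    by apply/andP; split; [apply: contraNneq (ina _ iF)|apply: contraNneq (inb _ iF)] => ->.
  + apply/hasPn => i; rewrite mem_cat => is23; apply/negP => /in1/dLRU.
    by case/orP: is23 => [/in2/inU|/in3/inD] /and3P[-> ->].
  + apply/hasPn => i /in3/inD/and3P[_ _ h]; apply/negP => /in2/inU/and3P[_ _ h'].
    by move: (leq_trans h (leq_trans b2 (ltnW h'))); rewrite ltnn.
- apply: all2_cat_both; first by rewrite /= !inE !eqxx.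
  by apply: all2_cat_both => //; apply: all2_cat_both.
move=> i; rewrite !mem_cat !negb_or => /and4P[_ n1 n2 n3].
rewrite in_forbidden_cells !negb_or; apply/and3P; split.
- by apply: contra n1; apply: all1.
- by apply: contra n2; apply: all2.
- by apply: contra n3; apply: all3.
Qed.

End ObstructionEvents.

(** * Elementary bounds for exponentials *)

Section ExponentialBounds.
Variable R : realType.
Local Open Scope ring_scope.
Implicit Types (x y c : R) (j n : nat).

Lemma exprn_le_expR x c j : 0 <= x -> 0 < c ->
  x ^+ j <= (c * j%:R) ^+ j * expR (x / c).
Proof.
move=> x0 c0; case: j => [|j].
  by rewrite !expr0 mul1r; apply: le_trans (expR_ge1Dx _); rewrite lerDl divr_ge0 // ltW.
set d := c * j.+1%:R; have d0 : 0 < d by rewrite mulr_gt0 // ltr0n.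
have -> : x / c = x / d * j.+1%:R.
  by rewrite /d invfM -!mulrA mulVf ?mulr1 // pnatr_eq0.
rewrite expRM_natr -exprMn lerXn2r ?nnegrE //; first by rewrite mulr_ge0 ?expR_ge0 // ltW.
have : x / d <= expR (x / d) by apply: le_trans (expR_ge1Dx _); rewrite lerDr.
by rewrite ler_pdivrMr // mulrC.
Qed.

Lemma sum_inv_sqr n : \sum_(i < n) ((i.+1)%:R ^+ 2)^-1 <= 2 :> R.
Proof.
suff : \sum_(i < n.+1) ((i.+1)%:R ^+ 2)^-1 <= 2 - (n.+1)%:R^-1 :> R.
  move=> h; apply: (@le_trans _ _ (2 - (n.+1)%:R^-1)); last by rewrite gerBl invr_ge0.
  by apply: le_trans h; rewrite big_ord_recr lerDl invr_ge0 exprn_ge0.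
elim: n => [|n IHn].
  by rewrite big_ord_recr big_ord0 /= add0r expr1n invr1; lra.
have step a : 0 < a -> 2 - a^-1 + ((a + 1) ^+ 2)^-1 <= 2 - (a + 1)^-1 :> R.
  move=> a0; have a1 : 0 < a + 1 by rewrite addr_gt0.
  have -> : 2 - (a + 1)^-1 = 2 - a^-1 + ((a + 1) ^+ 2)^-1 + (a * (a + 1) ^+ 2)^-1.
    by field; rewrite !gt_eqF.
  by rewrite lerDl invr_ge0 mulr_ge0 ?exprn_ge0 ?ltW.
rewrite big_ord_recr /=; apply: le_trans (lerD IHn (lexx _)) _.
by rewrite -[n.+2%:R]natr1 step ?ltr0n.
Qed.

(** The exponential dominates two powers more than the summand has, which leaves a sum of inverse
    squares. The bound is uniform in [M], hence later in [n]. *)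
Lemma sum_exprn_expR c j : 0 < c -> exists2 G, 0 < G &
  forall M, \sum_(w < M) (w.+1)%:R ^+ j * expR (- (w%:R / c)) <= G.
Proof.
move=> c0; pose K : R := (c * j.+2%:R) ^+ j.+2 * expR (c^-1).
have K0 : 0 < K by rewrite mulr_gt0 ?expR_gt0 ?exprn_gt0 ?mulr_gt0 ?ltr0n.
exists (K * 2); first by rewrite mulr_gt0.
move=> M; apply: le_trans (ler_wpM2l (ltW K0) (sum_inv_sqr M)).
rewrite mulr_sumr; apply: ler_sum => w _.
have w0 : 0 < w.+1%:R :> R by rewrite ltr0n.
have e0 := expR_gt0 (w%:R / c).
have := @exprn_le_expR w.+1%:R c j.+2 (ltW w0) c0.
rewrite -natr1 [(w%:R + 1) / c]mulrDl mul1r expRD natr1 mulrCA -/K.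
rewrite -[j.+2]addn2 exprD => h.
rewrite expRN ler_pdivrMr // mulrAC ler_pdivlMr ?exprn_gt0 //.
by rewrite [K * _]mulrC.
Qed.

Lemma onem_le_expR y n : y <= 1 -> (1 - y) ^+ n <= expR (- (n%:R * y)).
Proof.
move=> y1; rewrite -mulrN mulrC expRM_natr lerXn2r ?nnegrE ?subr_ge0 ?expR_ge0 //.
exact: expR_ge1Dx.
Qed.

Lemma expR_le_onem y n : y < 1 -> expR (- (n%:R * (y / (1 - y)))) <= (1 - y) ^+ n.
Proof.
move=> y1; have d0 : 0 < 1 - y by rewrite subr_gt0.
rewrite -mulrN mulrC expRM_natr lerXn2r ?nnegrE ?expR_ge0 ?(ltW d0) //.
rewrite expRN -[X in _ <= X]invrK lef_pV2 ?posrE ?invr_gt0 ?expR_gt0 //.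
apply: le_trans (expR_ge1Dx _); rewrite le_eqVlt; apply/orP; left; apply/eqP.
by field; rewrite gt_eqF.
Qed.

End ExponentialBounds.

(** * Expected number of obstructions *)

Section FirstMoment.
Local Open Scope ring_scope.
Variables (R : realType) (n b B W : nat).
Hypothesis b_gt0 : (0 < b)%N.
Hypothesis W_gt0 : (0 < W)%N.
Hypothesis n_ge6 : (6 <= n)%N.
Local Notation m := (b * B)%N.
Local Notation k := (4 * b)%N.
Local Notation cell := ('I_m * 'I_m)%type.
Local Notation N := #|quarter k k k|.
Hypothesis m_large : (2 * (W * b + k) < m)%N.

Let nu : R := n%:R / (m * m)%:R.
Let lam : R := (4 * N)%:R * nu.
Hypothesis nu_le : nu * (4 * b%:R) <= 1.

Lemma m_pos : (0 < m)%N.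
Proof. exact: leq_ltn_trans m_large. Qed.

Lemma cell_gt0 : (0 < #|{: cell}|)%N.
Proof. by rewrite card_prod card_ord muln_gt0 m_pos. Qed.

Lemma card_cellE : #|{: cell}| = (m * m)%N.
Proof. by rewrite card_prod card_ord. Qed.

Lemma n_dens (D : {set cell}) : n%:R * dens R D = nu * #|D|%:R.
Proof. by rewrite /dens /nu card_cellE mulrA mulrAC. Qed.

Lemma nu_ge0 : 0 <= nu.
Proof. by rewrite divr_ge0. Qed.

(** By [nu_le], a strip holds an expected number of points of order its width, and the two half
    discs one of order [b]. The constant is [388 = 4 * 97] with [97 = 1 + 32 + 64] from the three
    options; of the four powers of the width, two come from the crescents and one from each
    strip. *)
Lemma prod_event_sets p q p' q' o : box (W * b) p q p' q' ->
  \prod_(Q <- event_sets m b p q p' q' o) (n%:R * dens R Q) <=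
  nu ^+ 2 * (388%:R * b%:R * ((q.1 - p.1).+1)%:R ^+ 4).
Proof.
move=> bx; set w := (q.1 - p.1)%N; have b1 : 1 <= b%:R :> R by rewrite ler1n.
have nu0 := nu_ge0; have w1 : 1 <= w.+1%:R :> R by rewrite ler1n.
have nd0 (D : {set cell}) : 0 <= n%:R * dens R D.
  by rewrite mulr_ge0 // dens_ge0 // cell_gt0.
have pq : (p.1 <= q.1)%N by case/and5P: bx => /andP[h1 h2] *; apply: leq_trans h1 h2.
rewrite /event_sets !big_cat big_cons big_seq1 /=.
have cell1 r : n%:R * dens R (cell_at m r) <= nu.
  rewrite n_dens ler_piMr // lern1; apply/card_le1_eqP => z z'.
  by rewrite !inE => /eqP h /eqP h'; apply: coords_inj; rewrite h.
have strip (D : {set cell}) o' : (#|D| <= w.+1 * k)%N ->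
    \prod_(Q <- option_list D o') (n%:R * dens R Q) <= 2 * w.+1%:R.
  case: o' => /= hD; rewrite ?big_seq1 ?big_nil; last by lra.
  rewrite n_dens.
  have h : #|D|%:R <= w.+1%:R * (4 * b%:R) :> R by rewrite -!natrM ler_nat.
  apply: (le_trans (ler_wpM2l nu0 h)); rewrite mulrCA.
  by apply: (@le_trans _ _ (w.+1%:R * 1)); [rewrite ler_wpM2l|lra].
have s2 := strip _ o.2.1 (card_upper_cells_le _ b_gt0 p' pq).
have s3 := strip _ o.2.2 (card_lower_cells_le _ b_gt0 q' pq).
have s1 : \prod_(Q <- left_right_options m b p q o.1) (n%:R * dens R Q) <=
    97%:R * b%:R * w.+1%:R ^+ 2.
  have w2 : 1 <= w.+1%:R ^+ 2 :> R by rewrite exprn_ege1.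
  have bw : 1 <= b%:R * w.+1%:R ^+ 2 :> R by rewrite mulr_ege1.
  have bw' : b%:R <= b%:R * w.+1%:R ^+ 2 :> R by rewrite ler_peMr.
  have bw'' : w.+1%:R ^+ 2 <= b%:R * w.+1%:R ^+ 2 :> R by rewrite ler_peMl // exprn_ge0.
  rewrite -mulrA; set X := b%:R * _ in bw bw' bw'' *.
  case: o.1 => [[|[|[|//]]] ?]; rewrite /left_right_options /= ?big_nil ?big_seq1.
  - by lra.
  - rewrite n_dens.
    have LR : (#|left_cells m b p :|: right_cells m b q| <= 2 * (2 * k) ^ 2)%N.
      apply: leq_trans (leq_card_setU _ _) _; rewrite mul2n -addnn.
      apply: leq_add.
        apply: leq_trans (card_close_cells m b_gt0 p); apply/subset_leq_card/subsetP => z.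
        by rewrite !inE => /andP[].
      apply: leq_trans (card_close_cells m b_gt0 q); apply/subset_leq_card/subsetP => z.
      by rewrite !inE => /andP[].
    have h : #|left_cells m b p :|: right_cells m b q|%:R <= 32%:R * b%:R * (4 * b%:R) :> R.
      rewrite -!natrM ler_nat; apply: leq_trans LR _.
      by rewrite (_ : 2 * (2 * k) ^ 2 = 32 * b * (4 * b))%N //; ring.
    apply: (le_trans (ler_wpM2l nu0 h)); rewrite mulrCA.
    apply: (@le_trans _ _ (32%:R * b%:R * 1)); first by rewrite ler_wpM2l ?mulr_ge0.
    by lra.
  rewrite big_cons big_seq1 !n_dens.
  have [d1 d2] : (dn p.1 q.1 <= w)%N /\ (dn p.2 q.2 <= w)%N.
    by case/and5P: bx => _ _ h3 h4 /andP[h5 h6]; rewrite /dn /w; clear -h3 h4 h5 pq; lia.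
  have [d3 d4] : (dn q.1 p.1 <= w)%N /\ (dn q.2 p.2 <= w)%N.
    by rewrite /dn addnC [X in _ /\ (X <= _)%N]addnC.
  have cr (D : {set cell}) : (#|D| <= 8 * w * k)%N -> nu * #|D|%:R <= 8%:R * w.+1%:R.
    move=> hD; have h : #|D|%:R <= 8%:R * w.+1%:R * (4 * b%:R) :> R.
      rewrite -!natrM ler_nat; apply: leq_trans hD _.
      by rewrite leq_mul2r; apply/orP; right; rewrite leq_mul2l leqnSn orbT.
    apply: (le_trans (ler_wpM2l nu0 h)); rewrite mulrCA.
    by apply: (@le_trans _ _ (8%:R * w.+1%:R * 1)); [rewrite ler_wpM2l ?mulr_ge0|lra].
  apply: (@le_trans _ _ ((8%:R * w.+1%:R) * (8%:R * w.+1%:R))).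
    apply: ler_pM; try exact: mulr_ge0 nu0 (ler0n _ _).
      by apply: cr; apply: card_close_diff.
    by apply: cr; apply: card_close_diff.
  have -> : (8%:R * w.+1%:R) * (8%:R * w.+1%:R) = 64%:R * w.+1%:R ^+ 2 :> R by ring.
  by lra.
have p0 (s : seq {set cell}) : 0 <= \prod_(Q <- s) (n%:R * dens R Q).
  by apply: prodr_ge0 => Q _; apply: nd0.
apply: (@le_trans _ _ (nu * nu * (97%:R * b%:R * w.+1%:R ^+ 2 * (2 * w.+1%:R * (2 * w.+1%:R))))).
  apply: ler_pM.
  - exact: mulr_ge0 (nd0 _) (nd0 _).
  - exact: mulr_ge0 (p0 _) (mulr_ge0 (p0 _) (p0 _)).
  - exact: ler_pM (nd0 _) (nd0 _) (cell1 _) (cell1 _).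
  apply: ler_pM (p0 _) (mulr_ge0 (p0 _) (p0 _)) s1 _.
  exact: ler_pM (p0 _) (p0 _) s2 s3.
rewrite le_eqVlt; apply/orP; left; apply/eqP; ring.
Qed.

(** There are 12 option triples, and [4656 = 12 * 388]. At most six points are prescribed; the
    others, at least [n - 6], avoid the forbidden cells, whence [expR 6]. *)
Lemma pr_obstruction_event p q p' q' : box (W * b) p q p' q' ->
  pr R (obstruction_event m b n p q p' q') <=
  4656%:R * expR 6 * (nu ^+ 2 * (b%:R * ((q.1 - p.1).+1)%:R ^+ 4)) *
    expR (- (nu * #|forbidden_cells m b p q p' q'|%:R)).
Proof.
move=> bx; set T := forbidden_cells _ _ _ _ _ _; set w1 := ((q.1 - p.1).+1)%:R.
set K := nu ^+ 2 * (388%:R * b%:R * w1 ^+ 4).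
have y0 := dens_ge0 R T; have y1 := dens_le1 R cell_gt0 T.
apply: le_trans (pr_bigcup _ cell_gt0 _ _) _.
apply: (@le_trans _ _ (\sum_(o : 'I_3 * (bool * bool)) K * (expR 6 * expR (- (nu * #|T|%:R))))).
  apply: ler_sum => o _; apply: le_trans (pr_occupied _ _ cell_gt0 _ _) _.
  apply: ler_pM.
  - by apply: prodr_ge0 => Q _; rewrite mulr_ge0 // dens_ge0 // cell_gt0.
  - by rewrite exprn_ge0 // subr_ge0.
  - exact: prod_event_sets.
  have sz : (size (event_sets m b p q p' q' o) <= 6)%N.
    case: o => [[[|[|[|//]]] ?] [o2 o3]]; by case: o2; case: o3.
  apply: (@le_trans _ _ ((1 - dens R T) ^+ (n - 6))).
    by apply: ler_wiXn2l; rewrite ?subr_ge0 ?y1 ?gerBl // leq_sub2l.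
  apply: le_trans (onem_le_expR _ y1) _.
  rewrite -expRD ler_expR natrB // mulrBl n_dens.
  by lra.
rewrite sumr_const card_prod card_prod card_ord !card_bool /= -mulr_natl.
by rewrite le_eqVlt; apply/orP; left; apply/eqP; rewrite /K; ring.
Qed.

Hypothesis nu_ge : 1 <= 128%:R * (nu * b%:R).

Let c : R := 128%:R * (W + 4)%:R.
Let decay (x : nat) : R := expR (- (x%:R / c)).
Local Notation Lam := (W * b + k)%N.

Definition corner (a : nat * nat) : bool :=
  (((a.1 < Lam) || (m.-1 - a.1 < Lam)) && ((a.2 < Lam) || (m.-1 - a.2 < Lam)))%N.

Definition side_decay (a : nat * nat) : R :=
  (decay a.1 + decay (m.-1 - a.1)%N) + (decay a.2 + decay (m.-1 - a.2)%N).

(** The terms answer the three cases of [card_forbidden_classes]; they are added so that the sums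
    over positions and widths separate. *)
Definition weight (a : nat * nat) (w : nat) : R :=
  expR (- lam) * decay w + expR (- (lam / 2)) * (decay w * side_decay a) +
  expR (- (lam / 4)) * (corner a)%:R.

Lemma c_gt0 : 0 < c.
Proof. by rewrite mulr_gt0 // ltr0n addnS. Qed.

(** The gain saturates at [b] while [x] may reach [(W + 4) b]; dividing by [W + 4] and using
    [128 nu b >= 1] gives a linear rate on the whole range. *)
Lemma decay_gain (x : nat) : (x <= (W + 4) * b)%N ->
  x%:R / c <= nu * (minn x b * b)%:R.
Proof.
move=> xb; have xm : (x <= (W + 4) * minn x b)%N.
  by rewrite /minn; case: ifP => // _; rewrite leq_pmull // addnS.
rewrite ler_pdivrMr ?c_gt0 // natrM.
have h : x%:R <= (W + 4)%:R * (minn x b)%:R :> R by rewrite -natrM ler_nat.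
apply: le_trans h _.
have -> : nu * ((minn x b)%:R * b%:R) * c =
  128%:R * (nu * b%:R) * ((W + 4)%:R * (minn x b)%:R) by rewrite /c; ring.
by rewrite ler_peMl // mulr_ge0.
Qed.

Lemma decay_ge0 x : 0 <= decay x.
Proof. exact: expR_ge0. Qed.

Lemma weight_forbidden p q p' q' :
  (p.1 < m)%N -> (p.2 < m)%N -> (q.1 < m)%N -> (q.2 < m)%N ->
  (p'.2 < m)%N -> (q'.2 < m)%N -> box (W * b) p q p' q' ->
  expR (- (nu * #|forbidden_cells m b p q p' q'|%:R)) <= weight p (q.1 - p.1)%N.
Proof.
move=> p1 p2 q1 q2 p'2 q'2 bx; set w := (q.1 - p.1)%N.
have nu0 := nu_ge0; have wW : (w <= W * b)%N by case/and5P: bx => _ _ _ _ /andP[].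
have wW4 : (w <= (W + 4) * b)%N by rewrite mulnDl (leq_trans wW) // leq_addr.
have gw := decay_gain wW4; set T := forbidden_cells _ _ _ _ _ _.
have t1 : 0 <= expR (- lam) * decay w by rewrite mulr_ge0 ?expR_ge0 ?decay_ge0.
have ts a : 0 <= decay a := decay_ge0 a.
have t2 x : 0 <= expR (- (lam / 2)) * (decay w * x) = (0 <= x).
  by rewrite pmulr_rge0 ?expR_gt0 // pmulr_rge0 // expR_gt0.
have t3 : 0 <= expR (- (lam / 4)) * (corner p)%:R by rewrite mulr_ge0 ?expR_ge0.
have mono (z : nat) (y : R) : (z <= #|T|)%N -> y <= nu * z%:R ->
    expR (- (nu * #|T|%:R)) <= expR (- y).
  move=> zT yz; rewrite ler_expR lerN2; apply: le_trans yz _.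
  by rewrite ler_wpM2l // ler_nat.
have side x : (x < Lam)%N -> (2 * N + (minn w b + minn x b) * b <= #|T|)%N ->
    expR (- (nu * #|T|%:R)) <= expR (- (lam / 2)) * (decay w * decay x).
  move=> xL hT; rewrite /decay -!expRD -!opprD; apply: (mono _ _ hT).
  have gx : x%:R / c <= nu * (minn x b * b)%:R.
    by apply: decay_gain; rewrite mulnDl ltnW // (leq_trans xL) // leq_add2l.
  rewrite (natrD _ (2 * N)) mulnDl (natrD _ (minn w b * b)) !mulrDr; have -> : nu * (2 * N)%:R = lam / 2.
    by rewrite /lam !natrM; field.
  by rewrite lerD2l lerD.
have sd0 : 0 <= side_decay p by rewrite /side_decay !addr_ge0.
have side_le x : decay x <= side_decay p ->
    expR (- (lam / 2)) * (decay w * decay x) <= weight p w.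
  move=> xs; rewrite /weight; apply: (@le_trans _ _ (expR (- (lam / 2)) * (decay w * side_decay p))).
    by rewrite ler_wpM2l ?expR_ge0 // ler_wpM2l.
  by rewrite -addrA addrCA lerDl addr_ge0.
have ml : (2 * (W * b + k) < m)%N by [].
have := card_forbidden_classes b_gt0 (conj p1 p2) (conj q1 q2) p'2 q'2 bx ml.
rewrite -/w -/T; case=> [hT|[] [hT xL]|[hT h1 h2]].
- apply: (@le_trans _ _ (expR (- lam) * decay w)).
    rewrite /decay -expRD -opprD; apply: (mono _ _ hT).
    rewrite natrD mulrDr; have -> : nu * (4 * N)%:R = lam by rewrite /lam mulrC.
    rewrite lerD2l; apply: le_trans gw _.
    by rewrite ler_wpM2l // ler_nat leq_mul2l -addnn leq_addr orbT.
  by rewrite /weight -addrA lerDl addr_ge0 // t2.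
- by apply: le_trans (side _ xL hT) (side_le _ _); rewrite /side_decay -!addrA lerDl !addr_ge0.
- apply: le_trans (side _ xL hT) (side_le _ _).
  by rewrite /side_decay -!addrA addrCA lerDl !addr_ge0.
- apply: le_trans (side _ xL hT) (side_le _ _).
  by rewrite /side_decay addrC -!addrA lerDl !addr_ge0.
- apply: le_trans (side _ xL hT) (side_le _ _).
  by rewrite /side_decay addrC -!addrA addrCA lerDl !addr_ge0.
have -> : weight p w = expR (- lam) * decay w +
    expR (- (lam / 2)) * (decay w * side_decay p) + expR (- (lam / 4)).
  by rewrite /weight /corner h1 h2 mulr1.
apply: (@le_trans _ _ (expR (- (lam / 4)))).
  apply: (mono _ _ hT); rewrite /lam natrM.
  by rewrite le_eqVlt; apply/orP; left; apply/eqP; field.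
by rewrite lerDr addr_ge0 // t2.
Qed.

(** Relative to the leftmost point, the rightmost has its column fixed by the width [w] and only its
    row is free; the top and bottom points have both free. Rows are shifted by [w] to stay in the
    naturals. The five offsets have at most [8 (w + 1)^5] values. *)
Definition offsets (w : nat) : finType :=
  ('I_(2 * w).+1 * ('I_w.+1 * ('I_(2 * w).+1 * ('I_w.+1 * 'I_(2 * w).+1))))%type.

Definition right_of (a : nat * nat) w (j : offsets w) : nat * nat :=
  (a.1 + w, a.2 + j.1 - w)%N.
Definition top_of (a : nat * nat) w (j : offsets w) : nat * nat :=
  (a.1 + j.2.1, a.2 + j.2.2.1 - w)%N.
Definition bottom_of (a : nat * nat) w (j : offsets w) : nat * nat :=
  (a.1 + j.2.2.2.1, a.2 + j.2.2.2.2 - w)%N.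

Definition obstruction_term (a : nat * nat) w (j : offsets w) :
    {set {ffun 'I_n -> cell}} :=
  let q := right_of a j in let p' := top_of a j in let q' := bottom_of a j in
  if [&& q.1 < m, q.2 < m, p'.2 < m, q'.2 < m & box (W * b) a q p' q']%N
  then obstruction_event m b n a q p' q' else set0.

Definition obstructed : {set {ffun 'I_n -> cell}} :=
  \bigcup_(a : cell) \bigcup_(w : 'I_(W * b).+1) \bigcup_(j : offsets w)
    obstruction_term (coords a) j.

Lemma obstructedP (f : {ffun 'I_n -> cell}) : obstruction k (W * b) (fun i => coords (f i)) -> f \in obstructed.
Proof.
move=> /obstruction_eventP[ia [ib [ic [id [bx fE]]]]].
set p := coords (f ia) in bx fE; set q := coords (f ib) in bx fE.
set p' := coords (f ic) in bx fE; set q' := coords (f id) in bx fE.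
pose w := (q.1 - p.1)%N.
have [h1 h2 h3 h4] : [/\ (p.1 <= p'.1 <= q.1)%N, (p.1 <= q'.1 <= q.1)%N,
    (q'.2 <= p.2 <= p'.2)%N & (q'.2 <= q.2 <= p'.2)%N] by case/and5P: bx.
have [h5 h6] : (p'.2 - q'.2 <= w)%N /\ (w <= W * b)%N by case/and5P: bx => _ _ _ _ /andP[].
have wE : q.1 = (p.1 + w)%N by rewrite /w; clear -h1; lia.
have l1 : (q.2 + w - p.2 < (2 * w).+1)%N by clear -h3 h4 h5; lia.
have l2 : (p'.1 - p.1 < w.+1)%N by clear -h1 wE; lia.
have l3 : (p'.2 + w - p.2 < (2 * w).+1)%N by clear -h3 h4 h5; lia.
have l4 : (q'.1 - p.1 < w.+1)%N by clear -h2 wE; lia.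
have l5 : (q'.2 + w - p.2 < (2 * w).+1)%N by clear -h3 h4 h5; lia.
pose j : offsets w := (Ordinal l1, (Ordinal l2, (Ordinal l3, (Ordinal l4, Ordinal l5)))).
have back y : (p.2 <= y + w)%N -> (p.2 + (y + w - p.2) - w)%N = y.
  by move=> h; rewrite subnKC // addnK.
have jq : right_of p j = q.
  rewrite [RHS]surjective_pairing wE /right_of; congr (_, _); apply: back.
  by clear -h3 h4 h5; lia.
have jp' : top_of p j = p'.
  rewrite [RHS]surjective_pairing /top_of; congr (_, _).
    exact: subnKC (proj1 (andP h1)).
  by apply: back; clear -h3; lia.
have jq' : bottom_of p j = q'.
  rewrite [RHS]surjective_pairing /bottom_of; congr (_, _).
    exact: subnKC (proj1 (andP h2)).
  by apply: back; clear -h3 h4 h5; lia.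
apply/bigcupP; exists (f ia) => //; apply/bigcupP; exists (Ordinal (h6 : (w < (W * b).+1)%N)) => //.
apply/bigcupP; exists j => //; rewrite /obstruction_term jq jp' jq' bx.
by rewrite !ltn_ord.
Qed.

Lemma card_offsets w : (#|offsets w|%:R : R) <= 8 * w.+1%:R ^+ 5.
Proof.
rewrite !card_prod !card_ord.
have h : ((2 * w).+1 <= 2 * w.+1)%N by lia.
have -> : 8 * w.+1%:R ^+ 5 = (2 * w.+1 * (w.+1 * (2 * w.+1 * (w.+1 * (2 * w.+1)))))%:R :> R.
  by rewrite !natrM; ring.
by rewrite ler_nat !leq_mul.
Qed.

(** The power 9 of the width is 4 from the occupants plus 5 from the offsets, and
    [37248 = 8 * 4656]. *)
Lemma pr_obstructed_sum : pr R obstructed <=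
  37248%:R * expR 6 * (nu ^+ 2 * b%:R) *
  \sum_(a : cell) \sum_(w < (W * b).+1) w.+1%:R ^+ 9 * weight (coords a) w.
Proof.
have T0 := cell_gt0.
apply: le_trans (pr_bigcup _ T0 _ _) _; rewrite mulr_sumr; apply: ler_sum => a _.
apply: le_trans (pr_bigcup _ T0 _ _) _; rewrite mulr_sumr; apply: ler_sum => w _.
apply: le_trans (pr_bigcup _ T0 _ _) _.
pose C0 : R := 4656%:R * expR 6 * (nu ^+ 2 * (b%:R * w.+1%:R ^+ 4)).
have W0 : 0 <= weight (coords a) w.
  have := decay_ge0; rewrite /weight /side_decay => d0.
  by rewrite !addr_ge0 ?mulr_ge0 ?expR_ge0 ?addr_ge0.
have C00 : 0 <= C0.
  exact: mulr_ge0 (mulr_ge0 (ler0n _ _) (expR_ge0 _))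
    (mulr_ge0 (sqr_ge0 _) (mulr_ge0 (ler0n _ _) (exprn_ge0 _ (ler0n _ _)))).
apply: (@le_trans _ _ (\sum_(j : offsets w) C0 * weight (coords a) w)).
  apply: ler_sum => j _; rewrite /obstruction_term; case: ifP => [/and5P[q1 q2 p'2 q'2 bx]|_]; last first.
    by rewrite /pr cards0 mul0r mulr_ge0.
  apply: le_trans (pr_obstruction_event bx) _.
  have := @weight_forbidden (coords a) (right_of (coords a) j) _ _
    (ltn_ord a.1) (ltn_ord a.2) q1 q2 p'2 q'2 bx.
  have -> : ((right_of (coords a) j).1 - (coords a).1)%N = w by rewrite /right_of /= addKn.
  by move=> h; rewrite ler_wpM2l.
rewrite sumr_const -[X in X <= _]mulr_natl.
apply: (@le_trans _ _ (8 * w.+1%:R ^+ 5 * (C0 * weight (coords a) w))).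
  by rewrite ler_wpM2r ?card_offsets // mulr_ge0.
rewrite le_eqVlt; apply/orP; left; apply/eqP; rewrite /C0.
by move: (weight _ _) (expR 6) (w.+1%:R) => X Y Z; ring.
Qed.

End FirstMoment.

Section FirstMomentBound.
Local Open Scope ring_scope.
Variables (R : realType) (n b B W : nat).
Hypothesis b_gt0 : (0 < b)%N.
Hypothesis W_gt0 : (0 < W)%N.
Hypothesis n_ge6 : (6 <= n)%N.
Local Notation m := (b * B)%N.
Local Notation k := (4 * b)%N.
Local Notation cell := ('I_m * 'I_m)%type.
Local Notation N := #|quarter k k k|.
Hypothesis m_large : (2 * (W * b + k) < m)%N.
Let nu : R := n%:R / (m * m)%:R.
Let lam : R := (4 * N)%:R * nu.
Hypothesis nu_le : nu * (4 * b%:R) <= 1.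
Hypothesis nu_ge : 1 <= 128%:R * (nu * b%:R).
Hypothesis lam_large : expR (- lam) * (n%:R * Num.sqrt b%:R) <= 1.
Hypothesis lam_ge : b%:R / 2 <= lam.
Let c : R := 128%:R * (W + 4)%:R.
Variable G : R.
Hypothesis G_ge : forall M, \sum_(w < M) (w.+1)%:R ^+ 9 * expR (- (w%:R / c)) <= G.
Local Notation Lam := (W * b + k)%N.
Let decay (x : nat) : R := expR (- (x%:R / c)).

Lemma sum_decay_le M : \sum_(x < M) decay x <= G.
Proof.
apply: le_trans (G_ge M); apply: ler_sum => x _.
by rewrite ler_peMl ?expR_ge0 // exprn_ege1 // ler1n.
Qed.

Lemma sum_decay_rev_le : \sum_(x < m) decay (m.-1 - x)%N <= G.
Proof.
apply: le_trans (sum_decay_le m); rewrite (reindex_inj rev_ord_inj) /=.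
rewrite le_eqVlt; apply/orP; left; apply/eqP/eq_bigr => x _; congr (decay _).
have := ltn_ord x; clear; lia.
Qed.

Lemma G_ge0 : 0 <= G.
Proof. by have := G_ge 0; rewrite big_ord0. Qed.

Lemma card_corner :
  (#|[set a : cell | corner b B W (coords a)]| <= (2 * Lam) ^ 2)%N.
Proof.
pose A := [set x : 'I_m | (x < Lam)%N || (m.-1 - x < Lam)%N].
have -> : [set a : cell | corner b B W (coords a)] = setX A A.
  by apply/setP => a; rewrite !inE.
have cA (P : pred 'I_m) (F : 'I_m -> nat) : (forall x, P x -> F x < Lam)%N -> injective F ->
    (#|[set x | P x]| <= Lam)%N.
  move=> PF injF; have L0 : (0 < Lam)%N by rewrite addn_gt0 orbC muln_gt0 b_gt0.
  pose h x : 'I_Lam := insubd (Ordinal L0) (F x).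
  rewrite -[X in (_ <= X)%N]card_ord -(card_in_imset (f := h)) ?max_card //.
  move=> x y; rewrite !inE => /PF xL /PF yL /(congr1 val).
  by rewrite !val_insubd xL yL; apply: injF.
have A1 : (#|A| <= 2 * Lam)%N.
  have -> : A = [set x : 'I_m | (x < Lam)%N] :|: [set x : 'I_m | (m.-1 - x < Lam)%N].
    by apply/setP => x; rewrite !inE.
  apply: leq_trans (leq_card_setU _ _) _; rewrite mul2n -addnn; apply: leq_add.
    exact: (@cA (fun x => x < Lam)%N (@nat_of_ord m)) (fun x h => h) (@ord_inj m).
  apply: (@cA (fun x => m.-1 - x < Lam)%N (fun x => m.-1 - x)%N) => // x y.
  have := ltn_ord x; have := ltn_ord y => hy hx e; apply: ord_inj.
  by move: hx hy e; clear; lia.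
by rewrite cardsX -mulnn leq_mul.
Qed.

Lemma sum_cells_fst (F : nat -> R) :
  \sum_(a : cell) F (coords a).1 = m%:R * \sum_(x < m) F x.
Proof.
rewrite -(pair_big xpredT xpredT (fun x y : 'I_m => F x)) /= mulr_sumr.
by apply: eq_bigr => x _; rewrite sumr_const card_ord mulr_natl.
Qed.

Lemma sum_cells_snd (F : nat -> R) :
  \sum_(a : cell) F (coords a).2 = m%:R * \sum_(x < m) F x.
Proof.
rewrite -(pair_big xpredT xpredT (fun x y : 'I_m => F y)) /=.
by rewrite sumr_const card_ord mulr_natl.
Qed.

Lemma sum_side_decay :
  \sum_(a : cell) side_decay R b B W (coords a) <= 4 * m%:R * G.
Proof.
rewrite /side_decay !big_split /=.
rewrite (sum_cells_fst decay) (sum_cells_fst (fun x => decay (m.-1 - x)%N)).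
rewrite (sum_cells_snd decay) (sum_cells_snd (fun x => decay (m.-1 - x)%N)).
have h1 := ler_wpM2l (ler0n R m) (sum_decay_le m).
have h2 := ler_wpM2l (ler0n R m) sum_decay_rev_le.
apply: le_trans (lerD (lerD h1 h2) (lerD h1 h2)) _.
by rewrite le_eqVlt; apply/orP; left; apply/eqP; ring.
Qed.

Lemma sum_weight_le :
  \sum_(a : cell) \sum_(w < (W * b).+1) w.+1%:R ^+ 9 * weight R n b B W (coords a) w <=
  expR (- lam) * ((m * m)%:R * G) + expR (- (lam / 2)) * (4 * m%:R * G * G) +
  expR (- (lam / 4)) * (((W * b).+1%:R) ^+ 10 * (2 * Lam)%:R ^+ 2).
Proof.
pose S := \sum_(w < (W * b).+1) w.+1%:R ^+ 9 * decay w.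
have S0 : 0 <= S by apply: sumr_ge0 => w _; rewrite mulr_ge0 ?expR_ge0 ?exprn_ge0.
have SG : S <= G := G_ge _.
pose S' : R := \sum_(w < (W * b).+1) w.+1%:R ^+ 9.
have S'le : S' <= (W * b).+1%:R ^+ 10.
  apply: (@le_trans _ _ (\sum_(w < (W * b).+1) (W * b).+1%:R ^+ 9)).
    by apply: ler_sum => w _; rewrite lerXn2r ?nnegrE // ler_nat.
  by rewrite sumr_const card_ord -[X in X <= _]mulr_natl -exprS.
have S'0 : 0 <= S' by apply: sumr_ge0 => w _; rewrite exprn_ge0.
pose sd (a : cell) := side_decay R b B W (coords a).
pose co (a : cell) : R := (corner b B W (coords a))%:R.
have -> : \sum_(a : cell) \sum_(w < (W * b).+1)
      w.+1%:R ^+ 9 * weight R n b B W (coords a) w =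
    expR (- lam) * ((m * m)%:R * S) + expR (- (lam / 2)) * (\sum_a sd a * S) +
    expR (- (lam / 4)) * (\sum_a co a * S').
  have -> : (m * m)%:R * S = \sum_(a : cell) S.
    by rewrite sumr_const card_prod card_ord mulr_natl.
  rewrite !mulr_sumr -!big_split /=; apply: eq_bigr => a _.
  rewrite /S /S' !mulr_sumr -!big_split /=; apply: eq_bigr => w _.
  rewrite /weight -/nu -/lam -/c -/(decay w) -/(sd a) -/(co a).
  by move: (decay w) (sd a) (co a) (expR _) (expR _) (expR _) (w.+1%:R ^+ 9) => *; ring.
apply: lerD; first apply: lerD.
- by rewrite ler_wpM2l ?expR_ge0 // ler_wpM2l.
- rewrite ler_wpM2l ?expR_ge0 // -mulr_suml; apply: ler_pM => //.
    by apply: sumr_ge0 => a _; rewrite /sd /side_decay !addr_ge0 ?expR_ge0.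
  exact: sum_side_decay.
rewrite ler_wpM2l ?expR_ge0 // -mulr_suml mulrC; apply: ler_pM => //.
  by apply: sumr_ge0.
rewrite -natrX -natr_sum ler_nat; apply: leq_trans card_corner.
by rewrite -sum1_card [X in (_ <= X)%N]big_mkcond /=; apply: leq_sum => a _; rewrite inE; case: ifP.
Qed.

Definition first_moment_const : R := 37248%:R * expR 6 *
  (G + 3 * G ^+ 2 + (W + 1)%:R ^+ 10 * (2 * W + 8)%:R ^+ 2 * (8 * 13%:R) ^+ 13).

(** In the interior [nu^2 b m^2 exp (- lam) = (nu b) n exp (- lam)], which is at most [1 / sqrt b].
    Along the sides [m exp (- lam / 2)] is at most [12 sqrt b], against [nu^2 b <= 1 / (16 b)]. In
    the corners a polynomial in [b] meets [exp (- b / 8)]. *)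
Lemma pr_obstructed_le :
  pr R (obstructed n b B W) <= first_moment_const / Num.sqrt b%:R.
Proof.
have b1 : 1 <= b%:R :> R by rewrite ler1n.
have b0 : 0 < b%:R :> R by rewrite ltr0n.
have n0 : 0 < n%:R :> R by rewrite ltr0n (leq_trans _ n_ge6).
have m0 : 0 < m%:R :> R by rewrite ltr0n (leq_ltn_trans _ m_large).
set s := Num.sqrt b%:R; have s0 : 0 < s by rewrite sqrtr_gt0.
have ss : s ^+ 2 = b%:R by rewrite sqr_sqrtr // ltW.
have s1 : 1 <= s by rewrite -(@sqrtr1 R) ler_sqrt // ltW.
have nu0 : 0 < nu by rewrite divr_gt0 // natrM mulr_gt0.
have mmnu : (m * m)%:R * nu = n%:R.
  by rewrite /nu mulrCA mulfV ?mulr1 // natrM mulf_neq0 ?gt_eqF.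
have nub : nu * b%:R <= 4^-1 by move: nu_le; lra.
have nub2 : nu ^+ 2 * b%:R * b%:R <= 16^-1.
  have -> : nu ^+ 2 * b%:R * b%:R = (nu * b%:R) ^+ 2 by ring.
  have -> : 16^-1 = 4^-1 ^+ 2 :> R by field.
  apply: lerXn2r => //; rewrite nnegrE ?invr_ge0 //.
  exact: mulr_ge0 (ltW nu0) (ltW b0).
have nu2b : nu ^+ 2 * b%:R <= 16^-1 / b%:R by rewrite ler_pdivlMr.
have nu2b0 : 0 <= nu ^+ 2 * b%:R by rewrite mulr_ge0 ?sqr_ge0.
apply: le_trans (pr_obstructed_sum b_gt0 W_gt0 n_ge6 m_large nu_le nu_ge) _.
rewrite /first_moment_const -[X in X <= _]mulrA -[X in _ <= X]mulrA.
rewrite ler_wpM2l ?mulr_ge0 ?expR_ge0 //.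
apply: le_trans (ler_wpM2l nu2b0 sum_weight_le) _.
(* The exponent is [13 = 10 + 2 + 1]: widths, corner cells, and one more power for the division by
   [b]. *)
have poly : b%:R ^+ 13 <= (8 * 13%:R) ^+ 13 * expR (b%:R / 8) :> R.
  exact: exprn_le_expR (ltW b0) _.
set D := (8 * 13%:R) ^+ 13 in poly *.
have D0 : 0 <= D by rewrite exprn_ge0 // mulr_ge0.
clearbody D.
rewrite !mulrDr 2![in X in _ <= X]mulrDl.
have G0 := G_ge0.
apply: lerD; first apply: lerD.
- have -> : nu ^+ 2 * b%:R * (expR (- lam) * ((m * m)%:R * G)) =
    (nu * b%:R) * (expR (- lam) * (((m * m)%:R * nu))) * G by ring.
  rewrite mmnu mulrC ler_wpM2l //.
  have h : expR (- lam) * n%:R <= s^-1.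
    by rewrite -[X in _ <= X]mul1r ler_pdivlMr // -mulrA.
  apply: le_trans h; rewrite ler_piMl ?mulr_ge0 ?expR_ge0 //.
  by apply: le_trans nub _; lra.
- pose z := m%:R * expR (- (lam / 2)).
  have z0 : 0 <= z by rewrite mulr_ge0 ?expR_ge0.
  have z2 : z ^+ 2 <= 128%:R * b%:R.
    have e2 : expR (- (lam / 2)) ^+ 2 = expR (- lam) by rewrite -expRM_natr; congr expR; field.
    have h : z ^+ 2 * nu <= 1.
      have -> : z ^+ 2 * nu = expR (- lam) * n%:R.
        by rewrite exprMn e2 -mmnu natrM; ring.
      apply: le_trans lam_large; rewrite ler_wpM2l ?expR_ge0 //.
      by rewrite ler_peMr.
    have h' : z ^+ 2 * (128%:R * (nu * b%:R)) <= 128%:R * b%:R.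
      have -> : z ^+ 2 * (128%:R * (nu * b%:R)) = z ^+ 2 * nu * (128%:R * b%:R) by ring.
      by rewrite ler_piMl // mulr_ge0 // ltW.
    by apply: le_trans h'; rewrite ler_peMr // sqr_ge0.
  have zs : z <= 12%:R * s.
    have h12 : 0 <= 12%:R * s := mulr_ge0 (ler0n _ _) (ltW s0).
    rewrite -(@ler_pXn2r R 2 isT z) ?nnegrE // [X in _ <= X]exprMn ss.
    by apply: le_trans z2 _; rewrite -natrX ler_wpM2r ?ler_nat.
  have -> : nu ^+ 2 * b%:R * (expR (- (lam / 2)) * (4 * m%:R * G * G)) =
     (nu ^+ 2 * b%:R) * z * (4 * G ^+ 2) by rewrite /z; ring.
  have h : nu ^+ 2 * b%:R * z <= (16^-1 / b%:R) * (12%:R * s).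
    by rewrite ler_pM.
  apply: le_trans (ler_wpM2r _ h) _; first by rewrite mulr_ge0 ?sqr_ge0.
  rewrite le_eqVlt; apply/orP; left; apply/eqP.
  by rewrite -ss; field; rewrite gt_eqF.
have lamb : expR (- (lam / 4)) <= expR (- (b%:R / 8)).
  by rewrite ler_expR lerN2; move: lam_ge; lra.
have e0 := expR_gt0 (b%:R / 8 : R).
have h1 : (W * b).+1%:R ^+ 10 <= ((W + 1)%:R * b%:R) ^+ 10 :> R.
  rewrite lerXn2r ?nnegrE ?mulr_ge0 // -natrM ler_nat.
  by rewrite mulnDl mul1n -addn1 leq_add2l.
have h2 : (2 * Lam)%:R ^+ 2 = ((2 * W + 8)%:R * b%:R) ^+ 2 :> R.
  by rewrite -natrM; congr (_%:R ^+ 2); ring.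
have h3 : expR (- (lam / 4)) * ((W * b).+1%:R ^+ 10 * (2 * Lam)%:R ^+ 2) <=
    (W + 1)%:R ^+ 10 * (2 * W + 8)%:R ^+ 2 * (D / b%:R).
  apply: (@le_trans _ _ (expR (- (b%:R / 8)) * (((W + 1)%:R * b%:R) ^+ 10 * ((2 * W + 8)%:R * b%:R) ^+ 2))).
    by rewrite h2 ler_pM ?expR_ge0 ?mulr_ge0 ?exprn_ge0 // ler_wpM2r ?exprn_ge0 ?mulr_ge0.
  have -> : expR (- (b%:R / 8)) * (((W + 1)%:R * b%:R) ^+ 10 * ((2 * W + 8)%:R * b%:R) ^+ 2) =
    (W + 1)%:R ^+ 10 * (2 * W + 8)%:R ^+ 2 * (expR (- (b%:R / 8)) * b%:R ^+ 12) :> R.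
    by rewrite !exprMn; move: (expR _) => E; ring.
  rewrite ler_wpM2l ?mulr_ge0 ?exprn_ge0 // expRN ler_pdivlMr //.
  by rewrite -mulrA -exprSr mulrC ler_pdivrMr.
apply: (@le_trans _ _ (1 * ((W + 1)%:R ^+ 10 * (2 * W + 8)%:R ^+ 2 * (D / b%:R)))).
  apply: ler_pM => //; first by rewrite !mulr_ge0 ?expR_ge0 ?exprn_ge0.
  apply: le_trans nu2b _; rewrite ler_pdivrMr // mul1r; apply: le_trans b1; lra.
rewrite mul1r [X in X <= _]mulrA ler_wpM2l //.
  exact: mulr_ge0 (mulr_ge0 (exprn_ge0 _ (ler0n _ _)) (exprn_ge0 _ (ler0n _ _))) D0.
by rewrite lef_pV2 ?posrE // -ss expr2 ler_peMr // ltW.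
Qed.

End FirstMomentBound.

(** * Exchange of the two coordinates *)

Section Transposition.
Variables (R : realType) (n m : nat).
Local Notation cell := ('I_m * 'I_m)%type.

Definition transpose (f : {ffun 'I_n -> cell}) : {ffun 'I_n -> cell} :=
  [ffun i => ((f i).2, (f i).1)].

Lemma transposeK : involutive transpose.
Proof. by move=> f; apply/ffunP => i; rewrite !ffunE /=; case: (f i). Qed.

Lemma coords_transpose f i : coords (transpose f i) = swap_coords (coords (f i)).
Proof. by rewrite ffunE. Qed.

Lemma pr_transpose (A : {set {ffun 'I_n -> cell}}) :
  pr R [set f | transpose f \in A] = pr R A.
Proof.
rewrite /pr -(card_imset A (inv_inj transposeK)); congr (_%:R / _)%R; apply: eq_card => f.
rewrite inE; apply/idP/imsetP => [fA|[g gA ->]]; last by rewrite transposeK.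
by exists (transpose f); rewrite ?transposeK.
Qed.

End Transposition.

(** * Sparse windows are unlikely *)

Section Windows.
Variables (R : realType) (n b B K : nat).
Hypothesis b_gt0 : (0 < b)%N.
Local Notation W := K.*2.+1.
Local Notation m := (b * B)%N.
Local Notation k := (4 * b)%N.
Local Notation cell := ('I_m * 'I_m)%type.
Local Notation N := #|quarter k k k|.

Definition blocks_cells (i j : nat) (A : {set 'I_W * 'I_W}) : {set cell} :=
  [set z : cell | [exists IJ in A, (z.1 %/ b == i + IJ.1) && (z.2 %/ b == j + IJ.2)]].

(** The union runs over the window, a set [A] of exactly [K] blocks, and the number [l] of points in
    them. Blocks with at most three points hold at most [3 K] together; pooling them reduces
    everything to single [occupied] events. *)
Definition sparse_windows : {set {ffun 'I_n -> cell}} :=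
  \bigcup_(ij : 'I_B * 'I_B | (ij.1 + W <= B) && (ij.2 + W <= B))
  \bigcup_(A : {set 'I_W * 'I_W} | #|A| == K) \bigcup_(l < (3 * K).+1)
    occupied n (nseq l (blocks_cells ij.1 ij.2 A)) (blocks_cells ij.1 ij.2 A).

Lemma leq_card_bigcup (I T : finType) (P : pred I) (F : I -> {set T}) :
  #|\bigcup_(i | P i) F i| <= \sum_(i | P i) #|F i|.
Proof.
elim/big_rec2: _ => [|i x y _ le]; first by rewrite cards0.
by apply: leq_trans (leq_card_setU _ _) _; rewrite leq_add2l.
Qed.

Lemma sparse_windowsP (f : {ffun 'I_n -> cell}) : f \notin sparse_windows ->
  forall i j, i + W <= B -> j + W <= B -> window_dense b K (fun l => coords (f l)) i j.
Proof.
move=> nf i j iW jW; apply: contraNT nf; rewrite -leqNgt.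
set bad := [set IJ : 'I_W * 'I_W | _]; move=> Kbad.
have iB : i < B by apply: leq_trans iW; rewrite addnS ltnS leq_addr.
have jB : j < B by apply: leq_trans jW; rewrite addnS ltnS leq_addr.
have [A sA cA] : exists2 A : {set 'I_W * 'I_W}, A \subset bad & #|A| = K.
  exists [set x in take K (enum bad)].
    by apply/subsetP => x; rewrite inE => /mem_take; rewrite mem_enum.
  by rewrite cardsE (card_uniqP _) ?take_uniq ?enum_uniq // size_takel -?cardE.
pose D := blocks_cells i j A; pose J := [set l | f l \in D].
have cJ : #|J| <= 3 * K.
  pose F (IJ : 'I_W * 'I_W) := [set l | block b (fun l => coords (f l)) l == (i + IJ.1, j + IJ.2)].
  have sJ : J \subset \bigcup_(IJ in A) F IJ.
    apply/subsetP => l; rewrite !inE => /existsP[IJ /andP[IJA /andP[/eqP h1 /eqP h2]]].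
    by apply/bigcupP; exists IJ => //; rewrite inE /block /= h1 h2.
  apply: leq_trans (subset_leq_card sJ) _; apply: leq_trans (leq_card_bigcup _ _) _.
  apply: (@leq_trans (#|A| * 3)); last by rewrite cA mulnC.
  rewrite -sum_nat_const; apply: leq_sum => IJ /(subsetP sA).
  by rewrite inE /dense -leqNgt.
apply/bigcupP; exists (Ordinal iB, Ordinal jB); rewrite /= ?iW //.
apply/bigcupP; exists A; first by rewrite cA.
apply/bigcupP; exists (Ordinal (cJ : #|J| < (3 * K).+1)) => //=.
apply: (@occupiedI _ _ _ (enum J)); first exact: enum_uniq.
  rewrite cardE; have : {in enum J, forall l, f l \in D} by move=> l; rewrite mem_enum inE.
  elim: (enum J) => [|l s IHs] //= sD; rewrite sD ?mem_head //=.
  by apply: IHs => l' l's; apply: sD; rewrite inE l's orbT.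
by move=> l; rewrite mem_enum inE.
Qed.

Lemma card_blocks_cells_ge i j (A : {set 'I_W * 'I_W}) : i + W <= B -> j + W <= B ->
  #|A| * b ^ 2 <= #|blocks_cells i j A|.
Proof.
move=> iW jW.
pose F (x : ('I_W * 'I_W) * ('I_b * 'I_b)) : nat * nat :=
  ((i + x.1.1) * b + x.2.1, (j + x.1.2) * b + x.2.2).
have divF (a : nat) (s : 'I_b) : (a * b + s) %/ b = a.
  by rewrite divnMDl // divn_small ?addn0.
have -> : #|A| * b ^ 2 = #|setX A [set: 'I_b * 'I_b]|.
  by rewrite cardsX cardsT card_prod !card_ord mulnn.
apply: (card_cells_ge (F := F)).
- move=> [[I J] [s t]] [[I' J'] [s' t']] _ _ /= [e1 e2].
  have I1 := congr1 (fun a => a %/ b) e1; have J1 := congr1 (fun a => a %/ b) e2.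
  rewrite !divF in I1 J1; move: e1 e2; rewrite I1 J1 => /addnI/val_inj-> /addnI/val_inj->.
  by move/addnI/val_inj: I1 => ->; move/addnI/val_inj: J1 => ->.
- move=> [[I J] [s t]] _ /=.
  have h (i0 : nat) (I0 : 'I_W) (s0 : 'I_b) : i0 + W <= B -> (i0 + I0) * b + s0 < b * B.
    move=> hW; apply: (@leq_trans ((i0 + I0).+1 * b)).
      by rewrite mulSn addnC ltn_add2r.
    by rewrite mulnC leq_mul2l -addnS (leq_trans _ hW) ?orbT // leq_add2l.
  by split; apply: h.
move=> [[I J] [s t]] z; rewrite !inE andbT /= => IJA [e1 e2].
by apply/existsP; exists (I, J); rewrite IJA /= e1 e2 !divF !eqxx.
Qed.

Lemma card_blocks_cells_le i j (A : {set 'I_W * 'I_W}) :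
  #|blocks_cells i j A| <= (W * b) ^ 2.
Proof.
rewrite -mulnn; apply: (@card_rectangle_le _ (i * b) (j * b)) => z.
rewrite inE => /existsP[[I J] /andP[_ /andP[/eqP /= e1 /eqP /= e2]]].
have h (c a : nat) (I0 : 'I_W) : c %/ b = a + I0 -> a * b <= c < a * b + W * b.
  move=> e; rewrite -mulnDl -ltn_divLR // -leq_divRL // e leq_addr ltn_add2l.
  exact: ltn_ord.
by split; [apply: h e1|apply: h e2].
Qed.

Local Open Scope ring_scope.
Let nu : R := n%:R / (m * m)%:R.
Let lam : R := (4 * N)%:R * nu.
Hypothesis K_ge : (128 <= K)%N.
Hypothesis n_ge : (3 * K <= n)%N.
Hypothesis B_gt0 : (0 < B)%N.
Hypothesis nu_le : nu * (4 * b%:R) <= 1.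
Hypothesis nu_ge : 1 <= 128%:R * (nu * b%:R).
Hypothesis lam_large : expR (- lam) * (n%:R * Num.sqrt b%:R) <= 1.
Hypothesis n_large : expR (b%:R - 1) <= n%:R :> R.

Definition window_const : R :=
  128%:R * (#|{: {set 'I_W * 'I_W}}|%:R * ((3 * K).+1%:R *
    ((W ^ 2)%:R ^+ (3 * K) * expR (3 * K)%:R))) *
  (expR 1 * (3 * K + 2)%:R ^+ (3 * K + 2)).

(** Since [lam <= 64 b^2 nu], any [K >= 128] blocks carry an expectation of at least [2 lam]. Their
    near-emptiness has probability at most [n^-2] times a power of [b], against a number of windows
    of order [b n]; the remaining factor [1 / n] beats every power of [b] by [n_large]. *)
Lemma pr_sparse_windows : pr R sparse_windows <= window_const / Num.sqrt b%:R.
Proof.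
have b1 : 1 <= b%:R :> R by rewrite ler1n.
have b0 : 0 < b%:R :> R by rewrite ltr0n.
have n0 : 0 < n%:R :> R.
  by rewrite ltr0n (leq_trans _ n_ge) // muln_gt0 /= (leq_trans _ K_ge).
have m0 : 0 < m%:R :> R by rewrite ltr0n muln_gt0 b_gt0.
set s := Num.sqrt b%:R; have s0 : 0 < s by rewrite sqrtr_gt0.
have ss : s ^+ 2 = b%:R by rewrite sqr_sqrtr // ltW.
have s1 : 1 <= s by rewrite -(@sqrtr1 R) ler_sqrt // ltW.
have nu0 : 0 < nu by rewrite divr_gt0 // natrM mulr_gt0.
have mmnu : (m * m)%:R * nu = n%:R.
  by rewrite /nu mulrCA mulfV ?mulr1 // natrM mulf_neq0 ?gt_eqF.
have T0 : (0 < #|{: cell}|)%N by rewrite card_prod card_ord muln_gt0 -!(ltr0n R) m0.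
have nd (D : {set cell}) : n%:R * dens R D = nu * #|D|%:R.
  by rewrite /dens /nu card_prod card_ord mulrA mulrAC.
pose U : R := (W ^ 2)%:R * b%:R.
have U1 : 1 <= U by rewrite mulr_ege1 // ler1n expn_gt0.
have U0 : 0 <= U by apply: le_trans U1.
pose Q : R := U ^+ (3 * K) * (expR (3 * K)%:R * expR (- (2 * lam))).
have Q0 : 0 <= Q.
  by rewrite mulr_ge0 ?exprn_ge0 ?mulr_ge0 ?expR_ge0.
have term i j (A : {set 'I_W * 'I_W}) (l : nat) : (i + W <= B)%N -> (j + W <= B)%N ->
    #|A| = K -> (l <= 3 * K)%N ->
    pr R (occupied n (nseq l (blocks_cells i j A)) (blocks_cells i j A)) <= Q.
  move=> iW jW cA lK; set D := blocks_cells i j A.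
  apply: le_trans (pr_occupied _ _ T0 _ _) _.
  rewrite big_nseq size_nseq iter_mulr_1; apply: ler_pM.
  - by rewrite exprn_ge0 // mulr_ge0 // dens_ge0.
  - by rewrite exprn_ge0 // subr_ge0 dens_le1.
  - have hD : n%:R * dens R D <= U.
      rewrite nd; have := card_blocks_cells_le i j A; rewrite -/D -(ler_nat R) => h.
      apply: le_trans (ler_wpM2l (ltW nu0) h) _.
      have -> : ((W * b) ^ 2)%:R = (W ^ 2)%:R * b%:R * b%:R :> R.
        by rewrite expnMn natrM [in LHS](natrX _ b) expr2 mulrA.
      rewrite -/U mulrCA ler_piMr //.
      by move: nu_le; rewrite mulrCA; have := mulr_ge0 (ltW nu0) (ltW b0); lra.
    apply: (@le_trans _ _ (U ^+ l)); last exact: ler_weXn2l.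
    by apply: lerXn2r hD; rewrite nnegrE // mulr_ge0 // dens_ge0.
  apply: le_trans (onem_le_expR _ (dens_le1 R T0 D)) _.
  rewrite -expRD ler_expR natrB ?(leq_trans lK) // mulrBl nd opprB lerB //.
    apply: (@le_trans _ _ (l%:R * 1)); last by rewrite mulr1 ler_nat.
    by rewrite ler_wpM2l // dens_le1.
  have := card_blocks_cells_ge A iW jW; rewrite cA -/D -(ler_nat R) => h.
  apply: le_trans (ler_wpM2l (ltW nu0) h).
  rewrite /lam mulrA [_ * nu]mulrC ler_wpM2l ?(ltW nu0) // -natrM ler_nat.
  apply: (@leq_trans (128 * b ^ 2)); last by rewrite leq_mul2r K_ge orbT.
  rewrite mulnA; apply: leq_trans (leq_mul (leqnn (2 * 4)) (quarter_leq k)) _.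
  by rewrite expnMn mulnA.
apply: le_trans (pr_bigcup _ T0 _ _) _.
apply: (@le_trans _ _ (\sum_(ij : 'I_B * 'I_B) #|{: {set 'I_W * 'I_W}}|%:R * ((3 * K).+1%:R * Q))).
  rewrite big_mkcond; apply: ler_sum => -[i j] _ /=; case: ifP => [/andP[iW jW]|_]; last first.
    exact: mulr_ge0 (ler0n _ _) (mulr_ge0 (ler0n _ _) Q0).
  apply: le_trans (pr_bigcup _ T0 _ _) _.
  apply: (@le_trans _ _ (\sum_(A : {set 'I_W * 'I_W}) (3 * K).+1%:R * Q)); last first.
    by rewrite sumr_const -[X in X <= _]mulr_natl.
  rewrite big_mkcond; apply: ler_sum => A _ /=; case: ifP => [/eqP cA|_]; last first.
    exact: mulr_ge0 (ler0n _ _) Q0.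
  apply: le_trans (pr_bigcup _ T0 _ _) _.
  apply: (@le_trans _ _ (\sum_(l < (3 * K).+1) Q)); last first.
    by rewrite sumr_const card_ord -[X in X <= _]mulr_natl.
  by apply: ler_sum => l _; apply: term; rewrite // -ltnS ltn_ord.
rewrite sumr_const card_prod card_ord -[X in X <= _]mulr_natl.
set c1 := #|_|%:R; have c10 : 0 <= c1 by rewrite ler0n.
have e2 : expR (- (2 * lam)) * n%:R ^+ 2 <= 1.
  have -> : - (2 * lam) = - lam * 2%:R by ring.
  rewrite expRM_natr -exprMn -[X in _ <= X](expr1n _ 2) lerXn2r ?nnegrE ?mulr_ge0 ?expR_ge0 //.
  by apply: le_trans lam_large; rewrite ler_wpM2l ?expR_ge0 // ler_peMr.
have BB : (B * B)%:R <= 128%:R * b%:R * n%:R :> R.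
  apply: (@le_trans _ _ (m * m)%:R).
    by rewrite ler_nat leq_mul // leq_pmull.
  have -> : 128%:R * b%:R * n%:R = (m * m)%:R * (128%:R * (nu * b%:R)) by rewrite -mmnu; ring.
  by rewrite ler_peMr.
have nb : n%:R^-1 * b%:R ^+ (3 * K + 1) <= expR 1 * (3 * K + 2)%:R ^+ (3 * K + 2) / b%:R :> R.
  rewrite ler_pdivlMr // -mulrA -exprSr -addnS mulrC ler_pdivrMr //.
  have := @exprn_le_expR R b%:R 1 (3 * K + 2) (ltW b0) ltr01; rewrite mul1r divr1 => h.
  have eb : expR b%:R <= expR 1 * n%:R :> R.
    have -> : b%:R = 1 + (b%:R - 1) :> R by ring.
    by rewrite expRD ler_wpM2l ?expR_ge0.
  by apply: le_trans h _; rewrite -mulrA mulrCA ler_wpM2l ?exprn_ge0.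
rewrite /window_const -/c1.
set c2 := (3 * K).+1%:R; have c20 : 0 <= c2 by rewrite ler0n.
set c3 : R := (W ^ 2)%:R ^+ (3 * K); have c30 : 0 <= c3 by rewrite exprn_ge0.
set c4 := expR (3 * K)%:R; have c40 : 0 <= c4 by rewrite expR_ge0.
set c5 := expR 1 * _ in nb *.
have QE : Q = c3 * c4 * (b%:R ^+ (3 * K) * expR (- (2 * lam))).
  by rewrite /Q /U exprMn -/c3 -/c4; ring.
have en : expR (- (2 * lam)) <= n%:R^-1 ^+ 2.
  by rewrite exprVn -[X in _ <= X]mul1r ler_pdivlMr ?exprn_gt0.
have step : (B * B)%:R * (b%:R ^+ (3 * K) * expR (- (2 * lam))) <= 128%:R * (c5 / b%:R).
  apply: (@le_trans _ _ (128%:R * b%:R * n%:R * (b%:R ^+ (3 * K) * n%:R^-1 ^+ 2))).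
    apply: ler_pM => //; first by rewrite mulr_ge0 ?exprn_ge0 ?expR_ge0.
    by rewrite ler_wpM2l ?exprn_ge0.
  apply: le_trans (ler_wpM2l (ler0n R 128) nb).
  rewrite le_eqVlt; apply/orP; left; apply/eqP; rewrite exprD expr1.
  by field; rewrite gt_eqF.
apply: (@le_trans _ _ (c1 * c2 * c3 * c4 * (128%:R * (c5 / b%:R)))).
  have -> : (B * B)%:R * (c1 * (c2 * Q)) =
    c1 * c2 * c3 * c4 * ((B * B)%:R * (b%:R ^+ (3 * K) * expR (- (2 * lam)))).
    by rewrite QE; ring.
  by rewrite ler_wpM2l // !mulr_ge0.
have c50 : 0 <= c5 by rewrite mulr_ge0 ?expR_ge0 ?exprn_ge0.
have -> : 128%:R * (c1 * (c2 * (c3 * c4))) * c5 / s = c1 * c2 * c3 * c4 * (128%:R * (c5 / s)) by ring.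
rewrite ler_wpM2l ?mulr_ge0 // ler_wpM2l // ler_wpM2l // lef_pV2 ?posrE //.
by rewrite -ss expr2 ler_peMr // ltW.
Qed.

End Windows.

Lemma center_lt (b B I i : nat) : I < B %/ 16 -> i < b ->
  16 * b * I + 8 * b + i + 4 * b < b * B.
Proof.
move=> IB ib; apply: (@leq_trans (16 * b * I + 16 * b)); first by move: (16 * b * I) => t; lia.
rewrite -mulnSr [16 * b]mulnC -mulnA leq_mul2l; apply/orP; right.
by apply: leq_trans (leq_trunc_div B 16); rewrite mulnC leq_mul2r IB orbT.
Qed.

Lemma center_sep (b I I' i i' z : nat) : 0 < b -> i < b -> i' < b ->
  dn (16 * b * I + 8 * b + i) z <= (4 * b).+1 ->
  dn (16 * b * I' + 8 * b + i') z <= (4 * b).+1 -> I = I'.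
Proof.
move=> b0; wlog le : I I' i i' / I <= I' => [wlg ib ib' d d'|ib ib' d d'].
  have [le|/ltnW le] := leqP I I'; first exact: (wlg I I' i i').
  by apply/esym; apply: (wlg I' I i' i).
apply/eqP; rewrite eqn_leq le leqNgt; apply/negP => lt.
have h : 16 * b * I + 16 * b <= 16 * b * I' by rewrite -mulnSr leq_mul2l lt orbT.
by move: d d' h; rewrite /dn; move: (16 * b * I) (16 * b * I') => s t; lia.
Qed.

(** * Second moment for pairs with no other point nearby *)

Section IsolatedPairs.
Variables (R : realType) (n b B : nat).
Hypothesis b_gt0 : (0 < b)%N.
Local Notation m := (b * B)%N.
Local Notation k := (4 * b)%N.
Local Notation cell := ('I_m * 'I_m)%type.
Local Notation N := #|quarter k k k|.
Local Notation center := (('I_(B %/ 16) * 'I_(B %/ 16)) * ('I_b * 'I_b))%type.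
Local Notation index := (center * ('I_n * 'I_n))%type.

Lemma center_bound (I : 'I_(B %/ 16)) (i : 'I_b) : 16 * b * I + 8 * b + i < m.
Proof. exact: leq_ltn_trans (leq_addr _ _) (center_lt (ltn_ord I) (ltn_ord i)). Qed.

(** Centres fill a [b] by [b] patch in the middle of each square of side [16 b]. Discs from
    different squares are disjoint and keep clear of the border, centres of one square lie in each
    other's discs, and still a fixed fraction of all cells are centres. *)
Definition center_cell (x : center) : cell :=
  (Ordinal (center_bound x.1.1 x.2.1), Ordinal (center_bound x.1.2 x.2.2)).

Definition ball (x : center) : {set cell} := @near_cells m b (coords (center_cell x)).

Definition isolated_pair (t : index) : {set {ffun 'I_n -> cell}} :=
  [set f : {ffun 'I_n -> cell} | [&& t.2.1 != t.2.2, f t.2.1 == center_cell t.1,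
    f t.2.2 \in ball t.1 :\ center_cell t.1 &
    [forall l, (l != t.2.1) ==> (l != t.2.2) ==> (f l \notin ball t.1)]]].

Lemma isolated_pair_low_degree (f : {ffun 'I_n -> cell}) t :
  f \in isolated_pair t -> low_degree k (fun i => coords (f i)).
Proof.
rewrite inE => /and4P[_ /eqP fi _ /forallP far]; exists t.2.1, t.2.2 => l li lj.
have := far l; rewrite li lj /= inE => h; by rewrite fi.
Qed.

Lemma center_cell_in_ball x : center_cell x \in ball x.
Proof. by rewrite inE /near /dn !subnn. Qed.

Lemma same_block_near x x' : x.1 = x'.1 -> center_cell x' \in ball x.
Proof.
case: x => [[I J] [i j]]; case: x' => [[I' J'] [i' j']] /= [<- <-].
rewrite inE /near /=.
have h (a s t : nat) : s < b -> t < b -> (dn (a + s) (a + t)).-1 ^ 2 <= b ^ 2.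
  by rewrite leq_sqr /dn; lia.
apply: leq_trans (leq_add (h _ _ _ (ltn_ord i) (ltn_ord i')) (h _ _ _ (ltn_ord j) (ltn_ord j'))) _.
by rewrite addnn -mul2n expnMn leq_mul2r orbT.
Qed.

Lemma ball_disjoint x x' z : z \in ball x -> z \in ball x' -> x.1 = x'.1.
Proof.
case: x => [[I J] [i j]]; case: x' => [[I' J'] [i' j']] /=.
have dk (s t : nat) : s.-1 ^ 2 + t <= k ^ 2 -> s <= k.+1.
  move=> le; have : s.-1 ^ 2 <= k ^ 2 by apply: leq_trans le; rewrite leq_addr.
  by rewrite leq_sqr; lia.
rewrite !inE /near => h h'.
have h2 := h; have h2' := h'; rewrite addnC in h2; rewrite addnC in h2'.
have eI := center_sep b_gt0 (ltn_ord i) (ltn_ord i') (dk _ _ h) (dk _ _ h').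
have eJ := center_sep b_gt0 (ltn_ord j) (ltn_ord j') (dk _ _ h2) (dk _ _ h2').
by congr (_, _); apply: val_inj.
Qed.

Lemma center_cell_inj x x' : x.1 = x'.1 -> center_cell x = center_cell x' -> x = x'.
Proof.
case: x => [[I J] [i j]]; case: x' => [[I' J'] [i' j']] /= [<- <-] [].
by move=> /addnI/val_inj-> /addnI/val_inj->.
Qed.

(** Centres of one square lie in each other's discs, so another isolated pair of that square
    involves the same two points: it can only be the pair with its roles exchanged. *)
Lemma card_same_block (f : {ffun 'I_n -> cell}) (t : index) : f \in isolated_pair t ->
  #|[set u : index | (u.1.1 == t.1.1) && (f \in isolated_pair u)]| <= 2.
Proof.
case: t => x [i j]; rewrite inE /= => /and4P[ij /eqP fi fj /forallP far].
have out l : f l \in ball x -> (l == i) || (l == j).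
  move=> fl; have := far l; rewrite fl /= implybF -[X in _ ==> X]/(~~ (l != j)) negbK.
  by case: (l == i).
have shape u : u.1.1 = x.1 -> f \in isolated_pair u ->
    u = (x, (i, j)) \/ [/\ u.2.1 = j, u.2.2 = i & center_cell u.1 = f j].
  case: u => x' [i' j'] /= xx; rewrite inE /= => /and4P[ij' /eqP fi' fj' /forallP far'].
  have fi'x : f i' \in ball x by rewrite fi' same_block_near.
  have fix' : f i \in ball x' by rewrite fi same_block_near.
  have iij : (i == i') || (i == j').
    have := far' i; rewrite fix' /= implybF -[X in _ ==> X]/(~~ (i != j')) negbK.
    by case: (i == i').
  have /orP[/eqP ii|/eqP i'j] := out i' fi'x; last first.
    right; split=> //; last by rewrite -fi' i'j.
    by move: iij; rewrite i'j (negPf ij) /= => /eqP->.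
  left; have xE : x' = x by apply: center_cell_inj; rewrite // -fi' ii fi.
  rewrite xE in fj'; have := out j'; case/setD1P: fj' => _ -> /(_ isT).
  by rewrite -ii eq_sym (negPf ij') /= => /eqP->; rewrite xE.
apply: (@leq_trans #|{: bool}|); last by rewrite card_bool.
pose F (u : index) := u == (x, (i, j)).
rewrite -(card_in_imset (f := F)) ?max_card // => u v.
rewrite [u \in _]inE [v \in _]inE => /andP[/eqP ub uE] /andP[/eqP vb vE]; rewrite /F.
have [->|[u1 u2 uc]] := shape u ub uE; first by rewrite eqxx => /esym/eqP.
have [->|[v1 v2 vc] _] := shape v vb vE; first by rewrite eqxx => /eqP.
have uv : u.1 = v.1 by apply: center_cell_inj; rewrite ?ub ?vb // uc vc.
by rewrite [u]surjective_pairing [v]surjective_pairing [u.2]surjective_pairing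
  [v.2]surjective_pairing u1 u2 v1 v2 uv.
Qed.

Local Open Scope ring_scope.

Hypothesis m_gt0 : (0 < m)%N.

Lemma cells_gt0 : (0 < #|{: cell}|)%N.
Proof. by rewrite card_prod card_ord muln_gt0 m_gt0. Qed.

Lemma pr_isolated_pair_ge x i j : i != j ->
  dens R [set center_cell x] * dens R (ball x :\ center_cell x) *
    (1 - dens R (ball x)) ^+ (n - 2) <= pr R (isolated_pair (x, (i, j))).
Proof.
move=> ij; pose F l := if l == i then [set center_cell x]
  else if l == j then ball x :\ center_cell x else ~: ball x.
have T0 := cells_gt0.
have -> : dens R [set center_cell x] * dens R (ball x :\ center_cell x) *
    (1 - dens R (ball x)) ^+ (n - 2) = \prod_l dens R (F l).
  rewrite (bigD1 i) //= (bigD1 j) /=; last by rewrite eq_sym.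
  rewrite /F eqxx eq_sym (negPf ij) eqxx -mulrA; congr (_ * (_ * _)).
  rewrite -dens_setC // (eq_bigr (fun _ => dens R (~: ball x))); last first.
    by move=> l /andP[/negPf-> /negPf->].
  rewrite prodr_const; congr (_ ^+ _).
  have := cardC (pred2 i j); rewrite card2 ij card_ord => h.
  rewrite -[in LHS]h addKn; apply: eq_card => l; rewrite !inE negb_or.
  by [].
rewrite -pr_family; apply: prS => //; apply/subsetP => f.
rewrite inE => /forallP fF; rewrite inE; apply/and4P; split=> //.
- by have := fF i; rewrite /F eqxx inE.
- by have := fF j; rewrite /F eq_sym (negPf ij) eqxx.
apply/forallP => l; apply/implyP => li; apply/implyP => lj.
by have := fF l; rewrite /F (negPf li) (negPf lj) inE.
Qed.

Variable Y : R.
Hypothesis Y_lt1 : Y < 1.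
Hypothesis ball_le : forall x, dens R (ball x) <= Y.
Hypothesis n_ge4 : (4 <= n)%N.

(** Disjoint discs make the events nearly independent, in the favourable direction:
    [1 - y1 - y2 <= (1 - y1) (1 - y2)]. Only the exponent differs, [n - 4] free points against
    [n - 2] in each factor, which costs [(1 - Y)^-4]. If the two pairs share a point, the
    intersection is empty. *)
Lemma pr_isolated_pair_cross t u : t.1.1 != u.1.1 ->
  pr R (isolated_pair t :&: isolated_pair u) <=
  ((1 - Y) ^+ 4)^-1 * (pr R (isolated_pair t) * pr R (isolated_pair u)).
Proof.
move=> tu; have T0 := cells_gt0.
have d0 : 0 < 1 - Y by rewrite subr_gt0.
have rhs0 : 0 <= ((1 - Y) ^+ 4)^-1 * (pr R (isolated_pair t) * pr R (isolated_pair u)).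
  have i0 : 0 <= ((1 - Y) ^+ 4)^-1 by rewrite invr_ge0 exprn_ge0 // ltW.
  exact: mulr_ge0 i0 (mulr_ge0 (pr_ge0 R T0 _) (pr_ge0 R T0 _)).
have [->|[f]] := set_0Vmem (isolated_pair t :&: isolated_pair u).
  by rewrite /pr cards0 mul0r.
case: t tu rhs0 => x [i j]; case: u => x' [i' j'] /= xx' rhs0.
case/setIP; rewrite inE /= => /and4P[ij /eqP fi fj _].
rewrite inE /= => /and4P[ij' /eqP fi' fj' _].
have dis z : z \in ball x -> z \in ball x' -> False.
  by move=> zx zx'; move: xx'; rewrite (ball_disjoint zx zx') eqxx.
have bi : f i \in ball x by rewrite fi center_cell_in_ball.
have bi' : f i' \in ball x' by rewrite fi' center_cell_in_ball.
have bj : f j \in ball x by case/setD1P: fj.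
have bj' : f j' \in ball x' by case/setD1P: fj'.
have neq l l' : f l \in ball x -> f l' \in ball x' -> l != l'.
  by move=> h h'; apply/eqP => ll; rewrite ll in h; apply: dis h h'.
pose D := ball x :|: ball x'.
pose As := [:: [set center_cell x]; ball x :\ center_cell x;
               [set center_cell x']; ball x' :\ center_cell x'].
pose s : (size As).-tuple 'I_n := [tuple of [:: i; j; i'; j']].
have us : uniq s by rewrite /= !inE !negb_or ij ij' !neq.
have := pr_occupied_tuple R T0 D us.
set E := [set _ | _] => prE.
have sE : isolated_pair (x, (i, j)) :&: isolated_pair (x', (i', j')) \subset E.
  apply/subsetP => g /setIP[]; rewrite inE /= => /and4P[_ /eqP gi gj /forallP far].
  rewrite inE /= => /and4P[_ /eqP gi' gj' /forallP far'].
  rewrite /E in_set /= gj gj' !in_set1 gi gi' !eqxx /=; apply/forallP => l; apply/implyP.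
  move=> ls; have /and4P[li lj li' lj'] : [&& l != i, l != j, l != i' & l != j'].
    by move: ls; rewrite !inE !negb_or.
  rewrite in_setU negb_or.
  by rewrite (implyP (implyP (far l) li) lj) (implyP (implyP (far' l) li') lj').
apply: le_trans (prS _ T0 sE) _; apply: le_trans prE _.
rewrite !big_cons big_nil mulr1 [size As]/=.
set s1 := dens R [set center_cell x]; set q1 := dens R (ball x :\ _).
set s2 := dens R [set center_cell x']; set q2 := dens R (ball x' :\ _).
set y1 := dens R (ball x); set y2 := dens R (ball x').
have DE : dens R D = y1 + y2 by rewrite /dens card_disjointU // natrD mulrDl.
have p1 := pr_isolated_pair_ge x ij; have p2 := pr_isolated_pair_ge x' ij'.
rewrite -/s1 -/q1 -/y1 in p1; rewrite -/s2 -/q2 -/y2 in p2.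
have [s10 q10 s20 q20] : [/\ 0 <= s1, 0 <= q1, 0 <= s2 & 0 <= q2] by rewrite !dens_ge0.
have yY1 : 1 - Y <= 1 - y1 by rewrite lerB // ball_le.
have yY2 : 1 - Y <= 1 - y2 by rewrite lerB // ball_le.
have [y10 y20] : 0 <= y1 /\ 0 <= y2 by rewrite !dens_ge0.
have d1 := lt_le_trans d0 yY1; have d2 := lt_le_trans d0 yY2.
have D1 : 0 <= 1 - dens R D by rewrite subr_ge0 dens_le1.
have key : (1 - dens R D) ^+ (n - 4) * (1 - Y) ^+ 4 <=
    (1 - y1) ^+ (n - 2) * (1 - y2) ^+ (n - 2).
  have e : (n - 2 = (n - 4) + 2)%N by clear -n_ge4; lia.
  rewrite e !exprD.
  have -> : (1 - y1) ^+ (n - 4) * (1 - y1) ^+ 2 * ((1 - y2) ^+ (n - 4) * (1 - y2) ^+ 2) =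
    ((1 - y1) * (1 - y2)) ^+ (n - 4) * ((1 - y1) ^+ 2 * (1 - y2) ^+ 2).
    by rewrite exprMn; ring.
  apply: ler_pM; rewrite ?exprn_ge0 ?(ltW d0) //.
    apply: lerXn2r; rewrite ?nnegrE ?mulr_ge0 ?(ltW d1) ?(ltW d2) //.
    by rewrite DE; have := mulr_ge0 y10 y20; lra.
  have -> : (1 - Y) ^+ 4 = (1 - Y) ^+ 2 * (1 - Y) ^+ 2 by rewrite -exprD.
  by apply: ler_pM; rewrite ?exprn_ge0 ?(ltW d0) //; apply: lerXn2r => //;
    rewrite nnegrE ltW.
rewrite [X in _ <= X]mulrC ler_pdivlMr ?exprn_gt0 //.
apply: (@le_trans _ _ (s1 * q1 * (1 - y1) ^+ (n - 2) * (s2 * q2 * (1 - y2) ^+ (n - 2)))).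
  have -> : s1 * q1 * (1 - y1) ^+ (n - 2) * (s2 * q2 * (1 - y2) ^+ (n - 2)) =
    (s1 * q1 * (s2 * q2)) * ((1 - y1) ^+ (n - 2) * (1 - y2) ^+ (n - 2)) by ring.
  have -> : s1 * (q1 * (s2 * q2)) * (1 - dens R D) ^+ (n - 4) * (1 - Y) ^+ 4 =
    s1 * q1 * (s2 * q2) * ((1 - dens R D) ^+ (n - 4) * (1 - Y) ^+ 4) by ring.
  by rewrite ler_wpM2l //; apply: mulr_ge0 (mulr_ge0 s10 q10) (mulr_ge0 s20 q20).
apply: ler_pM => //.
  exact: mulr_ge0 (mulr_ge0 s10 q10) (exprn_ge0 _ (ltW d1)).
exact: mulr_ge0 (mulr_ge0 s20 q20) (exprn_ge0 _ (ltW d2)).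
Qed.

(** Counted inside the expectation: whenever the event of [t] occurs, at most two events of its
    square do. *)
Lemma sum_same_block t :
  \sum_(u : index | u.1.1 == t.1.1) pr R (isolated_pair t :&: isolated_pair u) <=
  2 * pr R (isolated_pair t).
Proof.
have Z0 := cardX_T_gt0 R n cells_gt0.
under eq_bigr do rewrite pr_indicator.
rewrite pr_indicator -mulr_suml mulrA ler_pM2r ?invr_gt0 // exchange_big /= mulr_sumr.
apply: ler_sum => f _; case: (boolP (f \in isolated_pair t)) => ft; last first.
  by rewrite mulr0 big1 // => u _; rewrite in_setI (negPf ft).
rewrite mulr1; have := card_same_block ft; rewrite -(ler_nat R); apply: le_trans.
rewrite -sum1_card natr_sum big_mkcond [X in _ <= X]big_mkcond.
rewrite le_eqVlt; apply/orP; left; apply/eqP/eq_bigr => u _.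
rewrite in_setI ft /= [in RHS]inE.
by case: (u.1.1 == t.1.1) => //=; case: (f \in _).
Qed.

Let mu : R := \sum_t pr R (isolated_pair t).

Definition no_isolated_pair : {set {ffun 'I_n -> cell}} :=
  [set f | [forall t, f \notin isolated_pair t]].

Lemma pr_no_isolated_pair_second_moment :
  pr R no_isolated_pair * mu ^+ 2 <= 2 * mu + (((1 - Y) ^+ 4)^-1 - 1) * mu ^+ 2.
Proof.
set ka := ((1 - Y) ^+ 4)^-1.
have ka0 : 0 <= ka by rewrite invr_ge0 exprn_ge0 // subr_ge0 ltW.
have -> : 2 * mu + (ka - 1) * mu ^+ 2 = (2 * mu + ka * mu ^+ 2) - mu ^+ 2 by ring.
apply: (@second_moment R n _ cells_gt0 _ isolated_pair (2 * mu + ka * mu ^+ 2)).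
have -> : 2 * mu + ka * mu ^+ 2 = \sum_t (2 * pr R (isolated_pair t) +
    \sum_u ka * (pr R (isolated_pair t) * pr R (isolated_pair u))).
  rewrite big_split /= -mulr_sumr -/mu; congr (_ + _).
  rewrite expr2 /mu mulr_suml mulr_sumr; apply: eq_bigr => t _.
  by rewrite mulr_sumr mulr_sumr.
apply: ler_sum => t _; rewrite (bigID (fun u : index => u.1.1 == t.1.1)) /=.
apply: lerD; first exact: sum_same_block.
rewrite big_mkcond; apply: ler_sum => u _; case: ifP => [ut|_].
  by apply: pr_isolated_pair_cross; rewrite eq_sym.
exact: mulr_ge0 ka0 (mulr_ge0 (pr_ge0 R cells_gt0 _) (pr_ge0 R cells_gt0 _)).
Qed.

End IsolatedPairs.

Section IsolatedPairBound.
Local Open Scope ring_scope.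
Variables (R : realType) (n b B : nat).
Hypothesis b_gt0 : (0 < b)%N.
Hypothesis B_ge : (16 <= B)%N.
Hypothesis n_ge4 : (4 <= n)%N.
Local Notation m := (b * B)%N.
Local Notation k := (4 * b)%N.
Local Notation cell := ('I_m * 'I_m)%type.
Local Notation N := #|quarter k k k|.
Local Notation center := (('I_(B %/ 16) * 'I_(B %/ 16)) * ('I_b * 'I_b))%type.
Let nu : R := n%:R / (m * m)%:R.
Let lam : R := (4 * N)%:R * nu.
Hypothesis nu_le : nu * (4 * b%:R) <= 1.
Hypothesis lam_ge : b%:R / 2 <= lam.
Hypothesis lam_le : lam <= 2 * b%:R.
Hypothesis n_large : (2 * b%:R + 50%:R) ^+ 2 <= n%:R :> R.
Hypothesis lam_small : expR (-1) <= expR (- lam) * (n%:R * Num.sqrt b%:R).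

Let Y : R := (4 * N + 50 * k)%:R / (m * m)%:R.

Lemma card_centers : (m * m <= 1024 * #|{: center}|)%N.
Proof.
rewrite !card_prod !card_ord; set h := (B %/ 16)%N.
have Bh : (B <= 32 * h)%N.
  rewrite /h; have := ltn_ceil B (isT : (0 < 16)%N).
  have : (0 < B %/ 16)%N by rewrite divn_gt0.
  by move: (B %/ 16)%N => t; lia.
rewrite mulnACA (_ : 1024 * (h * h * (b * b)) = (b * b) * ((32 * h) * (32 * h)))%N; last by ring.
by rewrite leq_mul2l leq_mul ?orbT.
Qed.

Definition isolated_const : R := 2 * 16384%:R * expR 53%:R + 5.

(** The expected number [mu] is at least a constant times [sqrt b], and [Y] is at most [1 / b]; so
    the second moment bound [2 / mu + (1 - Y)^-4 - 1] is of order [1 / sqrt b]. *)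
Lemma pr_no_isolated_pair :
  pr R (no_isolated_pair n b B) <= isolated_const / Num.sqrt b%:R.
Proof.
have b1 : 1 <= b%:R :> R by rewrite ler1n.
have b0 : 0 < b%:R :> R by rewrite ltr0n.
have n0 : 0 < n%:R :> R by rewrite ltr0n (leq_trans _ n_ge4).
have m0' : (0 < m)%N by rewrite muln_gt0 b_gt0 (leq_trans _ B_ge).
have m0 : 0 < m%:R :> R by rewrite ltr0n.
have mm0 : 0 < (m * m)%:R :> R by rewrite ltr0n muln_gt0 m0'.
set s := Num.sqrt b%:R; have s0 : 0 < s by rewrite sqrtr_gt0.
have ss : s ^+ 2 = b%:R by rewrite sqr_sqrtr // ltW.
have s1 : 1 <= s by rewrite -(@sqrtr1 R) ler_sqrt // ltW.
have sb : s <= b%:R by rewrite -ss expr2 ler_peMr // ltW.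
have nu0 : 0 < nu by rewrite divr_gt0.
have T0 := cells_gt0 m0'.
have nY : n%:R * Y <= lam + 50%:R.
  have -> : n%:R * Y = lam + 50%:R * (nu * (4 * b%:R)).
    by rewrite /Y natrD mulrDl mulrDr /lam /nu !natrM; ring.
  by rewrite lerD2l ler_piMr.
have Y0 : 0 <= Y by rewrite divr_ge0.
pose e : R := 2 * b%:R + 50%:R.
have n_l : e ^+ 2 <= n%:R := n_large.
have e0 : 52%:R <= e by rewrite /e; lra.
have e00 : 0 < e by apply: lt_le_trans e0.
have nYe : n%:R * Y <= e by apply: le_trans nY _; rewrite /e lerD2r.
have Ye : Y * e <= 1.
  have : e ^+ 2 * Y <= e * 1.
    by rewrite mulr1; apply: le_trans nYe; rewrite ler_wpM2r.
  by rewrite expr2 -mulrA ler_pM2l // mulrC.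
have Y50 : Y <= 50%:R^-1.
  have : Y * 50%:R <= 1 by apply: le_trans Ye; rewrite ler_wpM2l //; lra.
  by rewrite -ler_pdivlMr // mul1r.
have Yh : Y <= 8^-1 by apply: le_trans Y50 _; rewrite lef_pV2 ?posrE // ler_nat.
have Y1 : Y < 1 by apply: le_lt_trans Y50 _; rewrite invf_lt1 // ltr1n.
have d0 : 0 < 1 - Y by rewrite subr_gt0.
have cE : #|{: cell}| = (m * m)%N by rewrite card_prod !card_ord.
have ball_le (x : center) : dens R (ball x) <= Y.
  rewrite /dens /Y cE ler_pM2r ?invr_gt0 // ler_nat. 
  exact: card_near_cells.
pose mu : R := \sum_(t : center * ('I_n * 'I_n)) pr R (isolated_pair t).
have := pr_no_isolated_pair_second_moment b_gt0 m0' Y1 ball_le n_ge4.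
rewrite -/mu => hmu.
(* The boundary cells contribute at most 50 to the exponent, and the passage from [1 - Y] to an
   exponential at most [n Y^2 / (1 - Y) <= 2]: hence 52. *)
have low : expR (- lam - 52%:R) <= (1 - Y) ^+ n.
  apply: le_trans (expR_le_onem _ Y1); rewrite ler_expR -opprD lerN2.
  have -> : n%:R * (Y / (1 - Y)) = n%:R * Y + (n%:R * Y) * (Y / (1 - Y)).
    by field; rewrite gt_eqF.
  have h : n%:R * Y * (Y / (1 - Y)) <= 2.
    rewrite mulrA ler_pdivrMr //; have : n%:R * Y * Y <= e * Y by rewrite ler_wpM2r.
    by move=> h8; apply: le_trans h8 _; rewrite mulrC; apply: le_trans Ye _; move: Yh; lra.
  by apply: le_trans (lerD nY h) _; lra.
(* [16384 = 1024 * 2 * 4 * 2]: the share of centres, the pairs of distinct indices, [lam = 4 N nu],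
   and [lam >= b / 2]. The last unit of 53 comes from [lam_small]. *)
have mu_ge : s * expR (- 53%:R) / 16384%:R <= mu.
  pose c0 : R := (m * m)%:R^-1 * (N%:R / (m * m)%:R) * expR (- lam - 52%:R).
  have c00 : 0 <= c0.
    by rewrite /c0 !mulr_ge0 ?invr_ge0 ?expR_ge0.
  have term (x : center) (i j : 'I_n) : i != j -> c0 <= pr R (isolated_pair (x, (i, j))).
    move=> ij; apply: le_trans (pr_isolated_pair_ge R m0' x ij).
    have s1E : dens R [set center_cell x] = (m * m)%:R^-1.
      by rewrite /dens cards1 card_prod card_ord mul1r.
    rewrite /c0 s1E; apply: ler_pM; rewrite ?mulr_ge0 ?invr_ge0 ?expR_ge0 //.
      rewrite ler_wpM2l ?invr_ge0 // /dens card_prod card_ord ler_wpM2r ?invr_ge0 //.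
      rewrite ler_nat; apply: card_near_cells_ge => //.
        exact: center_lt (ltn_ord _) (ltn_ord _).
      exact: center_lt (ltn_ord _) (ltn_ord _).
    apply: le_trans low _; apply: (@le_trans _ _ ((1 - Y) ^+ (n - 2))).
      by apply: ler_wiXn2l; rewrite ?(ltW d0) ?gerBl // leq_subr.
    apply: lerXn2r; rewrite ?nnegrE ?(ltW d0) ?lerB // subr_ge0.
    exact: dens_le1.
  have pairs : (n * n <= 2 * #|[set ij : 'I_n * 'I_n | ij.1 != ij.2]|)%N.
    have cD : #|[set ij : 'I_n * 'I_n | ij.1 == ij.2]| = n.
      rewrite -[RHS]card_ord -(card_imset predT (f := fun i : 'I_n => (i, i))) => [|i j [//]].
      apply: eq_card => -[i j]; rewrite inE /=; apply/eqP/imsetP => [->|[l _ [-> ->]]] //.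
      by exists j.
    have := cardC [set ij : 'I_n * 'I_n | ij.1 == ij.2].
    rewrite cD card_prod card_ord (_ : #|[predC _]| = #|[set ij : 'I_n * 'I_n | ij.1 != ij.2]|); last first.
      by apply: eq_card => ij; rewrite !inE.
    by move: #|_| => c h; move: n_ge4 h; clear; nia.
  have mu1 : #|{: center}|%:R * #|[set ij : 'I_n * 'I_n | ij.1 != ij.2]|%:R * c0 <= mu.
    apply: (@le_trans _ _ (\sum_(x : center) \sum_(ij : 'I_n * 'I_n | ij.1 != ij.2) c0)).
      rewrite sumr_const sumr_const -[X in _ <= X]mulr_natl -[X in _ <= _ * X]mulr_natl.
      rewrite -mulrA; apply: ler_pM (ler0n _ _) (mulr_ge0 (ler0n _ _) c00) _ _.
        by rewrite ler_nat; apply/subset_leq_card/subsetP.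
      by rewrite ler_wpM2r // ler_nat cardsE.
    rewrite /mu -(pair_big xpredT xpredT (fun (x : center) ij => pr R (isolated_pair (x, ij)))) /=.
    apply: ler_sum => x _; rewrite [X in _ <= X](bigID (fun ij : 'I_n * 'I_n => ij.1 != ij.2)) /=.
    apply: (@le_trans _ _ (\sum_(ij : 'I_n * 'I_n | ij.1 != ij.2) pr R (isolated_pair (x, ij)))).
      by apply: ler_sum => -[i j] /= ij; apply: term.
    by rewrite lerDl sumr_ge0 // => ij _; apply: pr_ge0.
  apply: le_trans mu1.
  have cc : (m * m)%:R / 1024%:R <= #|{: center}|%:R :> R.
    by rewrite ler_pdivrMr // mulrC -natrM ler_nat card_centers.
  have pp : (n * n)%:R / 2 <= #|[set ij : 'I_n * 'I_n | ij.1 != ij.2]|%:R :> R.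
    by rewrite ler_pdivrMr // mulrC -natrM ler_nat.
  apply: (@le_trans _ _ ((m * m)%:R / 1024%:R * ((n * n)%:R / 2) * c0)); last first.
    by rewrite ler_wpM2r // ler_pM // divr_ge0.
  have -> : (m * m)%:R / 1024%:R * ((n * n)%:R / 2) * c0 =
      8192%:R^-1 * lam * (n%:R * expR (- lam - 52%:R)).
    rewrite /c0; set E := expR _; clearbody E.
    rewrite /lam /nu (natrM _ n n) (natrM _ 4 N).
    by set M := (m * m)%:R in mm0 *; clearbody M; field; rewrite gt_eqF.
  have -> : s * expR (- 53%:R) / 16384%:R =
      8192%:R^-1 * (b%:R / 2) * (expR (-1) / s * expR (- 52%:R)).
    have -> : - 53%:R = -1 + - 52%:R :> R by ring.
    rewrite expRD -ss; move: (expR (-1)) (expR (- 52%:R)) => E F.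
    by field; rewrite gt_eqF.
  apply: ler_pM; rewrite ?mulr_ge0 ?invr_ge0 ?expR_ge0 ?(ltW s0) //.
    by rewrite ler_wpM2l ?invr_ge0.
  rewrite expRD mulrA ler_wpM2r ?expR_ge0 // ler_pdivrMr //.
  by apply: le_trans lam_small _; rewrite mulrCA mulrA.
have mu0 : 0 < mu.
  by apply: lt_le_trans mu_ge; rewrite !mulr_gt0 ?expR_gt0 ?invr_gt0.
have h1 : pr R (no_isolated_pair n b B) <= 2 / mu + (((1 - Y) ^+ 4)^-1 - 1).
  rewrite -(ler_pM2r (exprn_gt0 2 mu0)); apply: le_trans hmu _.
  by rewrite [X in _ <= X]mulrDl lerD2r le_eqVlt; apply/orP; left; apply/eqP; field; rewrite gt_eqF.
apply: le_trans h1 _; rewrite /isolated_const (mulrDl _ 5); apply: lerD.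
  rewrite ler_pdivrMr //; set Z : R := 16384%:R in mu_ge *.
  have Z0 : 0 < Z by rewrite ltr0n.
  clearbody Z; have c0 : 0 <= 2 * Z * expR 53%:R / s.
    by rewrite divr_ge0 ?mulr_ge0 ?expR_ge0 // ltW.
  apply: le_trans (ler_wpM2l c0 mu_ge).
  have -> : 2 * Z * expR 53%:R / s * (s * expR (- 53%:R) / Z) =
      2 * (expR 53%:R * expR (- 53%:R)) * (s / s) * (Z / Z) :> R by ring.
  by rewrite expRxMexpNx_1 !divff ?gt_eqF // !mulr1.
have h4 : 1 - 4 * Y <= (1 - Y) ^+ 4.
  have -> : (1 - Y) ^+ 4 = 1 - 4 * Y + Y ^+ 2 * (6 - 4 * Y + Y ^+ 2) by ring.
  by rewrite lerDl mulr_ge0 ?sqr_ge0 //; have := sqr_ge0 Y; move: Y1; lra.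
have h5 : 0 < 1 - 4 * Y by move: Yh; lra.
have h6 : ((1 - Y) ^+ 4)^-1 <= (1 - 4 * Y)^-1 by rewrite lef_pV2 ?posrE ?exprn_gt0.
rewrite lerBlDr; apply: le_trans h6 _.
have h7 : (1 - 4 * Y)^-1 <= 1 + 5 * Y.
  rewrite -[X in X <= _]mul1r ler_pdivrMr //.
  have : 20%:R * Y * Y <= Y.
    by rewrite ler_piMl //; lra.
  by lra.
apply: le_trans h7 _; rewrite addrC lerD2r ler_wpM2l //.
rewrite -[X in _ <= X]mul1r ler_pdivlMr //; apply: le_trans Ye; rewrite ler_wpM2l //.
by apply: le_trans sb _; rewrite /e; lra.
Qed.

End IsolatedPairBound.

(** * Choice of the grid *)

Section GridParameters.
Local Open Scope ring_scope.
Variable R : realType.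

Lemma quarter_bounds b : (0 < b)%N ->
  (2 * b ^ 2 <= #|quarter (4 * b) (4 * b) (4 * b)| <= 16 * b ^ 2)%N.
Proof.
move=> b0; apply/andP; split; last by apply: leq_trans (quarter_leq _) _; rewrite expnMn.
have -> : (2 * b ^ 2 = b.*2 * b)%N by rewrite -mul2n -mulnA mulnn.
have h : (b.*2 <= 4 * b)%N by rewrite -mul2n leq_mul2r orbT.
apply: card_quarter_ge => //; first by left.
by apply: leq_trans h; rewrite -addnn leq_addr.
Qed.

(** The constant [256 = 4^4] comes from [exprn_le_expR] with four powers of [b]; the fourth power
    absorbs [D]. *)
Lemma cube_le_expR (D : R) (b : nat) : (0 < b)%N -> 256%:R * expR 1 * D <= b%:R ->
  D * b%:R ^+ 3 <= expR (b%:R - 1).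
Proof.
move=> b_gt0 hD; have b0 : 0 < b%:R :> R by rewrite ltr0n.
rewrite -(ler_pM2r b0) -mulrA -exprSr.
have := @exprn_le_expR R b%:R 1 4 (ltW b0) ltr01; rewrite divr1 mul1r => h.
have f256 : 4 ^+ 4 = 256%:R :> R by rewrite -natrX.
rewrite f256 in h.
have e1 : expR b%:R = expR 1 * expR (b%:R - 1) :> R.
  by rewrite -expRD; congr expR; ring.
have [D0|D0] := lerP 0 D; last first.
  apply: (@le_trans _ _ 0); first by rewrite nmulr_rle0 // exprn_ge0 // ltW.
  by rewrite mulr_ge0 ?expR_ge0 // ltW.
apply: le_trans (ler_wpM2l D0 h) _; rewrite e1.
have -> : D * (256%:R * (expR 1 * expR (b%:R - 1))) =
  expR (b%:R - 1) * (256%:R * expR 1 * D) :> R.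
  by move: (expR _) (expR _) => E F; ring.
by rewrite ler_wpM2l ?expR_ge0.
Qed.

(* The grid has side m = b B, with b just above ln n and B chosen so that the
   expected number lam of points in a disc satisfies
   ln (n sqrt b) <= lam <= ln (n sqrt b) + 1. *)
Lemma grid_parameters (n b : nat) (C : R) : (2 <= b)%N -> (0 < n)%N ->
  ln n%:R <= b%:R :> R -> b%:R - 1 <= ln n%:R :> R -> 0 <= C ->
  256%:R * expR 1 * (7%:R + C) ^+ 2 <= b%:R ->
  let N := #|quarter (4 * b) (4 * b) (4 * b)| in
  exists B, let nu : R := n%:R / (b * B * (b * B))%:R in let lam := (4 * N)%:R * nu in
    [/\ C <= B%:R,
        [/\ nu * (4 * b%:R) <= 1 & 1 <= 128%:R * (nu * b%:R)],
        [/\ expR (- lam) * (n%:R * Num.sqrt b%:R) <= 1 &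
            expR (-1) <= expR (- lam) * (n%:R * Num.sqrt b%:R)],
        b%:R / 2 <= lam & lam <= 2 * b%:R].
Proof.
move=> b2 n_gt0 lb ub C0 large N.
have b_gt0 : (0 < b)%N by apply: leq_trans b2.
have b0 : 0 < b%:R :> R by rewrite ltr0n.
have b2R : 2 <= b%:R :> R by rewrite ler_nat.
have n0 : 0 < n%:R :> R by rewrite ltr0n.
set s := Num.sqrt b%:R; have s0 : 0 < s by rewrite sqrtr_gt0.
have ss : s ^+ 2 = b%:R by rewrite sqr_sqrtr // ltW.
have s1 : 1 <= s by rewrite -(@sqrtr1 R) ler_sqrt ?ler1n // ltW.
have ns0 : 0 < n%:R * s by rewrite mulr_gt0.
pose L := ln (n%:R * s).
have eL : expR L = n%:R * s by rewrite /L lnK // posrE.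
have LE : L = ln n%:R + ln s by rewrite /L lnM ?posrE.
have ls0 : 0 <= ln s by rewrite ln_ge0.
have ls : ln s <= (b%:R - 1) / 2.
  have : ln b%:R = ln s + ln s :> R by rewrite -ss expr2 lnM ?posrE.
  have : ln b%:R <= b%:R - 1 :> R.
    have h : -1 < b%:R - 1 :> R by lra.
    by have := le_ln1Dx h; rewrite addrC subrK.
  by lra.
clearbody s; have L_ge : b%:R - 1 <= L by rewrite LE; lra.
have L_le : L + 1 <= 2 * b%:R by rewrite LE; lra.
have L0 : 0 < L by lra.
have hb := cube_le_expR b_gt0 large; clear large.
have [N1 N2] : 2 * b%:R ^+ 2 <= N%:R :> R /\ N%:R <= 16%:R * b%:R ^+ 2 :> R.
  by have /andP[h1 h2] := quarter_bounds b_gt0; rewrite -!natrX -!natrM !ler_nat.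
have N0 : 0 < N%:R :> R by apply: lt_le_trans N1; rewrite mulr_gt0 ?exprn_gt0.
pose X := Num.sqrt (4 * n%:R * N%:R / L).
have Q0 : 0 < 4 * n%:R * N%:R / L by rewrite divr_gt0 // !mulr_gt0.
have X0 : 0 < X by rewrite sqrtr_gt0.
have XX : X ^+ 2 = 4 * n%:R * N%:R / L by rewrite sqr_sqrtr // ltW.
clearbody X.
pose B := Num.truncn (X / b%:R).
have /andP[B1 B2] : B%:R <= X / b%:R < B.+1%:R by apply: truncn_itv; rewrite divr_ge0 ?ltW.
rewrite ler_pdivlMr // in B1; rewrite ltr_pdivrMr // in B2.
have n_ge : expR (b%:R - 1) <= n%:R :> R by rewrite -[X in _ <= X]lnK ?posrE // ler_expR.
(* This yields [B >= 6 b + C]. Here [C] is the size demanded from outside, and [6 b] exceeds [3 L],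
   so that rounding [X / b] down raises [lam] by at most 1. *)
have X_ge : (6 * b%:R + C + 1) * b%:R <= X.
  rewrite -(@ler_pXn2r R 2 isT) ?nnegrE ?(ltW X0) //; last first.
    by rewrite mulr_ge0 ?(ltW b0) //; lra.
  rewrite XX ler_pdivlMr //.
  have h1 : ((6 * b%:R + C + 1) * b%:R) ^+ 2 <= ((7%:R + C) ^+ 2 * b%:R ^+ 3) * b%:R.
    have -> : ((7%:R + C) ^+ 2 * b%:R ^+ 3) * b%:R = ((7%:R + C) * b%:R * b%:R) ^+ 2 by ring.
    apply: lerXn2r; rewrite ?nnegrE.
    - by rewrite mulr_ge0 ?(ltW b0) //; lra.
    - by rewrite !mulr_ge0 ?(ltW b0) //; lra.
    rewrite ler_wpM2r ?(ltW b0) //; have := mulr_ge0 C0 (_ : 0 <= b%:R - 1); rewrite mulrBr mulr1.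
    by move=> h; have := h _; rewrite mulrDl; lra.
  have h2 : (((6 : R) * b%:R + C + 1) * b%:R) ^+ 2 <= n%:R * b%:R.
    by apply: le_trans h1 _; rewrite ler_wpM2r ?(ltW b0) // (le_trans hb).
  apply: (@le_trans _ _ (n%:R * b%:R * (2 * b%:R))).
    by apply: ler_pM; rewrite ?sqr_ge0 ?(ltW L0) //; lra.
  have -> : n%:R * b%:R * (2 * b%:R) = n%:R * (2 * b%:R ^+ 2) :> R by ring.
  have -> : 4 * n%:R * N%:R = n%:R * (4 * N%:R) :> R by ring.
  by rewrite ler_wpM2l ?(ltW n0) //; lra.
clear hb n_ge; have B_ge : 6 * b%:R + C <= B%:R.
  have : (6 * b%:R + C + 1) * b%:R <= B.+1%:R * b%:R by apply: le_trans X_ge (ltW B2).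
  by rewrite ler_pM2r // -[B.+1%:R]natr1 lerD2r.
have BR0 : 0 < B%:R :> R by lra.
clear X_ge; clearbody B; exists B => nu lam.
have m0 : 0 < b%:R * B%:R :> R by rewrite mulr_gt0.
have mE : (b * B * (b * B))%:R = (b%:R * B%:R) ^+ 2 :> R by rewrite expr2 -!natrM.
have lamE : lam * (b%:R * B%:R) ^+ 2 = L * X ^+ 2.
  have nuE : nu * (b%:R * B%:R) ^+ 2 = n%:R.
    by rewrite /nu mE divfK // gt_eqF // exprn_gt0.
  rewrite /lam -mulrA nuE XX [RHS]mulrC divfK ?gt_eqF // natrM.
  by ring.
have mm0 : 0 < (b%:R * B%:R) ^+ 2 :> R by rewrite exprn_gt0.
clear Q0; have lam_ge : L <= lam.
  rewrite -(ler_pM2r mm0) lamE ler_wpM2l ?(ltW L0) //.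
  by apply: lerXn2r; rewrite ?nnegrE ?(ltW m0) ?(ltW X0) // mulrC.
have lam_le : lam <= L + 1.
  rewrite -(ler_pM2r mm0) lamE.
  have X_le : X <= b%:R * (B%:R + 1) by rewrite mulrC natr1 ltW.
  apply: (@le_trans _ _ (L * (b%:R * (B%:R + 1)) ^+ 2)).
    rewrite ler_wpM2l ?(ltW L0) //; apply: lerXn2r; rewrite ?nnegrE ?(ltW X0) //.
    by rewrite mulr_ge0 ?(ltW b0) //; lra.
  rewrite !exprMn mulrCA [X in _ <= X]mulrCA ler_wpM2l ?exprn_ge0 ?(ltW b0) //.
  have B6 : 3 * L <= B%:R by lra.
  have B1' : 1 <= B%:R :> R by lra.
  have h1 : 3 * L * B%:R <= B%:R ^+ 2 by rewrite expr2 ler_wpM2r // ltW.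
  have h2 : L * 1 <= L * B%:R by rewrite ler_wpM2l // ltW.
  have -> : L * (B%:R + 1) ^+ 2 = L * B%:R ^+ 2 + (2 * (L * B%:R) + L) by ring.
  have -> : (L + 1) * B%:R ^+ 2 = L * B%:R ^+ 2 + B%:R ^+ 2 by ring.
  by rewrite lerD2l; move: h1; rewrite -mulrA; lra.
clear lamE; have nuN : nu * (4 * N%:R) = lam by rewrite /lam natrM mulrC.
have nu0 : 0 <= nu by rewrite divr_ge0.
have lb2 : b%:R / 2 <= lam :> R by lra.
have lu2 : lam <= 2 * b%:R by lra.
have bb0 : 0 < b%:R ^+ 2 :> R by rewrite exprn_gt0.
split=> //; first lra.
- split.
    have h : nu * (8%:R * b%:R ^+ 2) <= 2 * b%:R.
      by apply: le_trans lu2; rewrite -nuN ler_wpM2l //; lra.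
    rewrite -(ler_pM2r (_ : 0 < 2 * b%:R)) ?mulr_gt0 // mul1r; apply: le_trans h.
    by rewrite le_eqVlt; apply/orP; left; apply/eqP; ring.
  have h : b%:R / 2 <= nu * (64%:R * b%:R ^+ 2).
    by apply: le_trans lb2 _; rewrite -nuN ler_wpM2l //; lra.
  rewrite -(ler_pM2r b0) mul1r.
  have -> : 128%:R * (nu * b%:R) * b%:R = 2 * (nu * (64%:R * b%:R ^+ 2)) by ring.
  by lra.
- rewrite -eL -!expRD; split; first by rewrite -expR0 ler_expR; lra.
  by rewrite ler_expR; lra.
Qed.

End GridParameters.

(** * Bad assignments are rare *)

Section GoodCells.
Variables n b B K : nat.
Local Notation W := K.*2.+1.

Definition bad_cells : {set {ffun 'I_n -> 'I_(b * B) * 'I_(b * B)}} :=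
  no_isolated_pair n b B :|: sparse_windows n b B K :|:
  (obstructed n b B W :|: [set f | transpose f \in obstructed n b B W]).

Lemma good_cellsP f : f \notin bad_cells -> good_cells b B K (fun i => coords (f i)).
Proof.
rewrite !in_setU !negb_or => /andP[/andP[iso sparse] /andP[h v]]; split.
- move: iso; rewrite inE negb_forall => /existsP[t /negPn]; exact: isolated_pair_low_degree.
- by move=> i j; apply: sparse_windowsP.
- by move=> /obstructedP; apply/negP.
move=> ob; move: v; rewrite inE => /negP; apply; apply: obstructedP.
rewrite (_ : (fun i => _) = (fun i => swap_coords (coords (f i)))) //.
by apply/boolp.funext => i; rewrite coords_transpose.
Qed.

End GoodCells.

Section BadCells.
Local Open Scope ring_scope.

Lemma pr_bad_cells (R : realType) (eps : R) : 0 < eps ->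
  exists n0, forall n, (n0 <= n)%N -> exists b B,
    [/\ (1 < n)%N, (0 < b)%N, (128.*2 < B)%N & pr R (bad_cells n b B 128) <= eps].
Proof.
move=> eps0; set K := 128%N; pose W := K.*2.+1.
have [G _ G_ge] := @sum_exprn_expR R (128%:R * (W + 4)%:R) 9 (ltac:(by rewrite mulr_gt0 ?ltr0n)).
(* With [W = 257], the value [523 = 2 (W + 4) + 1] is what the condition [2 (W b + 4 b) < b B]
   requires of [B]. *)
pose C : R := 523%:R; pose D : R := 256%:R * expR 1 * (7%:R + C) ^+ 2.
pose total := isolated_const R + window_const R K +
  (first_moment_const W G + first_moment_const W G).
pose M : R := 2 + D + (total / eps) ^+ 2.
have D0 : 0 <= D := mulr_ge0 (mulr_ge0 (ler0n _ _) (expR_ge0 _)) (sqr_ge0 _).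
have T2 : 0 <= (total / eps) ^+ 2 := sqr_ge0 _.
have [M2 MD MT] : [/\ 2 <= M, D <= M & (total / eps) ^+ 2 <= M].
  rewrite /M; move: (D) D0 (_ ^+ 2) T2; clear => u u0 v v0; split; lra.
clearbody M; exists (Num.truncn (expR M)).+1 => n nM.
have n_M : expR M < n%:R.
  have /andP[_ h] := truncn_itv (ltW (expR_gt0 M)).
  by apply: lt_le_trans h _; rewrite ler_nat.
have n0 : 0 < n%:R :> R by apply: lt_trans n_M; exact: expR_gt0.
have n_gt0 : (0 < n)%N by rewrite -(ltr0n R).
have lnM : M < ln n%:R by rewrite -ltr_expR lnK // posrE.
have ln0 : 0 <= ln n%:R :> R by apply: le_trans (ltW lnM); apply: le_trans M2.
have /andP[b1 b2] := truncn_itv ln0.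
set b := (Num.truncn (ln (n%:R : R))).+1 in b2.
have lb : ln n%:R <= b%:R :> R by exact: ltW.
have ub : b%:R - 1 <= ln n%:R :> R by rewrite -natr1 addrK.
have Mb : M <= b%:R by apply: ltW; apply: lt_le_trans lb.
have b_ge2 : (2 <= b)%N by rewrite -(ler_nat R) (le_trans M2).
have b_gt0 : (0 < b)%N by apply: leq_trans b_ge2.
have b_1 : 1 <= b%:R :> R by rewrite ler1n.
have Db : 256%:R * expR 1 * (7%:R + C) ^+ 2 <= b%:R.
  exact: le_trans MD Mb.
have C0 : 0 <= C by exact: ler0n.
have [B [CB [nu1 nu2] [lam1 lam2] lam3 lam4]] := grid_parameters b_ge2 n_gt0 lb ub C0 Db.
have B523 : (523 <= B)%N by rewrite -(ler_nat R).
have n_exp : expR (b%:R - 1) <= n%:R :> R by rewrite -[X in _ <= X]lnK ?posrE // ler_expR.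
have n_cube : (7%:R + C) ^+ 2 * b%:R ^+ 3 <= n%:R := le_trans (cube_le_expR b_gt0 Db) n_exp.
have cube1 : b%:R ^+ 2 <= b%:R ^+ 3 :> R by apply: ler_weXn2l.
have square1 : 1 <= b%:R ^+ 2 :> R by apply: exprn_ege1.
have n_square : (530%:R * b%:R) ^+ 2 <= n%:R :> R.
  apply: le_trans n_cube; rewrite exprMn; apply: ler_pM; rewrite ?exprn_ge0 //.
  by rewrite /C -natrD.
have b530 : 530%:R <= 530%:R * b%:R :> R by rewrite ler_peMr.
have n_ge : (3 * K <= n)%N.
  rewrite -(ler_nat R); apply: le_trans n_square; apply: (@le_trans _ _ (530%:R * b%:R)).
    by apply: le_trans b530; rewrite ler_nat.
  by rewrite expr2 ler_peMr // (le_trans _ b530) // ler1n.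
have n_big : (2 * b%:R + 50%:R) ^+ 2 <= n%:R :> R.
  apply: le_trans n_square; move: (b%:R : R) b_1; clear => t t1.
  by apply: lerXn2r; rewrite ?nnegrE; lra.
have n6 : (6 <= n)%N by apply: leq_trans n_ge.
exists b, B; split=> //; first exact: leq_trans n6.
  exact: leq_trans B523.
have b0 : 0 < b%:R :> R by rewrite ltr0n.
have s0 : 0 < Num.sqrt b%:R :> R by rewrite sqrtr_gt0.
have mlarge : (2 * (W * b + 4 * b) < b * B)%N.
  by rewrite -mulnDl mulnA [X in (_ < X)%N]mulnC ltn_pmul2r // (leq_trans _ B523).
have T0 : (0 < #|{: 'I_(b * B) * 'I_(b * B)}|)%N.
  apply: cells_gt0; by rewrite muln_gt0 b_gt0 (leq_trans _ B523).
have B16 : (16 <= B)%N by apply: leq_trans B523.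
have iso := pr_no_isolated_pair b_gt0 B16 (leq_trans (isT : (4 <= 6)%N) n6) nu1 lam3 lam4 n_big lam2.
have sparse := pr_sparse_windows b_gt0 (leqnn K) n_ge (leq_trans (isT : (0 < 523)%N) B523) nu1 nu2 lam1 n_exp.
have ob := pr_obstructed_le b_gt0 (isT : (0 < W)%N) n6 mlarge nu1 nu2 lam1 lam3 G_ge.
have h : pr R (bad_cells n b B K) <= total / Num.sqrt b%:R.
  have obT := ob; rewrite -pr_transpose in obT.
  have U1 := le_trans (pr_setU R T0 _ _) (lerD iso sparse).
  have U2 := le_trans (pr_setU R T0 _ _) (lerD ob obT).
  apply: le_trans (le_trans (pr_setU R T0 _ _) (lerD U1 U2)) _.
  by rewrite /total -!mulrDl.
apply: le_trans h _; rewrite ler_pdivrMr // mulrC -ler_pdivrMr //.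
apply: le_trans (ler_norm _) _; rewrite -sqrtr_sqr ler_sqrt ?(ltW b0) //.
exact: le_trans Mb.
Qed.

End BadCells.

(** * Uniform points *)

From mathcomp Require Import finmap all_classical all_reals all_analysis.
From mathcomp Require Import measurable_realfun.



Import numFieldNormedType.Exports.

Local Open Scope classical_set_scope.
Local Open Scope ring_scope.

Section GeometricGraphRadius.
Variables (R : realType) (n : nat) (x : 'I_n -> R * R).

(* Rational radii suffice to describe the hitting radius, which makes it
   measurable. *)
Lemma geometric_graph_right_constant (r c : R) : r < c ->
  exists q : rat, [/\ r <= ratr q, ratr q < c &
    geometric_graph x (ratr q) = geometric_graph x r].
Proof.
move=> rc; pose dist (ij : 'I_n * 'I_n) := euclidean_dist (x ij.1) (x ij.2).
pose c' := \big[Order.min/c]_(ij | r < dist ij) dist ij.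
have rc' : r < c' by apply: lt_bigmin.
have [q] := rat_in_itvoo rc'; rewrite in_itv /= => /andP[rq qc'].
exists q; split; [exact: ltW|exact: lt_le_trans qc' (bigmin_le_id _ _ _ _)|].
apply/setP => e; rewrite !inE; apply: eq_existsb => i; apply: eq_existsb => j.
congr (_ && (_ && _)); apply/idP/idP => [dq|dr]; last exact: le_trans (ltW rq).
rewrite leNgt; apply/negP => rd.
have : c' <= dist (i, j) by exact: bigmin_le_cond.
by rewrite leNgt => /negP; apply; exact: le_lt_trans qc'.
Qed.

Lemma hitting_radius_lt (Q : graph_property) (c : R) :
  (hitting_radius Q x < c%:E)%E <->
  exists q : rat, [/\ 0 <= ratr q :> R, ratr q < c & Q _ (geometric_graph x (ratr q))].
Proof.
split=> [/ereal_inf_lt[_ [r [r0 Qr] <-]]|[q [q0 qc Qq]]].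
  rewrite lte_fin => /geometric_graph_right_constant[q [rq qc qE]].
  by exists q; rewrite qE; split => //; apply: le_trans rq.
apply: le_lt_trans (_ : ((ratr q)%:E < _)%E); last by rewrite lte_fin.
by apply: ereal_inf_lbound; exists (ratr q).
Qed.

End GeometricGraphRadius.

(** * Measurability of the hitting radii *)

Section Measurability.
Context d (T : measurableType d) (R : realType).

Lemma measurable_finite_pred (U : finType) (h : T -> U) (Q : U -> Prop) :
  (forall u, measurable [set w | h w = u]) -> measurable [set w | Q (h w)].
Proof.
move=> mh; rewrite (_ : [set w | Q (h w)] = \bigcup_(u in [set u | Q u]) [set w | h w = u]).
  by apply: fin_bigcup_measurable => // u _; exact: mh.
by apply/seteqP; split=> [w Qw|w [u Qu /= ->]]; first by exists (h w).
Qed.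

Lemma measurable_finset_valued (U : finType) (h : T -> {set U}) :
  (forall u, measurable [set w | u \in h w]) -> forall A, measurable [set w | h w = A].
Proof.
move=> mh A.
rewrite (_ : [set w | h w = A] = \bigcap_(u in setT) [set w | (u \in h w) = (u \in A)]).
  apply: fin_bigcap_measurable => // u _; case: (u \in A); first exact: mh.
  rewrite (_ : [set w | _] = ~` [set w | u \in h w]); first exact: measurableC.
  by apply/seteqP; split=> w /=; [move=> ->|move/negP/negbTE].
apply/seteqP; split=> w /=; first by move=> hA u _ /=; rewrite hA.
by move=> wA; apply/setP => u; exact: (wA u I).
Qed.

Variables (n : nat) (x : 'I_n -> T -> R * R).
Hypothesis mx : forall i, measurable_fun setT (x i).

Lemma measurable_dist i j (r : R) :
  measurable [set w | euclidean_dist (x i w) (x j w) <= r].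
Proof.
have m1 k : measurable_fun setT (fun w => (x k w).1).
  exact: measurableT_comp measurable_fst (mx k).
have m2 k : measurable_fun setT (fun w => (x k w).2).
  exact: measurableT_comp measurable_snd (mx k).
have md : measurable_fun setT (fun w => euclidean_dist (x i w) (x j w)).
  apply: (measurableT_comp (continuous_measurable_fun (@sqrt_continuous R))).
  by apply: measurable_funD; apply: measurable_realfun.measurable_funX; apply: measurable_realfun.measurable_funB.
rewrite -[X in measurable X]setTI.
have := md measurableT `]-oo, r]%classic (measurable_itv _).
by congr (measurable (_ `&` _)); apply/seteqP; split=> w /=; rewrite in_itv.
Qed.

(** The graph takes finitely many values, each on an event defined by distance inequalities, so
    every predicate of it is measurable, even one that quantifies over strategies. *)
Lemma measurable_geometric_graph_pred (Q : graph 'I_n -> Prop) (r : R) :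
  measurable [set w | Q (geometric_graph (x^~ w) r)].
Proof.
apply: (@measurable_finite_pred _ (fun w => geometric_graph (x^~ w) r)).
apply: measurable_finset_valued => e.
rewrite (_ : [set w | _] = \bigcup_(ij in [set ij | (ij.1 != ij.2) && (e == [set ij.1; ij.2]%SET)])
    [set w | euclidean_dist (x ij.1 w) (x ij.2 w) <= r]).
  by apply: fin_bigcup_measurable => [|ij _]; [exact: finite_finset|exact: measurable_dist].
apply/seteqP; split=> w /=; rewrite inE.
  by move=> /existsP[i /existsP[j /and3P[ij d_r eE]]]; exists (i, j) => //=; rewrite ij.
case=> -[i j] /= /andP[ij eE] d_r.
by apply/existsP; exists i; apply/existsP; exists j; rewrite ij d_r.
Qed.

Lemma measurable_hitting_radius (Q : graph_property) :
  measurable_fun setT (fun w => hitting_radius Q (x^~ w)).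
Proof.
apply: (measurability (@ErealGenInftyO.G R)).
  exact: ErealGenInftyO.measurableE.
move=> _ [_ [c ->] <-]; rewrite setTI.
rewrite (_ : _ @^-1` _ = \bigcup_(q : rat)
    [set w | [/\ 0 <= ratr q :> R, ratr q < c & Q _ (geometric_graph (x^~ w) (ratr q))]]).
  apply: bigcupT_measurable_rat => q.
  have [q0|q0] := boolP ((0 <= ratr q :> R) && (ratr q < c)); last first.
    rewrite (_ : [set w | _] = set0); first exact: measurable0.
    by apply/seteqP; split=> w //= -[h1 h2 _]; move: q0; rewrite h1 h2.
  rewrite (_ : [set w | _] = [set w | Q _ (geometric_graph (x^~ w) (ratr q))]).
    exact: measurable_geometric_graph_pred.
  by move/andP: q0 => [h1 h2]; apply/seteqP; split=> w /=; [case|split].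
apply/seteqP; split=> w /=; rewrite in_itv /=.
  by move=> /hitting_radius_lt[q h]; exists q.
by case=> q _ h; apply/hitting_radius_lt; exists q.
Qed.

End Measurability.

Lemma in_cell_inj (R : realType) m p q (y : R * R) :
  in_cell m p y -> in_cell m q y -> p = q.
Proof.
have coord i j (a : R) : i%:R <= a < i%:R + 1 -> j%:R <= a < j%:R + 1 -> i = j.
  move=> /andP[i1 i2] /andP[j1 j2]; apply/eqP; rewrite eqn_leq.
  by apply/andP; split; rewrite -ltnS -(ltr_nat R) -natr1;
    [exact: le_lt_trans j2|exact: le_lt_trans i2].
case: p q => [p1 p2] [q1 q2] [/= h1 h2] [/= h3 h4].
by rewrite (coord _ _ _ h1 h3) (coord _ _ _ h2 h4).
Qed.

(** * The law of the cells of uniform points *)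

Section CellLaw.
Context d (T : measurableType d) (R : realType) (P : probability T R).

(** Half-open intervals make the cells disjoint; two sides of the square, a null set, are then in no
    cell. *)
Definition grid_itv (m i : nat) : set R := `[i%:R / m%:R, i.+1%:R / m%:R[%classic.

Lemma lebesgue_grid_itv m i : (0 < m)%N ->
  lebesgue_measure (grid_itv m i) = (m%:R^-1)%:E.
Proof.
move=> m0; have mR : 0 < m%:R :> R by rewrite ltr0n.
rewrite /grid_itv lebesgue_measure_itv /= lte_fin ltr_pM2r ?invr_gt0 // ltr_nat ltnSn.
by rewrite -EFinB -mulrBl -natr1 addrAC subrr add0r mul1r.
Qed.

Lemma in_cellE m (p : nat * nat) : (0 < m)%N ->
  [set y : R * R | in_cell m p y] = grid_itv m p.1 `*` grid_itv m p.2.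
Proof.
move=> m0; have mR : 0 < m%:R :> R by rewrite ltr0n.
have itvE i (y : R) : (i%:R <= m%:R * y < i%:R + 1) = (y \in `[i%:R / m%:R, i.+1%:R / m%:R[).
  by rewrite in_itv /= ler_pdivrMr // ltr_pdivlMr // natr1 [y * _]mulrC.
by apply/seteqP; split=> y; rewrite /in_cell /= !itvE.
Qed.

Lemma measurable_cell m (p : nat * nat) : (0 < m)%N ->
  measurable [set y : R * R | in_cell m p y].
Proof. by move=> m0; rewrite in_cellE //; apply: measurableX; apply: measurable_itv. Qed.

Lemma uniform_cell (X : {RV P >-> (R * R)%type}) m (z : 'I_m * 'I_m) :
  uniform_on_unit_square X ->
  P (X @^-1` [set y | in_cell m (coords z) y]) = ((m * m)%:R^-1)%:E.
Proof.
move=> unif; have m0 : (0 < m)%N by case: z => -[i im] _; exact: leq_ltn_trans im.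
have mR : 0 < m%:R :> R by rewrite ltr0n.
have sub (i : 'I_m) : grid_itv m i `<=` `[0, 1].
  move=> y; rewrite /grid_itv /= !in_itv /= => /andP[y1 y2]; apply/andP; split.
    by apply: le_trans y1; rewrite divr_ge0.
  by apply: ltW; apply: lt_le_trans y2 _; rewrite ler_pdivrMr // mul1r ler_nat.
have := unif _ (measurable_cell (coords z) m0).
rewrite /distribution /pushforward => ->; rewrite in_cellE // setIidl; last first.
  by apply: setSX => /=; exact: sub.
rewrite product_measure1E; [|exact: measurable_itv|exact: measurable_itv].
apply: etrans (congr2 mule (lebesgue_grid_itv _ m0) (lebesgue_grid_itv _ m0)) _.
by rewrite -EFinM natrM invfM.
Qed.

Variable X : nat -> {RV P >-> (R * R)%type}.
Hypothesis X_indep : mutually_independent X.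
Hypothesis X_unif : forall i, uniform_on_unit_square (X i).

Variables (n m : nat).
Hypothesis m_gt0 : (0 < m)%N.

Definition cell_event (f : {ffun 'I_n -> 'I_m * 'I_m}) : set T :=
  [set w | forall i : 'I_n, in_cell m (coords (f i)) (X i w)].

Lemma cell_event_bigcap f : cell_event f =
  \bigcap_(i in [set: 'I_n]) (X i @^-1` [set y | in_cell m (coords (f i)) y]).
Proof. by apply/seteqP; split=> w h i => [_|]; [exact: h|exact: (h i I)]. Qed.

Lemma measurable_cell_event f : measurable (cell_event f).
Proof.
rewrite cell_event_bigcap; apply: fin_bigcap_measurable => // i _.
by apply: measurable_funPTI => //; exact: measurable_cell.
Qed.

Lemma prob_cell_event f : P (cell_event f) = (((m * m)%:R ^+ n)^-1)%:E.
Proof.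
(* Independence is stated for sets indexed by all naturals, so the family is extended by the whole
   plane beyond [n]. *)
pose A i := if insub i is Some j then [set y : R * R | in_cell m (coords (f j)) y] else setT.
have mA i : measurable (A i) by rewrite /A; case: insub => // j; exact: measurable_cell.
have AE (i : 'I_n) : A i = [set y : R * R | in_cell m (coords (f i)) y].
  by rewrite /A valK.
pose J := [fset i in iota 0 n]%fset.
have := X_indep J mA.
have -> : \bigcap_(i in [set` J]) (X i @^-1` A i) = cell_event f.
  apply/seteqP; split=> w /= h.
    by move=> i; have := h i; rewrite /= AE; apply; rewrite !inE mem_iota /=.
  move=> i; rewrite /= !inE mem_iota /= => i_n.
  have -> : i = Ordinal i_n by [].
  by rewrite AE; exact: h.
move=> ->; rewrite (perm_big (index_iota 0 n)) /=; last first.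
  by apply: uniq_perm; rewrite ?iota_uniq ?fset_uniq // => i; rewrite !inE /= mem_index_iota mem_iota.
rewrite big_mkord.
rewrite (eq_bigr (fun=> ((m * m)%:R^-1)%:E)) => [|i _]; last by rewrite AE uniform_cell.
by rewrite prodEFin prodr_const card_ord exprVn.
Qed.

Lemma trivIset_cell_event (D : set {ffun 'I_n -> 'I_m * 'I_m}) : trivIset D cell_event.
Proof.
move=> f g _ _ [w [hf hg]]; apply/ffunP => i; apply: coords_inj.
by apply: in_cell_inj (hf i) (hg i).
Qed.

Lemma prob_cell_events (A : {set {ffun 'I_n -> 'I_m * 'I_m}}) :
  P (\bigcup_(f in [set` A]) cell_event f) = (pr R A)%:E.
Proof.
rewrite measure_fin_bigcup //; last 2 first.
- exact: trivIset_cell_event.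
- by move=> f _; exact: measurable_cell_event.
rewrite (@fsbigE _ _ _ _ _ (enum A)) ?enum_uniq //; last 2 first.
- by move=> f; rewrite /= mem_enum.
- by move=> f; rewrite /= mem_enum => ->.
rewrite (eq_bigr (fun=> (((m * m)%:R ^+ n)^-1)%:E)) => [|f _]; last exact: prob_cell_event.
rewrite (eq_bigl (mem A)) => [|f]; last by rewrite mem_setE.
rewrite big_enum_cond /= sumEFin.
rewrite (eq_bigl (mem A)) => [|f]; last by rewrite andbb.
by rewrite sumr_const /pr card_prod card_ord [X in _ = (X)%:E]mulr_natl.
Qed.

End CellLaw.

Section HittingRadiiEvent.
Context d (T : measurableType d) (R : realType) (P : probability T R).
Variable X : nat -> {RV P >-> (R * R)%type}.

Definition hitting_radii_equal (n : nat) : set T := [set w |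
  hitting_radius maker_wins_connectivity (fun i : 'I_n => X i w) =
  hitting_radius (min_degree_ge 2) (fun i : 'I_n => X i w)].

Lemma measurable_hitting_radii_equal n : measurable (hitting_radii_equal n).
Proof.
have mX (i : 'I_n) : measurable_fun setT (X i : T -> R * R) by [].
rewrite /hitting_radii_equal -[X in measurable X]setTI.
by apply: measurable_eqe => //; exact: (measurable_hitting_radius mX).
Qed.

Hypothesis X_indep : mutually_independent X.
Hypothesis X_unif : forall i, uniform_on_unit_square (X i).

(** The good assignments give disjoint events inside the target, and their total probability is
    [1 - pr] of the bad assignments. A lower bound is all that is wanted, so points outside every
    cell do no harm. *)
Lemma prob_hitting_radii_equal (eps : R) : 0 < eps -> exists n0, forall n,
  (n0 <= n)%N -> ((1 - eps)%:E <= P (hitting_radii_equal n))%E.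
Proof.
move=> /pr_bad_cells[n0 h]; exists n0 => n /h[b [B [n1 b0 B1 bad]]].
have m0 : (0 < b * B)%N by rewrite muln_gt0 b0 (leq_trans _ B1).
have sub : \bigcup_(f in [set` (~: bad_cells n b B 128)%SET]) cell_event X f `<=` hitting_radii_equal n.
  move=> w [f /=]; rewrite finset.in_setC => /good_cellsP good cells.
  apply: (hitting_radius_eq (g := fun i => coords (f i)) b0 (isT : (0 < 128)%N) _ B1) => // i.
  by split; exact: ltn_ord.
apply: (@le_trans _ _ (pr R (~: bad_cells n b B 128)%SET)%:E).
  by rewrite lee_fin pr_setC ?cells_gt0 // lerB.
rewrite -(prob_cell_events X_indep X_unif m0); apply: le_measure => //; rewrite inE.
  by apply: fin_bigcup_measurable => // f _; exact: measurable_cell_event.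
exact: measurable_hitting_radii_equal.
Qed.

End HittingRadiiEvent.

Theorem theorem1p1 (R : realType) (d : measure_display) (T : measurableType d)
    (P : probability T R) (X : nat -> {RV P >-> (R * R)%type})
    (X_indep : mutually_independent X)
    (X_unif : forall i : nat, uniform_on_unit_square (X i)) :
  (fun n : nat => P [set w : T |
     hitting_radius maker_wins_connectivity (fun i : 'I_n => X i w) =
     hitting_radius (min_degree_ge 2) (fun i : 'I_n => X i w)])
    @ \oo --> 1%E.
Proof.
have fin n : P (hitting_radii_equal X n) \is a fin_num by exact: fin_num_measure (measurable_hitting_radii_equal X n).
apply/fine_cvgP; split; first by apply: nearW => n; exact: fin.
apply/cvgrPdist_le => eps /(prob_hitting_radii_equal X_indep X_unif)[n0 h].
exists n0 => // n /h lower; rewrite /= -/(hitting_radii_equal X n) ger0_norm.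
  by rewrite lerBlDr -lerBlDl -lee_fin fineK.
rewrite subr_ge0 -lee_fin fineK //; apply: probability_le1.
exact: measurable_hitting_radii_equal.
Qed.
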